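(* Let $M>0$, let $f_0\in\mathcal F_M$ be a minimizer of $\mathcal H$ over $\mathcal F_M$, and let $U_0:=U_{f_0}$ be the potential induced by $f_0$. Put $$E=E(x,v):=\tfrac12|v|^2+U_0(x),\qquad \lambda_0:=\frac{\iint E\,f_0\,dv\,dx}{\iint Q'(f_0)\,f_0\,dv\,dx},\qquad E_0:=\lambda_0Q'(0).$$ Then $\lambda_0<0$ and, with $$\phi(\eta):=\inf\{s\ge0\mid Q'(s)=\eta/\lambda_0\},\qquad \eta\le E_0,$$ one has for almost every $(x,v)\in\mathbb R^6$ $$f_0(x,v)=\begin{cases}\phi(E(x,v)),&E(x,v)<E_0,\\0,&E(x,v)\ge E_0.\end{cases}$$ In particular, $f_0$ is a steady state of the Vlasov-Poisson system.
   Context: Variables: $x,v\in\mathbb R^3$. For a measurable $f=f(x,v)$ let $\rho_f(x):=\int f(x,v)\,dv$ and $U_f:=-\rho_f*\frac1{|\cdot|}$ (convolution on $\mathbb R^3$). Define $E_{\rm kin}(f):=\frac12\iint|v|^2f\,dv\,dx$, $E_{\rm pot}(f):=-\frac1{8\pi}\int|\nabla U_f|^2dx=-\frac12\iint\frac{\rho_f(x)\rho_f(y)}{|x-y|}dx\,dy$, $\mathcal H(f):=E_{\rm kin}(f)+E_{\rm pot}(f)$, and $\mathcal C(f):=\iint Q(f(x,v))\,dv\,dx$. Standing assumptions on $Q$: $Q\in C^1([0,\infty))$, $Q\ge0$, $Q(0)=0$; (Q1) $Q(f)\ge C(f+f^{1+1/k})$ for all $f\ge0$, with constants $C>0$ and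 $0<k<7/2$; (Q2) $Q$ is convex. For $M>0$, $\mathcal F_M:=\{f\in L^1(\mathbb R^6)\mid f\ge0,\ \mathcal C(f)=M,\ E_{\rm kin}(f)<\infty\}$. A minimizer is an $f_0\in\mathcal F_M$ with $\mathcal H(f_0)=\inf_{\mathcal F_M}\mathcal H$. The Vlasov-Poisson system is $\partial_tf+v\cdot\partial_xf-\partial_xU\cdot\partial_vf=0$, $\Delta U=4\pi\rho$, $\lim_{|x|\to\infty}U(t,x)=0$, $\rho(t,x)=\int f(t,x,v)\,dv$. A steady state is a time-independent solution. Since the particle energy $E=\frac12|v|^2+U_0(x)$ is conserved along characteristics of the Vlasov equation with time-independent potential $U_0$, the Vlasov equation for a time-independent $f_0$ is understood to be satisfied when $f_0$ is (a.e.) a function of $E$, with $U_0=U_{f_0}$. *)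

(* Defs.v *)
From HB Require Import structures.
From mathcomp Require Import all_boot all_order all_algebra.
From mathcomp Require Import all_classical all_reals all_analysis.

Set Implicit Arguments.
Unset Strict Implicit.
Unset Printing Implicit Defensive.

Import Order.TTheory GRing.Theory Num.Theory.
Import numFieldNormedType.Exports.

Local Open Scope classical_set_scope.
Local Open Scope ring_scope.

(* The library's canonical structures on [m1 \x m2] do not give sigma-finiteness
   for general sigma-finite factors (that instance is shadowed by the one for
   subprobabilities), but [leb3 \x leb3] below needs it. *)
Lemma product_sigma_finite d1 d2 (T1 : measurableType d1)
    (T2 : measurableType d2) (R : realType)
    (m1 : {sigma_finite_measure set T1 -> \bar R})
    (m2 : {sigma_finite_measure set T2 -> \bar R}) :
  sigma_finite setT (m1 \x m2)%E.
Proof.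
have /sigma_finiteP[F [TF ndF Foo]] := sigma_finiteT m1.
have /sigma_finiteP[G [TG ndG Goo]] := sigma_finiteT m2.
exists (fun n => F n `*` G n).
  rewrite -setXTT TF TG predeqE => -[x y]; split.
    move=> [/= [n _ Fnx] [k _ Gky]]; exists (maxn n k) => //; split.
    - by move: x Fnx; exact/subsetPset/ndF/leq_maxl.
    - by move: y Gky; exact/subsetPset/ndG/leq_maxr.
  by move=> [n _ []/= ? ?]; split; exists n.
move=> k; have [? ?] := Foo k; have [? ?] := Goo k.
split; first exact: measurableX.
by rewrite product_measure1E// lte_mul_pinfty// ge0_fin_numE.
Qed.

(* R^3 as a triple product: it carries the Borel sigma-algebra and the product
   topology.  The norm that [vec3 R] inherits from the library is the sup norm,
   so the Euclidean norm is always written [enorm]. *)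
Notation vec3 R := (measurableTypeR R * measurableTypeR R * measurableTypeR R)%type.

(* A point of phase space R^6 is a pair (x, v). *)
Notation phase R := (vec3 R * vec3 R)%type.

Section lebesgue.
Variable R : realType.

Definition leb2 : set (measurableTypeR R * measurableTypeR R) -> \bar R :=
  (@lebesgue_measure R \x @lebesgue_measure R)%E.
HB.instance Definition _ := Measure.on leb2.
HB.instance Definition _ := Measure_isSigmaFinite.Build _ _ _ leb2
  (product_sigma_finite (@lebesgue_measure R) (@lebesgue_measure R)).

Definition leb3 : set (vec3 R) -> \bar R := (leb2 \x @lebesgue_measure R)%E.
HB.instance Definition _ := Measure.on leb3.
HB.instance Definition _ := Measure_isSigmaFinite.Build _ _ _ leb3
  (product_sigma_finite leb2 (@lebesgue_measure R)).

Definition leb6 : set (phase R) -> \bar R := (leb3 \x leb3)%E.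
HB.instance Definition _ := Measure.on leb6.
HB.instance Definition _ := Measure_isSigmaFinite.Build _ _ _ leb6
  (product_sigma_finite leb3 leb3).

Definition enorm (x : vec3 R) : R :=
  Num.sqrt (x.1.1 ^+ 2 + x.1.2 ^+ 2 + x.2 ^+ 2).

End lebesgue.
Arguments leb2 {R}.
Arguments leb3 {R}.
Arguments leb6 {R}.

Section halfline.
Variable R : realType.

Definition hquot (Q : R -> R) (s h : R) : R := h^-1 * (Q (s + h) - Q s).

(* Increments that stay inside [0, +oo[: two-sided near 0 if s > 0, one-sided
   if s = 0, so that values of Q on negative reals are irrelevant. *)
Definition hincr (s : R) : set_system R := within [set h | 0 <= s + h] 0^'.

Definition hderive (Q : R -> R) (s : R) : R := lim (hquot Q s @ hincr s).

(* Q \in C^1([0, +oo[). *)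
Definition hC1 (Q : R -> R) : Prop :=
  (forall s : R, 0 <= s -> cvg (hquot Q s @ hincr s)) /\
  {within `[0, +oo[%classic, continuous (hderive Q)}.

End halfline.

Section functionals.
Variable R : realType.
Implicit Types (Q : R -> R) (f : phase R -> R) (U rho : vec3 R -> R).

(* [Rintegral] is 0 where the integral diverges; for integrable f this
   affects only a null set of x. *)
Definition density f (x : vec3 R) : R := (\int[leb3]_v f (x, v))%R.

Definition potential f (x : vec3 R) : R :=
  - (\int[leb3]_y (density f y / enorm (x - y)))%R.

Definition Ekin f : \bar R :=
  ((1 / 2)%:E * \int[leb6]_z (enorm z.2 ^+ 2 * f z)%:E)%E.

(* The Coulomb form of the potential energy; [z] ranges over pairs of
   positions here. *)
Definition Epot f : \bar R :=
  (- ((1 / 2)%:E * \int[leb6]_z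
        (density f z.1 * density f z.2 / enorm (z.1 - z.2))%:E))%E.

Definition Hamiltonian f : \bar R := (Ekin f + Epot f)%E.

Definition Casimir Q f : \bar R := (\int[leb6]_z (Q (f z))%:E)%E.

(* Elements of L^1(R^6) are given by Borel representatives which are
   nonnegative everywhere; every nonnegative class has one. *)
Definition admissible Q (M : R) f : Prop :=
  [/\ leb6.-integrable setT (EFin \o f), (forall z, 0 <= f z),
      Casimir Q f = M%:E & (Ekin f < +oo)%E].

Definition minimizer Q (M : R) f : Prop :=
  admissible Q M f /\
  Hamiltonian f = ereal_inf [set Hamiltonian g | g in admissible Q M].

Definition particle_energy U (z : phase R) : R :=
  1 / 2 * enorm z.2 ^+ 2 + U z.1.

Fixpoint Cn (n : nat) (psi : vec3 R -> R) : Prop :=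
  continuous psi /\
  if n is m.+1 then
    forall e : vec3 R, (forall x, derivable psi x e) /\ Cn m ('D_e psi)
  else True.

(* C_c^oo(R^3) *)
Definition test_function (psi : vec3 R -> R) : Prop :=
  (forall n, Cn n psi) /\ exists r, forall x, r < enorm x -> psi x = 0.

Definition laplacian (psi : vec3 R -> R) (x : vec3 R) : R :=
  'D_(1, 0, 0) ('D_(1, 0, 0) psi) x +
  'D_(0, 1, 0) ('D_(0, 1, 0) psi) x +
  'D_(0, 0, 1) ('D_(0, 0, 1) psi) x.

Definition locally_L1 (u : vec3 R -> R) : Prop :=
  forall r : R, leb3.-integrable [set x | enorm x <= r] (EFin \o u).

(* Delta U = 4 pi rho in the sense of distributions: rho is only determined
   almost everywhere. *)
Definition poisson U rho : Prop :=
  [/\ locally_L1 U, locally_L1 rho &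
      forall psi, test_function psi ->
        (\int[leb3]_x (U x * laplacian psi x))%R =
        4 * pi * (\int[leb3]_x (rho x * psi x))%R].

Definition vanishes_at_infinity U : Prop :=
  forall e : R, 0 < e -> exists r, forall x, r <= enorm x -> `|U x| < e.

(* The stationary Vlasov equation is read, for f of low regularity, as: f is
   a.e. a function of the particle energy, which is constant along the
   characteristics. *)
Definition stationary_vlasov f U : Prop :=
  exists g : R -> R, {ae leb6, forall z, f z = g (particle_energy U z)}.

Definition steady_state f U : Prop :=
  [/\ stationary_vlasov f U, poisson U (density f) & vanishes_at_infinity U].

End functionals.

(* Main.v *)
(* The competitors Q^-1(Q(f0) + t h), with h bounded, of integral 0 and supported
   in a box where f0 is bounded below on {h < 0}, satisfy the Casimir constraint
   exactly, and their first variation is the integral of E h / Q'(f0).  Hence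
   there is a lambda with E = lambda Q'(f0) on {f0 > 0} and E >= lambda Q'(f0)
   elsewhere.  E is negative on a set of positive measure, so lambda < 0.  Level
   sets of E are null sets, so the countably many values of Q' taken on intervals
   play no role and the infimum defining phi is f0.  For the steady state, the
   relation between f0 and E bounds the density by a power n = k + 3/2 < 5 of the
   potential; iterating Young's inequality improves its integrability beyond
   L^{3/2}, so the potential vanishes at infinity.  The Poisson equation follows
   from the Plummer regularization (e^2 + |x|^2)^(-1/2) of the kernel, whose
   Laplacian is -3 e^2 (e^2 + |x|^2)^(-5/2). *)
Require Import Defs.
From HB Require Import structures.
From mathcomp Require Import all_boot all_order all_algebra.
From mathcomp Require Import all_classical all_reals all_analysis.
From mathcomp Require Import measurable_realfun real_interval ring lra.

Set Implicit Arguments.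
Unset Strict Implicit.
Unset Printing Implicit Defensive.

Import Order.TTheory GRing.Theory Num.Theory.
Import numFieldNormedType.Exports.

Local Open Scope classical_set_scope.
Local Open Scope ring_scope.

(** * Measurability on R^3 *)

Section measurability.
Context {R : realType}.

(** The Casimir constraint is nonlinear and has to hold exactly along a competitor. Growth and
    convexity give Q' >= C > 0, so Q has a Lipschitz inverse, and a linear motion in the variable
    Q(f) conserves the constraint; the Lipschitz bound also dominates the difference quotients. On
    boxes the kinetic weight is bounded and the kernel has uniformly bounded integrals, so E is
    integrable there and the remainder of the Coulomb form is O(t^2). This much is done over an
    abstract symmetric kernel. The bound k < 7/2 makes the Coulomb energy finite: interpolating the
    kinetic energy against the integral of f^(1 + 1/k) puts the density in L^(1 + 1/n), n = k + 3/2
    < 5, strictly above the critical exponent 6/5. The slack allows cutting the kernel at a finite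
    range: its near part has integrable q-th powers for q < 3 and its far part is bounded, so
    elementary Young inequalities replace that of Hardy-Littlewood-Sobolev. Real integrals have
    default values, so the convergence of the integral defining V = - U0 is tracked separately,
    almost everywhere. *)

Lemma measurable_c1 : measurable_fun setT (fun x : vec3 R => x.1.1).
Proof. exact: (measurableT_comp measurable_fst measurable_fst). Qed.
Lemma measurable_c2 : measurable_fun setT (fun x : vec3 R => x.1.2).
Proof. exact: (measurableT_comp measurable_snd measurable_fst). Qed.
Lemma measurable_c3 : measurable_fun setT (fun x : vec3 R => x.2).
Proof. exact: measurable_snd. Qed.

Lemma measurable_enorm : measurable_fun setT (@enorm R).
Proof.
have m : measurable_fun setT (fun x : vec3 R => x.1.1 ^+ 2 + x.1.2 ^+ 2 + x.2 ^+ 2).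
  apply: measurable_funD; last by apply: measurable_funX; exact: measurable_c3.
  apply: measurable_funD; apply: measurable_funX; [exact: measurable_c1|exact: measurable_c2].
apply: (measurableT_comp _ m).
exact: (continuous_measurable_fun (@sqrt_continuous R)).
Qed.

Lemma measurable_enorm_inv : measurable_fun setT (fun z : vec3 R => (enorm z)^-1).
Proof.
rewrite (_ : (fun z => _) = (fun z : vec3 R => enorm z `^ (-1))).
  exact: (measurableT_comp (measurable_powR _) measurable_enorm).
by apply/funext => z; rewrite powR_inv1// sqrtr_ge0.
Qed.

Lemma measurable_vec3 d (T : measurableType d) (a b c : T -> R) :
  measurable_fun setT a -> measurable_fun setT b -> measurable_fun setT c ->
  measurable_fun setT (fun t => (a t, b t, c t) : vec3 R).
Proof.
move=> ma mb mc; apply: measurable_fun_pair => //.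
exact: measurable_fun_pair.
Qed.

Lemma measurable_sub3 d (T : measurableType d) (a b : T -> vec3 R) :
  measurable_fun setT a -> measurable_fun setT b ->
  measurable_fun setT (fun t => a t - b t).
Proof.
move=> ma mb.
rewrite (_ : (fun t => a t - b t) = (fun t => ((a t).1.1 - (b t).1.1,
  (a t).1.2 - (b t).1.2, (a t).2 - (b t).2))); last by [].
by apply: measurable_vec3; apply: measurable_funB;
  [exact: (measurableT_comp measurable_c1)|exact: (measurableT_comp measurable_c1)|
   exact: (measurableT_comp measurable_c2)|exact: (measurableT_comp measurable_c2)|
   exact: (measurableT_comp measurable_c3)|exact: (measurableT_comp measurable_c3)].
Qed.

Local Open Scope ereal_scope.
Local Notation mu := (@lebesgue_measure R).

(** The image of Lebesgue measure under a translation agrees with it on half-open intervals, and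
    these determine it. *)
Lemma ge0_integral_shift (f : R -> \bar R) (y : R) :
  measurable_fun setT f -> (forall r, 0 <= f r) ->
  \int[mu]_r f (r - y)%R = \int[mu]_r f r.
Proof.
move=> mf f0.
pose s : measurableTypeR R -> measurableTypeR R := fun r => (r - y)%R.
have ms : measurable_fun setT s by apply: measurable_funB.
have := @ge0_integral_pushforward _ _ _ _ R s ms mu setT f measurableT mf (fun r _ => f0 r).
rewrite preimage_setT => <-.
apply: eq_measure_integral => A mA _ /=.
apply/esym; apply: lebesgue_measure_unique => // _ [[a b]] _ <-.
rewrite [RHS](_ : _ = mu `](a + y)%R, (b + y)%R]%classic); last first.
  rewrite /= /pushforward; congr (mu _).
  by apply/seteqP; split => x /=; rewrite !in_itv/= /s ltrBrDr lerBlDr.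
rewrite !lebesgue_measure_itv /= !lte_fin ltrD2r.
by congr (if _ then _ else _); rewrite -!EFinB; congr EFin; lra.
Qed.

Lemma integral_leb3 (g : vec3 R -> \bar R) :
  measurable_fun setT g -> (forall z, 0 <= g z) ->
  \int[@leb3 R]_z g z = \int[mu]_a \int[mu]_b \int[mu]_c g (a, b, c).
Proof.
move=> mg g0; rewrite (fubini_tonelli1 g)//= (fubini_tonelli1 (fubini_F mu g))//.
  exact: measurable_fun_fubini_tonelli_F.
by move=> x; apply: integral_ge0.
Qed.

(** Tonelli reduces this to three translations on the line. *)
Lemma ge0_integral_shift3 (g : vec3 R -> \bar R) (y : vec3 R) :
  measurable_fun setT g -> (forall z, 0 <= g z) ->
  \int[@leb3 R]_z g (z - y)%R = \int[@leb3 R]_z g z.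
Proof.
move=> mg g0.
have mg' : measurable_fun setT (fun z : vec3 R => g (z - y)%R).
  by apply: (measurableT_comp mg); apply: measurable_sub3.
have m1 : measurable_fun setT (fubini_F mu g).
  exact: measurable_fun_fubini_tonelli_F.
have m2 : measurable_fun setT (fubini_F mu (fubini_F mu g)).
  apply: measurable_fun_fubini_tonelli_F => // x; exact: integral_ge0.
apply: (etrans (integral_leb3 mg' (fun z => g0 (z - y)%R))).
apply: (etrans _ (esym (integral_leb3 mg g0))).
apply: (etrans _ (ge0_integral_shift y.1.1 m2 _)); last first.
  by move=> r; do 2 (apply: integral_ge0 => ? _).
apply: eq_integral => a _.
have m3 : measurable_fun setT (fun b : measurableTypeR R => fubini_F mu g ((a - y.1.1)%R, b)).
  by apply: (measurableT_comp m1).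
apply: (etrans _ (ge0_integral_shift y.1.2 m3 _)); last first.
  by move=> r; apply: integral_ge0.
apply: eq_integral => b _.
have m4 : measurable_fun setT (fun c : measurableTypeR R => g ((a - y.1.1)%R, (b - y.1.2)%R, c)).
  by apply: (measurableT_comp mg).
exact: (ge0_integral_shift y.2 m4).
Qed.

End measurability.

(** * Local integrability of powers of the Coulomb kernel *)

Section near_kernel.
Context {R : realType}.
Local Notation mu := (@lebesgue_measure R).

(** The fundamental theorem of calculus applies on [[r / n.+2, r]], away from the singularity, and
    bounds each integral by the value of the antiderivative t^(1 - th) / (1 - th) at [r]; monotone
    convergence exhausts the half-open interval. *)
Lemma integral_powRN_lty (th r : R) : 0 < th -> th < 1 -> 0 < r ->
  (\int[mu]_(t in `]0%R, r]) (t `^ (- th))%R%:E < +oo)%E.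
Proof.
move=> th0 th1 r0.
pose F (n : nat) : set (measurableTypeR R) := `[r / (n.+2%:R), r]%classic.
have Fr n : r / n.+2%:R < r.
  by rewrite ltr_pdivrMr// ltr_pMr// (_ : 1 = 1%:R)// ltr_nat.
have rn0 n : 0 < r / n.+2%:R by rewrite divr_gt0.
have E : \bigcup_i F i = `]0, r]%classic :> set R.
  apply/seteqP; split => x /=.
    by move=> [n _]; rewrite /F/= !in_itv/= => /andP[h ->]; rewrite andbT (lt_le_trans _ h).
  rewrite in_itv/= => /andP[x0 xr]; exists (Num.truncn (r / x)) => //.
  rewrite /F/= in_itv/= xr andbT ler_pdivrMr//.
  rewrite mulrC -ler_pdivrMr// (le_trans (ltW (truncnS_gt _)))// ler_nat.
  by rewrite ltnW.
have ge0 x : (0 <= (x `^ (- th))%:E)%E by rewrite lee_fin powR_ge0.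
have mf : measurable_fun setT (fun x : R => (x `^ (- th))%:E).
  by apply/measurable_EFinP; exact: measurable_powR.
have nd : nondecreasing_seq F.
  apply/nondecreasing_seqP => n; apply/subsetPset => x; rewrite /F/= !in_itv/= => /andP[h ->].
  by rewrite andbT (le_trans _ h)// ler_pM2l// lef_pV2// ?posrE// ler_nat.
have mFi i : measurable (F i) by exact: measurable_itv.
have mfF i : measurable_fun (F i) (fun x : measurableTypeR R => (x `^ (- th))%R%:E) by exact: measurable_funTS.
have f0 i x : F i x -> (0 <= (x `^ (- th))%R%:E)%E by [].
pose m : {measure set _ -> \bar R} := mu.
rewrite -E.
have /cvg_lim <- // := @ge0_nondecreasing_set_cvg_integral _ _ R F _ m nd mFi mfF f0.
apply: (@le_lt_trans _ _ (r `^ (1 - th) / (1 - th))%:E); last by rewrite ltry.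
apply: lime_le.
  apply: ereal_nondecreasing_is_cvgn.
  exact: (@ge0_nondecreasing_set_nondecreasing_integral _ _ R F _ m nd mFi mfF f0).
apply: nearW => n.
have gt0 x : r / n.+2%:R <= x -> 0 < x by exact/lt_le_trans.
have dF (x : R) : 0 < x -> is_derive x 1 (fun x => x `^ (1 - th) / (1 - th)) (x `^ (- th)).
  move=> x0; have d := is_derive1_powR (1 - th) x0.
  have -> : (fun x : R => x `^ (1 - th) / (1 - th)) =
     (1 - th)^-1 *: ((powR (R:=R))^~ (1 - th)).
    by apply/funext => y; rewrite /= mulrC.
  apply: is_derive_eq; rewrite /= /GRing.scale/= mulrA mulVf ?mul1r; last lra.
  by congr (_ `^ _); lra.
have cf : {within `[r / n.+2%:R, r], continuous (fun x : R => x `^ (- th))}.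
  apply: derivable_within_continuous => x; rewrite in_itv/= => /andP[/gt0 x0 _].
  exact: (@ex_derive _ _ _ _ _ _ _ (is_derive1_powR (- th) x0)).
rewrite (continuous_FTC2 (F := fun x => x `^ (1 - th) / (1 - th)) (Fr n) cf).
- by rewrite -EFinB lee_fin lerBlDr lerDl divr_ge0 ?powR_ge0 ?subr_ge0 ?ltW.
- have cF x : 0 < x -> {for x, continuous (fun x => x `^ (1 - th) / (1 - th))}.
    move=> x0; apply/differentiable_continuous/derivable1_diffP.
    exact: (@ex_derive _ _ _ _ _ _ _ (dF _ x0)).
  split.
  + move=> x; rewrite in_itv/= => /andP[/ltW/gt0 x0 _].
    exact: (@ex_derive _ _ _ _ _ _ _ (dF _ x0)).
  + by apply: cvg_at_right_filter; exact: cF.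
  + by apply: cvg_at_left_filter; exact: cF.
- move=> x; rewrite in_itv/= => /andP[/ltW/gt0 x0 _].
  by rewrite derive1E; apply: (@derive_val _ _ _ _ _ _ _ (dF _ x0)).
Qed.

(* The value at 0 makes [le_kap3] hold everywhere, not just off the coordinate planes. *)
Definition kap (th r t : R) : \bar R :=
  if t == 0 then +oo%E else if `|t| <= r then (`|t| `^ (- th))%:E else 0%E.

Lemma kap_ge0 th r t : (0 <= kap th r t)%E.
Proof. by rewrite /kap; case: ifP => // _; case: ifP => // _; rewrite lee_fin powR_ge0. Qed.

Lemma kap_gt0 th r t : `|t| <= r -> (0 < kap th r t)%E.
Proof.
move=> tr; rewrite /kap; case: ifPn => // t0; rewrite tr lte_fin powR_gt0//.
by rewrite normr_gt0.
Qed.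

Lemma measurable_kap th r : measurable_fun setT (kap th r).
Proof.
apply: measurable_fun_ifT.
- apply: measurable_fun_eqr => //.
- exact: measurable_cst.
- apply: measurable_fun_ifT => //.
  + by apply: measurable_fun_ler => //; exact: normr_measurable.
  + apply/measurable_EFinP.
    exact: (measurableT_comp (measurable_powR _) (@normr_measurable R setT)).
Qed.

Lemma integral_kap_lty (th r : R) : 0 < th -> th < 1 -> 0 < r ->
  (\int[mu]_t kap th r t < +oo)%E.
Proof.
move=> th0 th1 r0.
pose h (t : R) : \bar R := if (0 < t) && (t <= r) then (t `^ (- th))%R%:E else 0%E.
have h0 t : (0 <= h t)%E by rewrite /h; case: ifP => // _; rewrite lee_fin powR_ge0.
have mh : measurable_fun setT h.
  apply: measurable_fun_ifT => //.
    by apply: measurable_and; [exact: measurable_fun_ltr|exact: measurable_fun_ler].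
  by apply/measurable_EFinP; exact: measurable_powR.
have Ih : (\int[mu]_t h t < +oo)%E.
  have := integral_powRN_lty th0 th1 r0.
  rewrite integral_mkcond; congr (_ < _)%E; apply: eq_integral => t _.
  by rewrite /h patchE mem_setE in_itv.
have mN : measurable_fun setT (-%R : measurableTypeR R -> measurableTypeR R).
  exact: oppr_measurable.
have IhN : (\int[mu]_t h (- t)%R = \int[mu]_t h t)%E.
  have := @ge0_integral_pushforward _ _ _ _ R _ mN mu setT h measurableT mh (fun r _ => h0 r).
  rewrite preimage_setT => <-.
  by apply: eq_measure_integral => A mA _ /=; exact: lebesgue_measureN.
have mhN : measurable_fun setT (fun t : measurableTypeR R => h (- t)%R).
  exact: (measurableT_comp mh mN).
have -> : (\int[mu]_t kap th r t = \int[mu]_t (h t + h (- t)%R))%E.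
  apply: ge0_ae_eq_integral.
  - exact: measurableT.
  - exact: measurable_kap.
  - exact: emeasurable_funD.
  - by move=> t _; exact: kap_ge0.
  - by move=> t _; exact: adde_ge0.
  exists [set 0%R]; split; [exact: measurable_set1|exact: lebesgue_measure_set1|].
  move=> t /= ht; apply: contrapT => t0; apply: ht => _.
  rewrite /kap /h oppr_gt0; case: (ltgtP t 0) t0 => [tn _|tp _|-> []//].
    by rewrite ltr0_norm//= add0e.
  by rewrite gtr0_norm//= adde0.
rewrite (ge0_integralD mu measurableT (fun t _ => h0 t) mh (fun t _ => h0 (- t)) mhN).
by rewrite IhN lte_add_pinfty.
Qed.

Lemma enorm_ge (z : vec3 R) :
  [/\ `|z.1.1| <= enorm z, `|z.1.2| <= enorm z & `|z.2| <= enorm z].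
Proof.
by split; rewrite -sqrtr_sqr ler_wsqrtr//; nra.
Qed.

Lemma enorm_ge0 (z : vec3 R) : 0 <= enorm z.
Proof. exact: sqrtr_ge0. Qed.

Definition inbox (r : R) (z : vec3 R) : bool :=
  [&& `|z.1.1| <= r, `|z.1.2| <= r & `|z.2| <= r].

(** Cut off by a cube rather than a ball, so that it has a majorant which is a product over the
    coordinates. *)
Definition near_pow (q r : R) (z : vec3 R) : R :=
  if inbox r z then (enorm z) `^ (- q) else 0.

(** Each coordinate is at most [enorm z] in absolute value, so |z|^(-q), split into three equal
    powers, is at most the product of the |z_i|^(-q/3). Integrability for q < 3 thus reduces to
    exponents below 1 on the line, without polar coordinates. *)
Lemma le_kap3 (q r : R) (z : vec3 R) : 0 < q ->
  ((near_pow q r z)%:E <= kap (q / 3) r z.1.1 * (kap (q / 3) r z.1.2 * kap (q / 3) r z.2))%E.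
Proof.
move=> q0; rewrite /near_pow; case: ifPn => [|_]; last first.
  by rewrite !mule_ge0// kap_ge0.
move=> /and3P[z1 z2 z3].
have [n1 n2 n3] := enorm_ge z.
have k1 := kap_gt0 (q / 3) z1; have k2 := kap_gt0 (q / 3) z2; have k3 := kap_gt0 (q / 3) z3.
(* On a coordinate plane one factor is infinite and the others are positive, so the right-hand side
   is infinite. *)
have [e1|e1] := eqVneq z.1.1 0.
  by rewrite /kap e1 eqxx /= gt0_mulye ?leey// mule_gt0.
have [e2|e2] := eqVneq z.1.2 0.
  by rewrite {2}/kap e2 eqxx /= gt0_mulye// gt0_muley ?leey.
have [e3|e3] := eqVneq z.2 0.
  by rewrite {3}/kap e3 eqxx /= gt0_muley// gt0_muley ?leey.
rewrite /kap (negbTE e1) (negbTE e2) (negbTE e3) z1 z2 z3 -!EFinM lee_fin.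
have p0 : 0 < enorm z by rewrite (lt_le_trans _ n1)// normr_gt0.
have -> : enorm z `^ (- q) = enorm z `^ (- (q / 3)) * (enorm z `^ (- (q / 3)) * enorm z `^ (- (q / 3))).
  by rewrite -!powRD ?(gt_eqF p0) ?implybT//; congr (_ `^ _); lra.
have le (t : R) : t != 0 -> `|t| <= enorm z -> enorm z `^ (- (q / 3)) <= `|t| `^ (- (q / 3)).
  move=> t0 tz; have tp : 0 < `|t| by rewrite normr_gt0.
  rewrite !powRN lef_pV2 ?posrE ?powR_gt0//.
  by apply: ge0_ler_powR; rewrite ?nnegrE ?(ltW p0)//; lra.
apply: ler_pM; rewrite ?mulr_ge0 ?powR_ge0 ?le//.
by apply: ler_pM; rewrite ?powR_ge0 ?le.
Qed.

Lemma measurable_inbox (r : R) : measurable_fun setT (inbox r).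
Proof.
have m1 := measurableT_comp (@normr_measurable R setT) measurable_c1.
have m2 := measurableT_comp (@normr_measurable R setT) measurable_c2.
have m3 := measurableT_comp (@normr_measurable R setT) measurable_c3.
by apply: measurable_and; [|apply: measurable_and]; exact: measurable_fun_ler.
Qed.

Lemma measurable_near_pow (q r : R) : measurable_fun setT (near_pow q r).
Proof.
apply: measurable_fun_ifT => //; first exact: measurable_inbox.
exact: (measurableT_comp (measurable_powR _) measurable_enorm).
Qed.

Lemma near_pow_ge0 q r z : 0 <= near_pow q r z.
Proof. by rewrite /near_pow; case: ifP => // _; exact: powR_ge0. Qed.

(** The cube of a one-dimensional integral is a finite bound, and by translation invariance the
    value does not depend on [y]. *)
Lemma near_pow_integral (q r : R) : 0 < q -> q < 3 -> 0 < r ->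
  exists2 c : R, 0 <= c & forall y : vec3 R,
    (\int[@leb3 R]_x (near_pow q r (x - y)%R)%:E = c%:E)%E.
Proof.
move=> q0 q3 r0.
have mN : measurable_fun setT (fun z => (near_pow q r z)%:E).
  by apply/measurable_EFinP; exact: measurable_near_pow.
have N0 z : (0 <= (near_pow q r z)%:E)%E by rewrite lee_fin near_pow_ge0.
have fin : (\int[@leb3 R]_x (near_pow q r x)%:E < +oo)%E.
  pose k := kap (q / 3) r.
  have mk : measurable_fun setT k by exact: measurable_kap.
  have k0 t : (0 <= k t)%E by exact: kap_ge0.
  have m1 := measurableT_comp mk measurable_c1.
  have m2 := measurableT_comp mk measurable_c2.
  have m3 := measurableT_comp mk measurable_c3.
  have mp : measurable_fun setT (fun x : vec3 R => k x.1.1 * (k x.1.2 * k x.2))%E.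
    by apply: emeasurable_funM => //; exact: emeasurable_funM.
  apply: (@le_lt_trans _ _ (\int[@leb3 R]_x (k x.1.1 * (k x.1.2 * k x.2)))%E).
    apply: ge0_le_integral => //.
    by move=> z _; exact: le_kap3.
  rewrite integral_leb3//; last by move=> z; rewrite !mule_ge0.
  have Ik : (\int[mu]_t k t < +oo)%E by apply: integral_kap_lty; lra.
  have Ik0 : (0 <= \int[mu]_t k t)%E by exact: integral_ge0.
  set I := (\int[mu]_t k t)%E in Ik Ik0 *.
  have E1 (a b : R) : (\int[mu]_c (k a * (k b * k c)) = k a * (k b * I))%E.
    rewrite -(ge0_integralZl mu measurableT mk (fun c _ => k0 c) (k0 b)) -ge0_integralZl//.
    - by apply: emeasurable_funM => //; exact: measurable_cst.
    - by move=> c _; exact: mule_ge0.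
  have E2 (a : R) : (\int[mu]_b \int[mu]_c (k a * (k b * k c)) = k a * (I * I))%E.
    under eq_integral do rewrite E1.
    rewrite -[in RHS](ge0_integralZr mu measurableT mk (fun c _ => k0 c) Ik0) -ge0_integralZl//.
    - by apply: emeasurable_funM => //; exact: measurable_cst.
    - by move=> c _; exact: mule_ge0.
  under eq_integral do rewrite E2.
  rewrite (ge0_integralZr mu measurableT mk (fun c _ => k0 c)) ?mule_ge0//.
  by rewrite !lte_mul_pinfty// ?mule_ge0// ge0_fin_numE.
have I0 : (0 <= \int[@leb3 R]_x (near_pow q r x)%:E)%E by exact: integral_ge0.
exists (fine (\int[@leb3 R]_x (near_pow q r x)%:E)%E); first exact: fine_ge0.
move=> y; rewrite fineK; last by rewrite ge0_fin_numE.
exact: (ge0_integral_shift3 y mN N0).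
Qed.

End near_kernel.

(** * The Casimir function and its inverse *)

Section casimir_function.
Context {R : realType}.
Variables (Q : R -> R) (C k : R).
Hypothesis Q_C1 : hC1 Q.
Hypothesis Q_0 : Q 0 = 0.
Hypothesis C_gt0 : 0 < C.
Hypothesis k_gt0 : 0 < k.
Hypothesis Q1 : forall s : R, 0 <= s -> C * (s + s `^ (1 + 1 / k)) <= Q s.
Hypothesis Q2 : convex_function (`[0, +oo[%classic : set R^o) (Q : R^o -> R^o).
Local Notation Q' := (hderive Q).

(** Both s > 0 and s = 0 are covered: the increments only have to be nonzero and to keep s + h in
    the half-line, as [hincr] demands. *)
Lemma hderive_seq (s : R) (h : R^nat) : 0 <= s -> (forall n, h n != 0) ->
  (forall n, 0 <= s + h n) -> h @ \oo --> 0 -> hquot Q s (h n) @[n --> \oo] --> Q' s.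
Proof.
move=> s0 hn0 sh h0.
have cvgQ : hquot Q s @ hincr s --> Q' s by exact: (Q_C1.1 _ s0).
suff H : h @ \oo `=>` hincr s by exact: cvg_comp H cvgQ.
move=> A; rewrite /hincr /within /= => wA.
have [e e0 He] : exists2 e : R, 0 < e & forall x, `|x| < e -> x != 0 -> 0 <= s + x -> A x.
  move: wA; rewrite /nbhs /= /dnbhs /within /= => -[e e0 He]; exists e => // x xe x0 sx.
  by apply: (He x) => //=; rewrite sub0r normrN.
have /cvgrPdist_lt/(_ _ e0) := h0.
apply: filterS => n; rewrite sub0r normrN => hn.
exact: He.
Qed.

(** Convexity bounds the difference quotient for the increment (t - s) / (n + 1), times t - s, by
    the chord Q t - Q s; the limit in n gives the tangent. *)
Lemma Q_tangent (s t : R) : 0 <= s -> 0 <= t -> Q' s * (t - s) <= Q t - Q s.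
Proof.
move=> s0 t0; have [->|st] := eqVneq s t; first by rewrite !subrr mulr0.
have ts : t - s != 0 by rewrite subr_eq0 eq_sym.
pose th (n : nat) : R := n.+1%:R^-1.
have th0 n : 0 < th n by rewrite invr_gt0.
have th1 n : th n <= 1 by rewrite invf_le1// ler1n.
pose h n := th n * (t - s).
have h0 : h @ \oo --> (0 : R).
  rewrite -[X in _ --> X](mul0r (t - s)).
  exact: (cvgMr_tmp (b := t - s) (@cvg_harmonic R)).
have sh n : s + h n = (1 - th n) * s + th n * t by rewrite /h; ring.
have sh0 n : 0 <= s + h n.
  by rewrite sh addr_ge0// mulr_ge0// ?subr_ge0// ltW.
have hn0 n : h n != 0 by rewrite mulf_neq0// gt_eqF.
have lim : hquot Q s (h n) * (t - s) @[n --> \oo] --> Q' s * (t - s).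
  by apply: cvgMr_tmp; exact: hderive_seq.
rewrite -(cvg_lim _ lim)//; apply: limr_le; first by apply/cvg_ex; exists (Q' s * (t - s)).
apply: nearW => n.
have thi : 0 <= 1 - th n <= 1 by rewrite subr_ge0 th1 gerBl ltW.
have /andP[thi0 thi1] := thi.
have := Q2 (Itv01 thi0 thi1) (mem_set (_ : `[0, +oo[%classic s)) (mem_set (_ : `[0, +oo[%classic t)).
rewrite /= !in_itv /= !andbT => /(_ s0 t0).
rewrite !convRE /= /unstable.onem (_ : 1 - (1 - th n) = th n); last ring.
move=> H.
have {}H : Q ((1 - th n) * s + unstable.onem (1 - th n) * t) <=
  (1 - th n) * Q s + th n * Q t := H.
rewrite /unstable.onem (_ : 1 - (1 - th n) = th n) -?sh in H; last ring.
have -> : hquot Q s (h n) * (t - s) = (th n)^-1 * (Q (s + h n) - Q s).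
  rewrite /hquot {1}/h invfM; field.
  by rewrite ts gt_eqF.
rewrite mulrC ler_pdivrMr //; lra.
Qed.

Lemma Q'_nondecreasing (s t : R) : 0 <= s -> s <= t -> Q' s <= Q' t.
Proof.
move=> s0; rewrite le_eqVlt => /predU1P[->//|st].
have t0 : 0 <= t by rewrite ltW// (le_lt_trans s0).
have H1 := Q_tangent s0 t0; have H2 := Q_tangent t0 s0.
rewrite -(@ler_pM2r _ (t - s)) ?subr_gt0//; lra.
Qed.

(** At 0 the growth condition gives Q h / h >= C, and the derivative is nondecreasing. This positive
    lower bound makes Q invertible with a Lipschitz inverse. *)
Lemma Q'_geC (s : R) : 0 <= s -> C <= Q' s.
Proof.
move=> s0; apply: (@le_trans _ _ (Q' 0)); last exact: Q'_nondecreasing.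
have lim : hquot Q 0 (@harmonic R n) @[n --> \oo] --> Q' 0.
  have hp n : 0 < @harmonic R n by exact: harmonic_gt0.
  apply: hderive_seq; [by []|by move=> n; rewrite gt_eqF| |exact: cvg_harmonic].
  by move=> n; rewrite add0r ltW.
rewrite -(cvg_lim _ lim)//; apply: limr_ge; first by apply/cvg_ex; exists (Q' 0).
apply: nearW => n; rewrite /hquot add0r Q_0 subr0 ler_pdivlMl ?harmonic_gt0//.
have h0 := @harmonic_ge0 R n.
apply: le_trans (Q1 h0); rewrite mulrC ler_pM2l// lerDl powR_ge0//.
Qed.

Lemma Q'_gt0 (s : R) : 0 <= s -> 0 < Q' s.
Proof. by move=> /Q'_geC; exact: lt_le_trans. Qed.

(** The tangent at s, evaluated at 0, gives Q s <= s Q' s; divide the growth condition by s. This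
    later turns the Euler-Lagrange relation into a pointwise bound on f by a power of the
    potential. *)
Lemma Q'_ge (s : R) : 0 <= s -> C * (1 + s `^ (1 / k)) <= Q' s.
Proof.
rewrite le_eqVlt => /predU1P[<-|s0].
  by rewrite powR0 ?addr0 ?mulr1 ?Q'_geC// div1r invr_eq0 gt_eqF.
have s0' := ltW s0.
have := Q_tangent s0' (lexx 0); rewrite Q_0 !sub0r mulrN lerN2 => H.
rewrite -(ler_pM2r s0); apply: le_trans H; apply: le_trans (Q1 s0').
rewrite powRD ?(gt_eqF s0) ?implybT// powRr1// le_eqVlt; apply/orP; left; apply/eqP; ring.
Qed.

Lemma Q_expand (s t : R) : 0 <= s -> s <= t -> C * (t - s) <= Q t - Q s.
Proof.
move=> s0 st; apply: le_trans (Q_tangent s0 (le_trans s0 st)).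
by rewrite ler_wpM2r ?subr_ge0// Q'_geC.
Qed.

Lemma Q_mono (s t : R) : 0 <= s -> s <= t -> Q s <= Q t.
Proof.
move=> s0 st; rewrite -subr_ge0; apply: le_trans (Q_expand s0 st).
by rewrite mulr_ge0 ?subr_ge0// ltW.
Qed.

Lemma Q_lipschitz (s t L : R) : 0 <= s -> s <= t -> t <= L ->
  `|Q t - Q s| <= Q' L * `|t - s|.
Proof.
move=> s0 st tL; have t0 := le_trans s0 st.
rewrite !ger0_norm ?subr_ge0 ?Q_mono//.
have := Q_tangent t0 s0; have := Q'_nondecreasing t0 tL => h1 h2.
have : Q' t * (t - s) <= Q' L * (t - s) by rewrite ler_wpM2r ?subr_ge0.
lra.
Qed.

Lemma Q_surj (y : R) : 0 <= y -> exists2 s, 0 <= s & Q s = y.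
Proof.
(* By linear growth Q (y / C) >= y, so the intermediate value theorem applies on [0, y / C]. *)
move=> y0; pose L := y / C.
have L0 : 0 <= L by rewrite divr_ge0// ltW.
have QL : y <= Q L.
  have := Q_expand (lexx 0) L0; rewrite Q_0 !subr0; apply: le_trans.
  by rewrite /L mulrC divfK// gt_eqF.
have cQ : {within `[0, L], continuous Q}.
  apply/subspace_continuousP => x /=; rewrite in_itv/= => /andP[x0 xL].
  apply/cvgrPdist_lt => e e0.
  have d0 : 0 < e / Q' L by rewrite divr_gt0// Q'_gt0.
  exists (e / Q' L) => //= z /= xz; rewrite in_itv/= => /andP[z0 zL].
  suff : `|Q x - Q z| <= Q' L * `|x - z|.
    by move=> /le_lt_trans; apply; rewrite mulrC -ltr_pdivlMr// Q'_gt0.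
  case: (leP x z) => [xz'|/ltW zx]; last exact: Q_lipschitz.
  by rewrite distrC [in leRHS]distrC; exact: Q_lipschitz.
have [] := IVT L0 cQ (v := y).
  by rewrite Q_0 (min_idPl _) ?(max_idPr _) ?y0//; apply: le_trans QL.
by move=> s; rewrite in_itv/= => /andP[s0 _] Qs; exists s.
Qed.

(** Clamping the argument at 0 makes the inverse total and nondecreasing on the whole line, which
    yields its measurability. *)
Definition Qinv (y : R) : R := xget 0 [set s | 0 <= s /\ Q s = Num.max 0 y].

Lemma QinvP (y : R) : 0 <= Qinv y /\ Q (Qinv y) = Num.max 0 y.
Proof.
rewrite /Qinv; case: xgetP => [s _ []//|H].
have [s s0 Qs] := @Q_surj (Num.max 0 y) (ltac:(by rewrite le_max lexx)).
by have := H s; case.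
Qed.

Lemma Qinv_ge0 y : 0 <= Qinv y. Proof. by have [] := QinvP y. Qed.

Lemma QinvK y : 0 <= y -> Q (Qinv y) = y.
Proof. by move=> y0; have [_ ->] := QinvP y; apply/max_idPr. Qed.

Lemma Q_inj (s t : R) : 0 <= s -> 0 <= t -> Q s = Q t -> s = t.
Proof.
move=> s0 t0 E; wlog st : s t s0 t0 E / s <= t.
  by move=> H; case: (leP s t) => [|/ltW] h; [|apply/esym]; exact: H.
apply/eqP; rewrite eq_le st /= -subr_le0 -(pmulr_rle0 _ C_gt0).
by apply: le_trans (Q_expand s0 st) _; rewrite E subrr.
Qed.

Lemma QK s : 0 <= s -> Qinv (Q s) = s.
Proof.
move=> s0; apply: Q_inj => //; first exact: Qinv_ge0.
by rewrite QinvK// -Q_0 Q_mono.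
Qed.

Lemma Qinv_mono (y z : R) : y <= z -> Qinv y <= Qinv z.
Proof.
move=> yz; rewrite leNgt; apply/negP => H.
have [z0 Qz] := QinvP z; have [y0 Qy] := QinvP y.
have : C * (Qinv y - Qinv z) <= Num.max 0 y - Num.max 0 z.
  by rewrite -Qy -Qz; apply: Q_expand => //; exact: ltW.
apply/negP; rewrite -ltNge; apply: (@le_lt_trans _ _ 0).
  by rewrite subr_le0 ge_max !le_max lexx /= yz orbT.
by rewrite mulr_gt0// subr_gt0.
Qed.

Lemma Qinv_lip (y z : R) : 0 <= y -> 0 <= z -> C * `|Qinv y - Qinv z| <= `|y - z|.
Proof.
move=> y0 z0; wlog yz : y z y0 z0 / z <= y.
  move=> H; case: (leP z y) => [|/ltW] h; first exact: H.
  by rewrite distrC [leRHS]distrC; exact: H.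
rewrite !ger0_norm ?subr_ge0 ?Qinv_mono//.
apply: le_trans (Q_expand (Qinv_ge0 z) (Qinv_mono yz)) _.
by rewrite !QinvK.
Qed.

Lemma measurable_Qinv : measurable_fun setT Qinv.
Proof.
by apply: nondecreasing_measurable => // y z yz; exact: Qinv_mono.
Qed.

(** Both functions are nondecreasing on the half-line; precomposing with the maximum with 0 extends
    them monotonically to the line and leaves the composites with [f] unchanged. *)
Lemma measurable_Qc d (T : measurableType d) (f : T -> R) :
  measurable_fun setT f -> (forall z, 0 <= f z) ->
  measurable_fun setT (Q \o f) /\ measurable_fun setT (Q' \o f).
Proof.
move=> mf f0.
have E (g : R -> R) : g \o f = (g \o Num.max 0) \o f.
  by apply/funext => z /=; rewrite (max_idPr _).
have H (g : R -> R) : (forall s t, 0 <= s -> s <= t -> g s <= g t) ->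
    measurable_fun setT (g \o f).
  move=> gm; rewrite E; apply: (measurableT_comp _ mf).
  apply: nondecreasing_measurable => // y z yz /=.
  apply: gm; first by rewrite le_max lexx.
  by rewrite ge_max !le_max lexx/= yz orbT.
by split; apply: H; [exact: Q_mono|exact: Q'_nondecreasing].
Qed.

(** Derivative of the inverse function along a possibly one-sided increment: if h is the increment
    of the inverse, the difference quotient of Q is t a / h, and its reciprocal times a is h / t. *)
Lemma Qinv_curve (s a : R) (t : R^nat) : 0 <= s -> (forall n, 0 < t n) ->
  (forall n, 0 <= Q s + t n * a) -> t @ \oo --> 0 ->
  (Qinv (Q s + t n * a) - s) / t n @[n --> \oo] --> a / Q' s.
Proof.
(* For a = 0 the increments h vanish, which [hincr] excludes; but then the sequence is constantly
   0. *)
move=> s0 t0 ta t_0; have [->|a0] := eqVneq a 0.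
  rewrite mul0r; apply: cvg_near_cst; apply: nearW => n.
  by rewrite mulr0 addr0 QK// subrr mul0r.
pose h n := Qinv (Q s + t n * a) - s.
have Qs0 : 0 <= Q s by rewrite -Q_0 Q_mono.
have tn0 n : t n != 0 by rewrite gt_eqF.
have shE n : s + h n = Qinv (Q s + t n * a) by rewrite /h; ring.
have Qh n : Q (s + h n) - Q s = t n * a by rewrite shE QinvK//; ring.
have hn0 n : h n != 0.
  apply/eqP => h0; have := Qh n; rewrite h0 addr0 subrr => /esym/eqP.
  by rewrite mulf_eq0 (negbTE a0) (negbTE (tn0 n)).
have sh n : 0 <= s + h n by rewrite shE Qinv_ge0.
have hle n : `|h n| <= t n * (`|a| / C).
  rewrite mulrA ler_pdivlMr// mulrC.
  have := Qinv_lip (ta n) Qs0; rewrite QK// (addrC (Q s)) addrK normrM gtr0_norm//.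
  by rewrite [_ + Q s]addrC.
have h0 : h @ \oo --> 0.
  apply/norm_cvg0P; apply: (@squeeze_cvgr _ _ _ _ (fun=> 0) (fun n => t n * (`|a| / C))).
  - by apply: nearW => n; rewrite normr_ge0 hle.
  - exact: cvg_cst.
  - rewrite -[X in _ --> X](mul0r (`|a| / C)).
    exact: (cvgMr_tmp (b := `|a| / C) t_0).
have := hderive_seq s0 hn0 sh h0.
move=> /(cvgV (lt0r_neq0 (Q'_gt0 s0)))/(cvgMl_tmp (a := a)).
apply: cvg_trans; apply: near_eq_cvg; apply: nearW => n /=.
by rewrite /hquot Qh /h; field; rewrite tn0 a0 hn0.
Qed.

End casimir_function.

(** * Real-valued integrals and iterated integrals *)

Section real_integrals.
Context {R : realType} d (T : measurableType d) (mu : {measure set T -> \bar R}).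
Implicit Types f g h : T -> R.

Definition integ f := mu.-integrable setT (EFin \o f).

Lemma integ_measurable f : integ f -> measurable_fun setT f.
Proof. by move=> /measurable_int /measurable_EFinP. Qed.

Lemma integ_le f h : measurable_fun setT f -> (forall z, `|f z| <= h z) ->
  integ h -> integ f.
Proof.
move=> mf fh; apply: le_integrable => //; first exact/measurable_EFinP.
by move=> z _ /=; rewrite lee_fin; apply: le_trans (fh z) (ler_norm _).
Qed.

Lemma integ_ae_le f h : measurable_fun setT f -> {ae mu, forall z, `|f z| <= h z} ->
  integ h -> integ f.
Proof.
move=> mf fh /integrableP[mh hoo]; apply/integrableP; split; first exact/measurable_EFinP.
apply: le_lt_trans hoo; apply: ae_ge0_le_integral => //.
- by apply: measurableT_comp => //; exact/measurable_EFinP.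
- exact: measurableT_comp.
- apply: filterS fh => z fh _ /=; rewrite lee_fin; apply: le_trans fh (ler_norm _).
Qed.

Lemma integD f g : integ f -> integ g -> integ (fun z => f z + g z).
Proof. by move=> If Ig; have := integrableD measurableT If Ig. Qed.

Lemma integB f g : integ f -> integ g -> integ (fun z => f z - g z).
Proof. by move=> If Ig; have := integrableB measurableT If Ig. Qed.

Lemma integZ c f : integ f -> integ (fun z => c * f z).
Proof. by move=> If; have := integrableZl measurableT c If. Qed.

Lemma integ_norm f : integ f -> integ (fun z => `|f z|).
Proof. by move=> If; have := integrable_abse If. Qed.

Lemma integ_ae_eq f g : measurable_fun setT g -> {ae mu, forall z, f z = g z} ->
  integ f -> integ g.
Proof.
move=> mg fg If; apply: (integ_ae_le mg _ (integ_norm If)).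
by apply: filterS fg => z ->.
Qed.

Lemma RintD f g : integ f -> integ g ->
  (\int[mu]_z (f z + g z) = \int[mu]_z f z + \int[mu]_z g z)%R.
Proof. exact: RintegralD. Qed.

Lemma RintB f g : integ f -> integ g ->
  (\int[mu]_z (f z - g z) = \int[mu]_z f z - \int[mu]_z g z)%R.
Proof. exact: RintegralB. Qed.

Lemma RintZ c f : integ f -> (\int[mu]_z (c * f z) = c * \int[mu]_z f z)%R.
Proof. by move=> If; rewrite RintegralZl. Qed.

Lemma Rint_le f g : integ f -> integ g -> (forall z, f z <= g z) ->
  (\int[mu]_z f z <= \int[mu]_z g z)%R.
Proof. by move=> If Ig fg; exact: le_Rintegral. Qed.

Lemma Rint_ae_eq f g : measurable_fun setT f -> measurable_fun setT g ->
  {ae mu, forall z, f z = g z} -> (\int[mu]_z f z = \int[mu]_z g z)%R.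
Proof.
move=> mf mg fg; rewrite /Rintegral; congr fine; apply: ae_eq_integral => //.
- exact/measurable_EFinP.
- exact/measurable_EFinP.
- by apply: filterS fg => z fg _; rewrite fg.
Qed.

Lemma EFin_Rint f : integ f -> ((\int[mu]_z f z)%R%:E = \int[mu]_z (f z)%:E)%E.
Proof. by move=> If; rewrite /Rintegral fineK//; exact: integrable_fin_num. Qed.

Lemma integ_ge0P f : measurable_fun setT f -> (forall z, 0 <= f z) ->
  (\int[mu]_z (f z)%:E < +oo)%E -> integ f.
Proof.
move=> mf f0 foo; apply/integrableP; split; first exact/measurable_EFinP.
by apply: le_lt_trans foo; under eq_integral do rewrite /= ger0_norm//.
Qed.

Lemma integ_ge0_lty f : integ f -> (forall z, 0 <= f z) ->
  (\int[mu]_z (f z)%:E < +oo)%E.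
Proof. by move=> If _; rewrite -EFin_Rint// ltry. Qed.

Lemma integ_bounded f (D : set T) (B : R) : measurable D -> (mu D < +oo)%E ->
  measurable_fun setT f -> (forall z, `|f z| <= B * \1_D z) -> integ f.
Proof.
move=> mD Doo mf fB; apply: (integ_le mf fB); apply: integZ.
apply: integ_ge0P => //.
by rewrite integral_indic// setIT.
Qed.

Lemma Rint_ge0_eq0 f : integ f -> (forall z, 0 <= f z) ->
  (\int[mu]_z f z = 0)%R -> {ae mu, forall z, f z = 0}.
Proof.
move=> If f0 If0.
have mf := integ_measurable If.
have : (\int[mu]_z `|(EFin \o f) z| = 0)%E.
  transitivity (\int[mu]_z (f z)%:E)%E.
    by apply: eq_integral => z _ /=; rewrite ger0_norm.
  by rewrite -EFin_Rint// If0.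
move=> /(ae_eq_integral_abs mu measurableT (measurable_int mu If)).
by apply: filterS => z /(_ I)[].
Qed.

End real_integrals.

Section product_integrals.
Context {R : realType} d d' (X : measurableType d) (Y : measurableType d').
Variables (m : {sigma_finite_measure set X -> \bar R}).
Variables (n : {sigma_finite_measure set Y -> \bar R}).

Lemma ae_fst (P : X -> Prop) : {ae m, forall x, P x} ->
  {ae (m \x n)%E, forall z, P z.1}.
Proof.
move=> [N [mN N0 PN]]; exists (N `*` setT); split.
- exact: measurableX.
- transitivity (m N * n setT)%E; [exact: product_measure1E|by rewrite N0 mul0e].
- by move=> z /= Pz; split => //; exact: PN.
Qed.

Lemma ae_snd (P : Y -> Prop) : {ae n, forall x, P x} ->
  {ae (m \x n)%E, forall z, P z.2}.
Proof.
move=> [N [mN N0 PN]]; exists (setT `*` N); split.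
- exact: measurableX.
- transitivity (m setT * n N)%E; [exact: product_measure1E|by rewrite N0 mule0].
- by move=> z /= Pz; split => //; exact: PN.
Qed.

Lemma ae_prod (P : X * Y -> Prop) : {ae (m \x n)%E, forall z, P z} ->
  {ae m, forall x, {ae n, forall y, P (x, y)}}.
Proof.
move=> [N [mN N0 PN]].
have H : (\int[m]_x n (xsection N x) = 0)%E by rewrite -[LHS]/((m \x n)%E N).
have mx := measurable_fun_xsection n mN.
have : (\int[m]_x `|n (xsection N x)| = 0)%E.
  by rewrite -[RHS]H; apply: eq_integral => x _; rewrite gee0_abs.
move=> /(ae_eq_integral_abs m measurableT mx); apply: filterS => x /(_ I) /= nx.
exists (xsection N x); split => //; first exact: measurable_xsection.
by move=> y /= Py; rewrite /xsection/= inE; exact: PN.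
Qed.

(** Written as [fine] of a difference of integrals of nonnegative functions, the real integral is
    measurable in [x] even where the slice is not integrable. *)
Lemma measurable_Rint1 (f : X * Y -> R) : measurable_fun setT f ->
  measurable_fun setT (fun x => (\int[n]_y f (x, y))%R).
Proof.
move=> mf; apply: (@measurableT_comp _ _ _ _ _ _ fine); first exact: fine_measurable.
have mf' : measurable_fun setT (EFin \o f) by exact/measurable_EFinP.
rewrite (_ : (fun x => _) = (fun x => (\int[n]_y (EFin \o f)^\+ (x, y)) -
    \int[n]_y (EFin \o f)^\- (x, y))%E); last first.
  apply/funext => x; rewrite integralE; congr (_ - _)%E.
    by apply: eq_integral => y _; rewrite !funeposE.
  by apply: eq_integral => y _; rewrite !funenegE.
have m1 : measurable_fun setT (fubini_F n ((EFin \o f)^\+)%E).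
  by apply: measurable_fun_fubini_tonelli_F => //; exact: measurable_funepos.
have m2 : measurable_fun setT (fubini_F n ((EFin \o f)^\-)%E).
  by apply: measurable_fun_fubini_tonelli_F => //; exact: measurable_funeneg.
exact: (emeasurable_funB m1 m2).
Qed.

Lemma integ_prod (f : X * Y -> R) (h : X -> R) : measurable_fun setT f ->
  (forall x, (\int[n]_y `|f (x, y)|%:E <= (h x)%:E)%E) -> integ m h ->
  integ (m \x n)%E f.
Proof.
move=> mf fh Ih; have mf' : measurable_fun setT (EFin \o f) by exact/measurable_EFinP.
apply/(integrable12ltyP m n mf').
apply: (@le_lt_trans _ _ (\int[m]_x (h x)%:E)%E); last first.
  apply: integ_ge0_lty => // x; rewrite -lee_fin; apply: le_trans (fh x).
  by apply: integral_ge0 => y _; rewrite lee_fin.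
have ma : measurable_fun setT (fubini_F n (abse \o (EFin \o f))).
  have mfa : measurable_fun setT (abse \o (EFin \o f)) by exact: measurableT_comp.
  exact: (measurable_fun_fubini_tonelli_F _ mfa (fun z => abse_ge0 _)).
apply: ge0_le_integral; [exact: measurableT|by move=> x _; exact: integral_ge0|exact: ma|
  exact: (measurable_int m Ih)|by move=> x _; exact: fh].
Qed.

Lemma integ_prod_ae1 (f : X * Y -> R) : integ (m \x n)%E f ->
  {ae m, forall x, integ n (fun y => f (x, y))}.
Proof. exact: ae_integrable1. Qed.

Lemma integ_prod_ae2 (f : X * Y -> R) : integ (m \x n)%E f ->
  {ae n, forall y, integ m (fun x => f (x, y))}.
Proof. exact: ae_integrable2. Qed.

(** The extended-valued partial integral is integrable by Fubini; the real-valued one can differ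
    from it only on the null set of slices that are not integrable. *)
Lemma integ_Rint1 (f : X * Y -> R) : integ (m \x n)%E f ->
  integ m (fun x => (\int[n]_y f (x, y))%R).
Proof.
move=> If; have Ia := integrable_fubini_F If.
apply/integrableP; split.
  by apply/measurable_EFinP/measurable_Rint1/integ_measurable; exact: If.
have /integrableP[mF] := Ia; apply: le_lt_trans.
apply: ae_ge0_le_integral => //.
- apply: measurableT_comp => //.
  by apply/measurable_EFinP/measurable_Rint1/integ_measurable; exact: If.
- exact: measurableT_comp.
- apply: filterS (integ_prod_ae1 If) => x Ix _ /=.
  by rewrite -EFin_normr_Rintegral//=.
Qed.

Lemma Rint_fubini1 (f : X * Y -> R) : integ (m \x n)%E f ->
  (\int[m]_x \int[n]_y f (x, y) = \int[(m \x n)%E]_z f z)%R.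
Proof.
move=> If; rewrite /Rintegral; congr fine.
rewrite -(integral12_prod_meas1 If); apply: ae_eq_integral => //.
- by apply: (measurable_int m (integ_Rint1 If)).
- exact: (measurable_int m (integrable_fubini_F If)).
- by apply: filterS (integ_prod_ae1 If) => x Ix _; rewrite (EFin_Rint Ix).
Qed.

End product_integrals.

Section product_swap.
Context {R : realType} d d' (X : measurableType d) (Y : measurableType d').
Variables (m : {sigma_finite_measure set X -> \bar R}).
Variables (n : {sigma_finite_measure set Y -> \bar R}).

Lemma Rint_fubini2 (f : X * Y -> R) : integ (m \x n)%E f ->
  integ n (fun y => \int[m]_x f (x, y))%R /\
  (\int[n]_y \int[m]_x f (x, y) = \int[(m \x n)%E]_z f z)%R.
Proof.
move=> If.
have mf := integ_measurable If.
have mf' : measurable_fun setT (fun z : Y * X => f (z.2, z.1)).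
  by apply: (measurableT_comp mf); apply: measurable_fun_pair.
have Is : integ (n \x m)%E (fun z : Y * X => f (z.2, z.1)).
  apply/(integrable12ltyP n m _); first exact/measurable_EFinP.
  by apply/(integrable21ltyP m n (f := EFin \o f)) => //; exact/measurable_EFinP.
split; first exact: (integ_Rint1 Is).
rewrite (Rint_fubini1 Is) /Rintegral; congr fine.
by rewrite -(integral12_prod_meas1 Is) -(integral21_prod_meas1 If).
Qed.

End product_swap.

Lemma integ_swap {R : realType} d d' (X : measurableType d) (Y : measurableType d')
    (m : {sigma_finite_measure set X -> \bar R})
    (n : {sigma_finite_measure set Y -> \bar R}) (f : X * Y -> R) :
  integ (m \x n)%E f -> integ (n \x m)%E (fun z => f (z.2, z.1)).
Proof.
move=> If; have mf := integ_measurable If.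
have mf' : measurable_fun setT (fun z : Y * X => f (z.2, z.1)).
  by apply: (measurableT_comp mf); apply: measurable_fun_pair.
apply/(integrable12ltyP n m _); first exact/measurable_EFinP.
by apply/(integrable21ltyP m n (f := EFin \o f)) => //; exact/measurable_EFinP.
Qed.

Lemma Rint_dominated {R : realType} d (T : measurableType d)
    (mu : {measure set T -> \bar R}) (u : nat -> T -> R) (f h : T -> R) :
  (forall n, measurable_fun setT (u n)) -> measurable_fun setT f ->
  integ mu h -> (forall n z, `|u n z| <= h z) ->
  (forall z, u n z @[n --> \oo] --> f z) ->
  (\int[mu]_z u n z)%R @[n --> \oo] --> (\int[mu]_z f z)%R.
Proof.
move=> mu_ mf Ih uh uf.
have [] := @dominated_convergence _ _ R mu setT measurableT (fun n z => (u n z)%:E)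
  (EFin \o f) (EFin \o h).
- by move=> n; exact/measurable_EFinP.
- exact/measurable_EFinP.
- by apply: aeW => z _; apply: cvg_EFin; [exact: nearW|exact: uf].
- exact: Ih.
- by apply: aeW => z n _ /=; rewrite lee_fin.
move=> If _ cv; rewrite /Rintegral; apply: fine_cvg.
rewrite fineK; first exact: cv.
exact: integrable_fin_num.
Qed.

Section integ_prod_ae.
Context {R : realType} d d' (X : measurableType d) (Y : measurableType d').
Variables (m : {sigma_finite_measure set X -> \bar R}).
Variables (n : {sigma_finite_measure set Y -> \bar R}).

Lemma integ_prod_ae (f : X * Y -> R) (h : X -> R) : measurable_fun setT f ->
  {ae m, forall x, (\int[n]_y `|f (x, y)|%:E <= (h x)%:E)%E} -> integ m h ->
  integ (m \x n)%E f.
Proof.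
move=> mf fh Ih; have mf' : measurable_fun setT (EFin \o f) by exact/measurable_EFinP.
apply/(integrable12ltyP m n mf').
apply: (@le_lt_trans _ _ (\int[m]_x `|(h x)%:E|)%E); last first.
  by have /integrableP[] := Ih.
have ma : measurable_fun setT (fubini_F n (abse \o (EFin \o f))).
  have mfa : measurable_fun setT (abse \o (EFin \o f)) by exact: measurableT_comp.
  exact: (measurable_fun_fubini_tonelli_F _ mfa (fun z => abse_ge0 _)).
apply: ae_ge0_le_integral.
- exact: measurableT.
- by move=> x _; exact: integral_ge0.
- exact: ma.
- by move=> x _; exact: abse_ge0.
- by apply: measurableT_comp => //; exact: (measurable_int m Ih).
- apply: filterS fh => x fh _; apply: le_trans fh _.
  by rewrite /= lee_fin ler_norm.
Qed.

End integ_prod_ae.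

(** * The Coulomb form of an abstract symmetric kernel *)

Section coulomb.
Context {R : realType} d (X : measurableType d).
Variable m : {sigma_finite_measure set X -> \bar R}.
Local Notation M2 := (m \x m)%E.
Variable K : X -> X -> R.
Hypothesis K_ge0 : forall x y, 0 <= K x y.
Hypothesis mK : measurable_fun setT (fun z : X * X => K z.1 z.2).
Hypothesis KC : forall x y, K x y = K y x.

Definition dens (f : X * X -> R) (x : X) : R := (\int[m]_v f (x, v))%R.
Definition pot (f : X * X -> R) (x : X) : R := (\int[m]_y (dens f y * K x y))%R.
Definition coul (f : X * X -> R) (z : X * X) : R :=
  dens f z.1 * dens f z.2 * K z.1 z.2.

Lemma measurable_dens f : measurable_fun setT f -> measurable_fun setT (dens f).
Proof. exact: measurable_Rint1. Qed.

Lemma measurable_K1 x : measurable_fun setT (K x).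
Proof.
by apply: (measurableT_comp mK (g := fun y => (x, y))); exact: measurable_fun_pair.
Qed.

Lemma measurable_pot f : measurable_fun setT f -> measurable_fun setT (pot f).
Proof.
move=> mf; have md := measurable_dens mf.
apply: (@measurable_Rint1 _ _ _ X X m (fun z : X * X => dens f z.2 * K z.1 z.2)).
by apply: measurable_funM => //; exact: (measurableT_comp md measurable_snd).
Qed.

Lemma measurable_coul f : measurable_fun setT f -> measurable_fun setT (coul f).
Proof.
move=> mf; have md := measurable_dens mf.
apply: measurable_funM => //; apply: measurable_funM.
  exact: (measurableT_comp md measurable_fst).
exact: (measurableT_comp md measurable_snd).
Qed.

Lemma dens_ge0 f x : (forall z, 0 <= f z) -> 0 <= dens f x.
Proof. by move=> f0; apply: Rintegral_ge0. Qed.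

Lemma pot_ge0 f x : (forall z, 0 <= f z) -> 0 <= pot f x.
Proof. by move=> f0; apply: Rintegral_ge0 => y _; rewrite mulr_ge0// dens_ge0. Qed.

Section on_set.
Variables (D : set X) (c : R).
Hypothesis mD : measurable D.
Hypothesis Doo : (m D < +oo)%E.
Hypothesis c0 : 0 <= c.
Hypothesis Kc : forall x, (\int[m]_y (\1_D y * K x y)%:E <= c%:E)%E.

Let mD1 : measurable_fun setT (\1_D : X -> R).
Proof. exact: measurable_indic. Qed.

(** The integral of the kernel over [D] is at most [c] from every point, so integrating first in the
    second variable leaves at most c |a|. Convergence of potentials on [D] rests on this bound. *)
Lemma integ_aDK (a : X -> R) : integ m a ->
  integ M2 (fun z => a z.1 * (\1_D z.2 * K z.1 z.2)).
Proof.
move=> Ia; have ma := integ_measurable Ia.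
have mk x : measurable_fun setT (fun y => (\1_D y * K x y)%:E).
  by apply/measurable_EFinP/measurable_funM => //; exact: measurable_K1.
apply: (integ_prod (h := fun x => c * `|a x|)); last exact/integZ/integ_norm.
  apply: measurable_funM; first exact: (measurableT_comp ma measurable_fst).
  by apply: measurable_funM => //; exact: (measurableT_comp mD1 measurable_snd).
move=> x; under eq_integral => y _.
  rewrite /= normrM (ger0_norm (_ : 0 <= \1_D y * K x y)) ?mulr_ge0// EFinM.
  over.
rewrite ge0_integralZl//=; last by move=> y _; rewrite lee_fin mulr_ge0.
by rewrite mulrC EFinM lee_wpmul2l// lee_fin.
Qed.

Lemma potDE f y : \1_D y * pot f y = (\int[m]_x (dens f x * (\1_D y * K x y)))%R.
Proof.
rewrite /pot indicE; case: (y \in D); rewrite /=.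
  rewrite mul1r; congr fine; apply: eq_integral => x _.
  by rewrite mul1r KC.
rewrite mul0r /Rintegral integral0_eq// => x _.
by rewrite mul0r mulr0.
Qed.

Lemma integ_potD f : integ m (dens f) -> integ m (fun y => \1_D y * pot f y).
Proof.
move=> Id; have [H _] := Rint_fubini2 (integ_aDK Id).
rewrite (_ : (fun y => \1_D y * pot f y) = (fun y : X => \int[m]_x (dens f x * (\1_D y * K x y)))%R)//.
by apply/funext => y; rewrite potDE.
Qed.

(** Fubini, read in the other variable: the integral defining the potential converges at almost
    every point of [D]. *)
Lemma pot_ae f : integ m (dens f) ->
  {ae m, forall y, D y -> integ m (fun x => dens f x * K y x)}.
Proof.
move=> Id; apply: filterS (integ_prod_ae2 (integ_aDK Id)) => y /= H Dy.
rewrite (_ : (fun x => _) = (fun x => dens f x * (\1_D y * K x y)))//.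
by apply/funext => x; rewrite indicE mem_set// mul1r KC.
Qed.

Section perturbation.
Variables (f g : X * X -> R) (B : R).
Hypothesis If : integ M2 f.
Hypothesis Icf : integ M2 (coul f).
Hypothesis mg : measurable_fun setT g.
Hypothesis B0 : 0 <= B.
Hypothesis gB : forall z, `|g z| <= B * (\1_D z.1 * \1_D z.2).

Let mu := fine (m D).
Let muE : mu%:E = m D. Proof. by rewrite fineK// ge0_fin_numE. Qed.
Let mu0 : 0 <= mu. Proof. exact: fine_ge0. Qed.

Let mgx x : measurable_fun setT (fun v => g (x, v)).
Proof. by apply: (measurableT_comp mg); exact: measurable_fun_pair. Qed.

Let Igx x : integ m (fun v => g (x, v)).
Proof.
apply: (integ_bounded (D := D) (B := B * \1_D x)) => // v.
by rewrite -mulrA; exact: (gB (x, v)).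
Qed.

Let intDZ (b : R) : 0 <= b -> (\int[m]_v (b * \1_D v)%:E = (b * mu)%:E)%E.
Proof.
move=> b0; under eq_integral do rewrite EFinM.
rewrite ge0_integralZl//=; last by apply/measurable_EFinP.
by rewrite integral_indic// setIT EFinM muE.
Qed.

Lemma dens_bound x : `|dens g x| <= B * mu * \1_D x.
Proof.
apply: le_trans (le_normr_Rintegral _ (Igx x)) _ => //.
rewrite -lee_fin (EFin_Rint (integ_norm (Igx x))).
apply: (@le_trans _ _ (\int[m]_v ((B * \1_D x) * \1_D v)%:E)%E).
  apply: ge0_le_integral => //.
  - by apply/measurable_EFinP/measurableT_comp.
  - by apply/measurable_EFinP/measurable_funM.
  - by move=> v _; rewrite lee_fin -mulrA; exact: (gB (x, v)).
by rewrite intDZ ?mulr_ge0// lee_fin mulrAC.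
Qed.

Let mr : measurable_fun setT (dens g). Proof. exact: measurable_dens. Qed.
Let Ir : integ m (dens g).
Proof. exact: (integ_bounded mD Doo mr dens_bound). Qed.
Let Idf : integ m (dens f). Proof. exact: integ_Rint1. Qed.
Let mdf := integ_measurable Idf.

Let mprod (a b : X -> R) : measurable_fun setT a -> measurable_fun setT b ->
  measurable_fun setT (fun z : X * X => a z.1 * b z.2 * K z.1 z.2).
Proof.
move=> ma mb; apply: measurable_funM => //; apply: measurable_funM.
  exact: (measurableT_comp ma measurable_fst).
exact: (measurableT_comp mb measurable_snd).
Qed.

Let bound_right (a : X -> R) z : `|a z.1 * dens g z.2 * K z.1 z.2| <=
  B * mu * (`|a z.1| * (\1_D z.2 * K z.1 z.2)).
Proof.
rewrite 2!normrM (ger0_norm (K_ge0 _ _)).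
have -> : B * mu * (`|a z.1| * (\1_D z.2 * K z.1 z.2)) =
  `|a z.1| * (B * mu * \1_D z.2) * K z.1 z.2 by ring.
by rewrite ler_wpM2r// ler_wpM2l// dens_bound.
Qed.

Let Iright (a : X -> R) : integ m a ->
  integ M2 (fun z => a z.1 * dens g z.2 * K z.1 z.2).
Proof.
move=> Ia; apply: (integ_le _ (bound_right a)).
  by apply: mprod => //; exact: integ_measurable Ia.
by apply: integZ; exact: (integ_aDK (integ_norm Ia)).
Qed.

Lemma integ_gpot : integ M2 (fun z => g z * pot f z.1).
Proof.
have mp := measurable_pot (integ_measurable If).
apply: (integ_prod (h := fun x => B * mu * `|\1_D x * pot f x|)).
- by apply: measurable_funM => //; exact: (measurableT_comp mp measurable_fst).
- move=> x; apply: (@le_trans _ _ (\int[m]_v ((B * \1_D x * `|pot f x|) * \1_D v)%:E)%E).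
    apply: ge0_le_integral => //.
    + apply/measurable_EFinP/measurableT_comp => //.
      exact: (measurable_funM (mgx x) (@measurable_cst _ _ _ _ setT (pot f x))).
    + by apply/measurable_EFinP/measurable_funM.
    + move=> v _; rewrite lee_fin normrM /=.
      have -> : B * \1_D x * `|pot f x| * \1_D v = B * (\1_D x * \1_D v) * `|pot f x| by ring.
      by rewrite ler_wpM2r//; exact: (gB (x, v)).
  rewrite intDZ ?mulr_ge0// lee_fin normrM (ger0_norm (_ : 0 <= \1_D x))//.
  by rewrite (_ : _ * mu = B * mu * (\1_D x * `|pot f x|))//; ring.
- exact/integZ/integ_norm/integ_potD.
Qed.

Lemma dens_out y : ~ D y -> dens g y = 0.
Proof.
move=> Dy; apply/eqP; rewrite -normr_le0; apply: le_trans (dens_bound y) _.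
by rewrite indicE memNset// mulr0.
Qed.

Lemma Rint_gpot :
  (\int[M2]_z (g z * pot f z.1) = \int[m]_x (dens g x * pot f x))%R.
Proof.
rewrite -(Rint_fubini1 integ_gpot); congr fine; apply: eq_integral => x _.
congr EFin; rewrite /=.
under eq_Rintegral do rewrite mulrC.
by rewrite (RintZ _ (Igx x)) mulrC.
Qed.

(** At almost every point of [D] the integral defining [pot f] converges and the constant [dens g y]
    can be pulled out; off [D] both sides vanish with [dens g]. *)
Let cross2 : (\int[M2]_z (dens f z.1 * dens g z.2 * K z.1 z.2) =
  \int[m]_x (dens g x * pot f x))%R.
Proof.
have [I1 <-] := Rint_fubini2 (Iright Idf).
apply: Rint_ae_eq; first exact: integ_measurable I1.
  by apply: measurable_funM => //; apply: measurable_pot; exact: integ_measurable If.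
apply: filterS (pot_ae Idf) => y H; have [Dy|Dy] := pselect (D y); last first.
  rewrite dens_out// mul0r /Rintegral integral0_eq// => x _.
  by rewrite /= mulr0 mul0r.
rewrite -(RintZ _ (H Dy)); congr fine; apply: eq_integral => x _.
by rewrite /= KC; congr EFin; ring.
Qed.

Let Ileft : integ M2 (fun z => dens g z.1 * dens f z.2 * K z.1 z.2).
Proof.
have := integ_swap (Iright Idf); congr (is_true (integ _ _)).
by apply/funext => z /=; rewrite KC; ring.
Qed.

Let cross1 : (\int[M2]_z (dens g z.1 * dens f z.2 * K z.1 z.2) =
  \int[m]_x (dens g x * pot f x))%R.
Proof.
rewrite -(Rint_fubini1 Ileft).
apply: Rint_ae_eq; first exact: (integ_measurable (integ_Rint1 Ileft)).
  by apply: measurable_funM => //; apply: measurable_pot; exact: integ_measurable If.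
apply: filterS (pot_ae Idf) => x H; have [Dx|Dx] := pselect (D x); last first.
  rewrite dens_out// mul0r /Rintegral integral0_eq// => y _.
  by rewrite /= !mul0r.
by rewrite -(RintZ _ (H Dx)); congr fine; apply: eq_integral => y _; rewrite /= mulrA.
Qed.

Let Igg : integ M2 (fun z => dens g z.1 * dens g z.2 * K z.1 z.2).
Proof. exact: Iright. Qed.

(** Two factors B mu bound the densities, the inner integral of the kernel contributes [c] and the
    outer one [mu]. *)
Let Rint_gg : `| (\int[M2]_z (dens g z.1 * dens g z.2 * K z.1 z.2))%R | <=
  (B * mu) ^+ 2 * mu * c.
Proof.
apply: le_trans (le_normr_Rintegral _ Igg) _ => //.
have ID : integ m (fun x => B * mu * \1_D x).
  by apply: (integ_bounded (D := D) (B := B * mu)) => // [|x]; [exact: measurable_funM|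
    rewrite ger0_norm// !mulr_ge0].
have ID2 := integZ (B * mu) (integ_aDK ID).
have Inn := integ_norm Igg.
apply: (@le_trans _ _ (\int[M2]_z (B * mu * (B * mu * \1_D z.1 * (\1_D z.2 * K z.1 z.2))))%R).
  apply: Rint_le => // z; apply: le_trans (bound_right _ _) _.
  rewrite ler_wpM2l ?mulr_ge0// ler_wpM2r ?mulr_ge0//; exact: dens_bound.
rewrite -(Rint_fubini1 ID2).
have I3 : integ m (fun x => (B * mu) ^+ 2 * c * \1_D x).
  apply: (integ_bounded (D := D) (B := (B * mu) ^+ 2 * c)) => // [|x].
    exact: measurable_funM.
  by rewrite ger0_norm// ?mulr_ge0// ?exprn_ge0// mulr_ge0.
apply: (@le_trans _ _ (\int[m]_x ((B * mu) ^+ 2 * c * \1_D x))%R).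
  apply: Rint_le => //; first exact: integ_Rint1 ID2.
  move=> x /=.
  have mk : measurable_fun setT (fun y => \1_D y * K x y).
    by apply: measurable_funM => //; exact: measurable_K1.
  have Ik : integ m (fun y => \1_D y * K x y).
    apply: integ_ge0P => // [y|]; first by rewrite mulr_ge0.
    by apply: le_lt_trans (Kc x) _; rewrite ltry.
  under eq_Rintegral do rewrite mulrA.
  rewrite (RintZ _ Ik) (_ : _ * c * _ = B * mu * (B * mu * \1_D x) * c); last ring.
  rewrite ler_wpM2l ?mulr_ge0//.
  by rewrite -lee_fin (EFin_Rint Ik).
have I1 : integ m (\1_D : X -> R).
  apply: (integ_bounded (D := D) (B := 1)) => // x; by rewrite mul1r ger0_norm.
rewrite (RintZ _ I1) (_ : (\int[m]_x \1_D x)%R = mu); last first.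
  by rewrite /Rintegral integral_indic// setIT.
by rewrite mulrAC.
Qed.

Let dens_add : {ae m, forall x, dens (fun z => f z + g z) x = dens f x + dens g x}.
Proof.
apply: filterS (integ_prod_ae1 If) => x Ifx.
exact: (RintD Ifx (Igx x)).
Qed.

Let coul_add : {ae M2, forall z, coul f z + dens f z.1 * dens g z.2 * K z.1 z.2 +
   (dens g z.1 * dens f z.2 * K z.1 z.2 + dens g z.1 * dens g z.2 * K z.1 z.2) =
   coul (fun z => f z + g z) z}.
Proof.
apply: filterS2 (ae_fst m dens_add) (ae_snd m dens_add) => z h1 h2.
by rewrite /coul h1 h2; ring.
Qed.

Let Isum := integD (integD Icf (Iright Idf)) (integD Ileft Igg).
Let mfg : measurable_fun setT (fun z => f z + g z).
Proof. by apply: measurable_funD => //; exact: integ_measurable If. Qed.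

Lemma integ_coul_add : integ M2 (coul (fun z => f z + g z)).
Proof. exact: (integ_ae_eq (measurable_coul mfg) coul_add Isum). Qed.

(** Expansion of a quadratic form: the two cross terms agree by the symmetry of the kernel, and the
    remainder is quadratic in the size [B] of the perturbation. *)
Lemma Rint_coul_add :
  `| (\int[M2]_z coul (fun z => f z + g z) z - (\int[M2]_z coul f z +
      2 * \int[M2]_z (g z * pot f z.1)))%R | <= (B * mu) ^+ 2 * mu * c.
Proof.
rewrite -(Rint_ae_eq (integ_measurable Isum) (measurable_coul mfg) coul_add).
rewrite (RintD (integD Icf (Iright Idf)) (integD Ileft Igg)).
rewrite (RintD Icf (Iright Idf)) (RintD Ileft Igg) cross1 cross2 Rint_gpot.
by rewrite (_ : _ - _ = (\int[M2]_z (dens g z.1 * dens g z.2 * K z.1 z.2))%R); [|ring].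
Qed.

End perturbation.
End on_set.

(** A slice of the Coulomb density, divided by [dens f x], shows that the potential converges at
    almost every [x] of nonzero density; where the density is zero both partial integrals vanish.
    This serves the numerator of the multiplier, where [f] is not confined to a box. *)
Lemma integ_fpot f : (forall z, 0 <= f z) -> integ M2 f -> integ M2 (coul f) ->
  integ M2 (fun z => f z * pot f z.1) /\
  (\int[M2]_z (f z * pot f z.1) = \int[M2]_z coul f z)%R.
Proof.
move=> f0 If Ic; have mf := integ_measurable If.
have mp := measurable_pot mf.
have Id : integ m (dens f) by exact: integ_Rint1.
have E x : (\int[m]_y (coul f (x, y)))%R = dens f x * pot f x \/
    ~ integ m (fun y => dens f y * K x y).
  have [H|] := pselect (is_true (integ m (fun y => dens f y * K x y))); last by right.
  by left; rewrite -(RintZ _ H); congr fine; apply: eq_integral => y _; rewrite /coul/= mulrA.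
have E' : {ae m, forall x, (\int[m]_y (coul f (x, y)))%R = dens f x * pot f x}.
  apply: filterS (integ_prod_ae1 Ic) => x Icx.
  have [d0|d0] := eqVneq (dens f x) 0.
    rewrite d0 mul0r /Rintegral integral0_eq// => y _.
    by rewrite /coul/= d0 !mul0r.
  have [//|[]] := E x.
  have := integZ (dens f x)^-1 Icx; congr (is_true (integ _ _)).
  by apply/funext => y; rewrite /coul/= -mulrA mulKf.
have Idp : integ m (fun x => dens f x * pot f x).
  apply: (integ_ae_eq _ E' (integ_Rint1 Ic)).
  by apply: measurable_funM => //; exact: measurable_dens.
have If1 := integ_prod_ae1 If.
have Ifp : integ M2 (fun z => f z * pot f z.1).
  apply: (integ_prod_ae (h := fun x => dens f x * pot f x)) => //.
    by apply: measurable_funM => //; exact: (measurableT_comp mp measurable_fst).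
  apply: filterS If1 => x Ifx.
  under eq_integral => v _.
    rewrite /= ger0_norm ?mulr_ge0 ?pot_ge0// mulrC.
    over.
  by rewrite -(EFin_Rint (integZ _ Ifx)) (RintZ _ Ifx) mulrC.
split=> //; rewrite -(Rint_fubini1 Ifp) -(Rint_fubini1 Ic).
apply: Rint_ae_eq.
- exact: integ_measurable (integ_Rint1 Ifp).
- exact: integ_measurable (integ_Rint1 Ic).
apply: filterS2 E' If1 => x -> Ifx /=.
under eq_Rintegral do rewrite mulrC.
by rewrite (RintZ _ Ifx) mulrC.
Qed.

End coulomb.

(** * The Euler-Lagrange relation *)

Lemma le_indic {R : realType} (U : Type) (A B : set U) (z : U) :
  A `<=` B -> \1_A z <= \1_B z :> R.
Proof.
move=> AB; rewrite !indicE; have [zA|zA] := pselect (A z).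
  by rewrite (mem_set zA) (mem_set (AB _ zA)).
by rewrite (memNset zA) ler0n.
Qed.

Lemma measurable_inv_pos {R : realType} d (U : measurableType d) (u : U -> R) :
  measurable_fun setT u -> (forall z, 0 < u z) ->
  measurable_fun setT (fun z => (u z)^-1).
Proof.
move=> mu u0; rewrite (_ : (fun z => (u z)^-1) = (fun z => u z `^ (-1))).
  exact: (measurableT_comp (measurable_powR _) mu).
by apply/funext => z; rewrite powR_inv1// ltW.
Qed.

Section euler_lagrange.
Context {R : realType} d (X : measurableType d).
Variable m : {sigma_finite_measure set X -> \bar R}.
Local Notation M2 := (m \x m)%E.
Variable K : X -> X -> R.
Hypothesis K_ge0 : forall x y, 0 <= K x y.
Hypothesis mK : measurable_fun setT (fun z : X * X => K z.1 z.2).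
Hypothesis KC : forall x y, K x y = K y x.
Local Notation dens := (dens m).
Local Notation pot := (pot m K).
Local Notation coul := (coul m K).

Variables (Q : R -> R) (C k M : R).
Hypothesis Q_C1 : hC1 Q.
Hypothesis Q_ge0 : forall s : R, 0 <= s -> 0 <= Q s.
Hypothesis Q_0 : Q 0 = 0.
Hypothesis C_gt0 : 0 < C.
Hypothesis Q1 : forall s : R, 0 <= s -> C * (s + s `^ (1 + 1 / k)) <= Q s.
Hypothesis Q2 : convex_function (`[0, +oo[%classic : set R^o) (Q : R^o -> R^o).
Local Notation Q' := (hderive Q).

Variable D : nat -> set X.
Hypothesis mD : forall n, measurable (D n).
Hypothesis Doo : forall n, (m (D n) < +oo)%E.
Hypothesis DT : \bigcup_n D n = setT.
Hypothesis Dnd : forall n p, (n <= p)%N -> D n `<=` D p.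
Variable c : nat -> R.
Hypothesis c0 : forall n, 0 <= c n.
Hypothesis Kc : forall n x, (\int[m]_y (\1_(D n) y * K x y)%:E <= (c n)%:E)%E.

Variable T : X * X -> R.
Hypothesis mT : measurable_fun setT T.
Hypothesis T_ge0 : forall z, 0 <= T z.
Variable tau : nat -> R.
Hypothesis Ttau : forall n z, D n z.1 -> D n z.2 -> T z <= tau n.

Variable f : X * X -> R.
Hypothesis f_ge0 : forall z, 0 <= f z.
Hypothesis If : integ M2 f.
Hypothesis Ic : integ M2 (coul f).
Hypothesis IT : integ M2 (fun z => T z * f z).
Hypothesis QM : (\int[M2]_z (Q (f z))%:E = M%:E)%E.
Hypothesis f_min : forall g, integ M2 g -> (forall z, 0 <= g z) ->
  (\int[M2]_z (Q (g z))%:E = M%:E)%E -> integ M2 (fun z => T z * g z) ->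
  integ M2 (coul g) ->
  (\int[M2]_z (T z * f z) - 2^-1 * \int[M2]_z coul f z <=
   \int[M2]_z (T z * g z) - 2^-1 * \int[M2]_z coul g z)%R.

Let E z := T z - pot f z.1.
Let mf := integ_measurable If.
Let Id : integ m (dens f). Proof. exact: integ_Rint1. Qed.

Let box n : set (X * X) := D n `*` D n.
Let mbox n : measurable (box n). Proof. exact: measurableX. Qed.

Let indic_box n z : \1_(box n) z = \1_(D n) z.1 * \1_(D n) z.2 :> R.
Proof.
rewrite !indicE; have [zb|zb] := pselect (box n z).
  by case: (zb) => ? ?; rewrite !mem_set// mulr1.
rewrite memNset//; have [z1|z1] := pselect (D n z.1).
  by rewrite (memNset (A := D n) (u := z.2)) ?mulr0// => z2; exact: zb.
by rewrite (memNset (A := D n) (u := z.1)) ?mul0r.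
Qed.

Let box_lty n : (M2 (box n) < +oo)%E.
Proof.
rewrite (_ : M2 (box n) = (m (D n) * m (D n))%E); last exact: product_measure1E.
by rewrite lte_mul_pinfty// ge0_fin_numE.
Qed.

Let mp : measurable_fun setT (pot f). Proof. exact: measurable_pot. Qed.
Let mE : measurable_fun setT E.
Proof. by apply: measurable_funB => //; exact: (measurableT_comp mp measurable_fst). Qed.

(** The weight [T] is at most [tau n] on the box, and the potential is integrable there. *)
Let IEbox n : integ M2 (fun z => `|E z| * \1_(box n) z).
Proof.
have tau0 : 0 <= `|tau n| by [].
have I1 : integ M2 (fun z => \1_(box n) z * pot f z.1).
  apply: (integ_gpot K_ge0 mK KC (mD n) (Doo n) (Kc n) If (B := 1)) => // z.
  by rewrite mul1r ger0_norm// indic_box.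
have I2 : integ M2 (fun z => `|tau n| * \1_(box n) z).
  apply: (integ_bounded (mbox n) (box_lty n) (B := `|tau n|)) => [|z].
    exact: measurable_funM.
  by rewrite ger0_norm// mulr_ge0.
apply: (integ_le _ _ (integD (integ_norm I1) I2)).
  by apply: measurable_funM => //; exact: measurableT_comp.
move=> z; rewrite indicE; have [zb|zb] := pselect (box n z); last first.
  by rewrite memNset// !mulr0 addr0 mul0r normr0.
rewrite mem_set// !mulr1 mul1r normr_id /E addrC.
apply: le_trans (ler_normD _ _) _; rewrite normrN lerD2l.
rewrite ger0_norm//; apply: le_trans (ler_norm _).
by case: zb => ? ?; exact: Ttau.
Qed.

Let mQ : measurable_fun setT (fun z => Q (f z)).
Proof. by have [] := measurable_Qc Q_C1 Q_0 C_gt0 Q1 Q2 mf f_ge0. Qed.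
Let mQ' : measurable_fun setT (fun z => Q' (f z)).
Proof. by have [] := measurable_Qc Q_C1 Q_0 C_gt0 Q1 Q2 mf f_ge0. Qed.
Let Q'_gt0 z : 0 < Q' (f z). Proof. exact: (Q'_gt0 Q_C1 Q_0 C_gt0 Q1 Q2). Qed.
Let Q'_geC z : C <= Q' (f z). Proof. exact: (Q'_geC Q_C1 Q_0 C_gt0 Q1 Q2). Qed.

Let IQ : integ M2 (fun z => Q (f z)).
Proof.
by apply: integ_ge0P => // [z|]; [exact: Q_ge0|rewrite QM ltry].
Qed.

Section competitor.
Variables (n : nat) (h : X * X -> R) (B t0 : R).
Hypothesis mh : measurable_fun setT h.
Hypothesis B0 : 0 <= B.
Hypothesis hB : forall z, `|h z| <= B * \1_(box n) z.
Hypothesis h0 : (\int[M2]_z h z = 0)%R.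
Hypothesis t00 : 0 < t0.
Hypothesis ht0 : forall z, 0 <= Q (f z) + t0 * h z.

Let Ih : integ M2 h. Proof. exact: (integ_bounded (mbox n) (box_lty n) mh hB). Qed.

(* Moving along [Q^-1] satisfies the Casimir constraint exactly:
   the integral of [Q (fg t z)] is that of [Q (f z) + t * h z]. *)
Let fg (t : R) z := Qinv Q (Q (f z) + t * h z).
Let g t z := fg t z - f z.

Section fixed_t.
Variable t : R.
Hypothesis t_gt0 : 0 < t.
Hypothesis t_le : t <= t0.

Let Qth z : 0 <= Q (f z) + t * h z.
Proof.
have [hz|hz] := leP 0 (h z); first by rewrite addr_ge0 ?Q_ge0// mulr_ge0// ltW.
by apply: le_trans (ht0 z) _; rewrite lerD2l ler_wnM2r// ltW.
Qed.

Let mfg : measurable_fun setT (fg t).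
Proof.
apply: (measurableT_comp (measurable_Qinv Q_C1 Q_0 C_gt0 Q1 Q2)).
by apply: measurable_funD => //; exact: measurable_funM.
Qed.

Let mg : measurable_fun setT (g t). Proof. exact: measurable_funB. Qed.

Let g_h z : `|g t z| <= t / C * `|h z|.
Proof.
have Q0 : 0 <= Q (f z) by exact: Q_ge0.
have := Qinv_lip Q_C1 Q_0 C_gt0 Q1 Q2 (Qth z) Q0.
rewrite (QK Q_C1 Q_0 C_gt0 Q1 Q2)// (addrC (Q (f z))) addrK normrM gtr0_norm//.
by rewrite /g /fg (addrC (Q (f z))) mulrAC ler_pdivlMr// mulrC.
Qed.

Let g_bound z : `|g t z| <= t / C * B * \1_(box n) z.
Proof.
apply: le_trans (g_h z) _; rewrite -(mulrA (t / C)) ler_wpM2l// divr_ge0// ltW//.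
Qed.

Let g_bound' z : `|g t z| <= t / C * B * (\1_(D n) z.1 * \1_(D n) z.2).
Proof. by rewrite -indic_box; exact: g_bound. Qed.

Let tCB0 : 0 <= t / C * B. Proof. by rewrite mulr_ge0// divr_ge0// ltW. Qed.

Let Ig : integ M2 (g t).
Proof. exact: (integ_bounded (mbox n) (box_lty n) mg g_bound). Qed.

Let IEg : integ M2 (fun z => E z * g t z).
Proof.
apply: (integ_le _ _ (integZ (t / C * B) (IEbox n))); first exact: measurable_funM.
move=> z; rewrite normrM mulrCA ler_wpM2l//; exact: g_bound.
Qed.

Let Igp : integ M2 (fun z => g t z * pot f z.1).
Proof. exact: (integ_gpot K_ge0 mK KC (mD n) (Doo n) (Kc n) If mg tCB0 g_bound'). Qed.

(** Minimality against [fg t]: the weight [T] enters linearly and the Coulomb form by its expansion;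
    the linear terms combine to the integral of E g, and half the quadratic remainder is left
    over. *)
Lemma competitor_ineq :
  0 <= (\int[M2]_z (E z * g t z))%R + 2^-1 * ((t / C * B * fine (m (D n))) ^+ 2 * fine (m (D n)) * c n).
Proof.
have fgE : fg t = (fun z => f z + g t z) by apply/funext => z; rewrite /g addrC subrK.
have ITg : integ M2 (fun z => T z * g t z).
  have := integD IEg Igp; congr (is_true (integ _ _)).
  by apply/funext => z; rewrite /E; ring.
have Ifg : integ M2 (fg t) by rewrite fgE; exact: integD.
have fg0 z : 0 <= fg t z by exact: (Qinv_ge0 Q_C1 Q_0 C_gt0 Q1 Q2).
have QfgM : (\int[M2]_z (Q (fg t z))%:E = M%:E)%E.
  transitivity (\int[M2]_z (Q (f z) + t * h z)%:E)%E.
    by apply: eq_integral => z _; rewrite /fg (QinvK Q_C1 Q_0 C_gt0 Q1 Q2).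
  rewrite -(EFin_Rint (integD IQ (integZ t Ih))) (RintD IQ (integZ t Ih)).
  by rewrite (RintZ _ Ih) h0 mulr0 addr0 (EFin_Rint IQ).
have ITfg : integ M2 (fun z => T z * fg t z).
  have := integD IT ITg; congr (is_true (integ _ _)).
  by apply/funext => z; rewrite fgE; ring.
have Icfg : integ M2 (coul (fg t)).
  rewrite fgE.
  exact: (integ_coul_add K_ge0 mK KC (mD n) (Doo n) (Kc n) If Ic mg tCB0 g_bound').
have := f_min Ifg fg0 QfgM ITfg Icfg.
have := Rint_coul_add K_ge0 mK KC (mD n) (Doo n) (c0 n) (Kc n) If Ic mg tCB0 g_bound'.
rewrite -fgE.
have -> : (\int[M2]_z (T z * fg t z) = \int[M2]_z (T z * f z) + \int[M2]_z (T z * g t z))%R.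
  rewrite -(RintD IT ITg); congr fine; apply: eq_integral => z _.
  by congr EFin; rewrite fgE; ring.
have -> : (\int[M2]_z (T z * g t z) = \int[M2]_z (E z * g t z) + \int[M2]_z (g t z * pot f z.1))%R.
  rewrite -(RintD IEg Igp); congr fine; apply: eq_integral => z _.
  by congr EFin; rewrite /E; ring.
set e := (_ ^+ 2 * _ * _); rewrite ler_norml => /andP[+ _].
lra.
Qed.

Lemma competitor_ineq_div :
  0 <= (\int[M2]_z (E z * (g t z / t)))%R +
    t * (2^-1 * ((C^-1 * B * fine (m (D n))) ^+ 2 * fine (m (D n)) * c n)).
Proof.
have := competitor_ineq.
have -> : (\int[M2]_z (E z * g t z) = t * \int[M2]_z (E z * (g t z / t)))%R.
  have I1 : integ M2 (fun z => E z * (g t z / t)).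
    have := integZ t^-1 IEg; congr (is_true (integ _ _)).
    by apply/funext => z; ring.
  rewrite -(RintZ _ I1); congr fine; apply: eq_integral => z _; congr EFin.
  by field; rewrite gt_eqF.
move=> H; rewrite -(pmulr_rge0 _ t_gt0); apply: le_trans H _.
by rewrite le_eqVlt; apply/orP; left; apply/eqP; ring.
Qed.

Lemma g_div_bound z : `|E z * (g t z / t)| <= B / C * (`|E z| * \1_(box n) z).
Proof.
rewrite normrM mulrCA ler_wpM2l// normrM normfV (gtr0_norm t_gt0) ler_pdivrMr//.
by apply: le_trans (g_bound z) _; rewrite le_eqVlt; apply/orP; left; apply/eqP; ring.
Qed.

Lemma measurable_g_div : measurable_fun setT (fun z => E z * (g t z / t)).
Proof. by apply: measurable_funM => //; exact: measurable_funM. Qed.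

End fixed_t.

(** As t tends to 0 the remainder, of order t after division by t, disappears, and the quotients g /
    t tend pointwise to h / Q'(f); the products with E have the integrable majorant (B / C) |E| on
    the box. *)
Lemma first_variation : 0 <= (\int[M2]_z (E z * (h z / Q' (f z))))%R.
Proof.
(* All times stay at most [t0], so that Q(f) + t h remains nonnegative. *)
pose t j : R := t0 * @harmonic R j.
have hp j : 0 < @harmonic R j by exact: harmonic_gt0.
have t_gt0 j : 0 < t j by rewrite mulr_gt0.
have t_le j : t j <= t0.
  by rewrite /t -[leRHS]mulr1 ler_pM2l// /harmonic /= invf_le1// ler1n.
have t_cvg : t @ \oo --> 0.
  rewrite -[X in _ --> X](mulr0 t0).
  exact: (cvgMl_tmp (a := t0) (@cvg_harmonic R)).
have Qth j z : 0 <= Q (f z) + t j * h z.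
  have [hz|hz] := leP 0 (h z); first by rewrite addr_ge0 ?Q_ge0// mulr_ge0// ltW.
  by apply: le_trans (ht0 z) _; rewrite lerD2l ler_wnM2r// ltW.
have lim := Rint_dominated (mu := M2) (u := fun j z => E z * (g (t j) z / t j))
  (f := fun z => E z * (h z / Q' (f z))) (h := fun z => B / C * (`|E z| * \1_(box n) z)).
have {}lim := lim (fun j => measurable_g_div (t j)).
have mEh : measurable_fun setT (fun z => E z * (h z / Q' (f z))).
  apply: measurable_funM => //; apply: measurable_funM => //.
  exact: measurable_inv_pos.
have {}lim := lim mEh (integZ _ (IEbox n)) (fun j => g_div_bound (t_gt0 j) (t_le j)).
set cst := 2^-1 * ((C^-1 * B * fine (m (D n))) ^+ 2 * fine (m (D n)) * c n).
have lim2 : (\int[M2]_z (E z * (g (t j) z / t j)))%R + t j * cst @[j --> \oo] -->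
    (\int[M2]_z (E z * (h z / Q' (f z))))%R + 0 * cst.
  apply: cvgD; last exact: cvgMr_tmp.
  apply: lim => z; apply: cvgMl_tmp.
  exact: (Qinv_curve Q_C1 Q_0 C_gt0 Q1 Q2 (f_ge0 z) t_gt0 (fun j => Qth j z) t_cvg).
rewrite mul0r addr0 in lim2.
rewrite -(cvg_lim _ lim2)//; apply: limr_ge.
  by apply/cvg_ex; eexists; exact: lim2.
by apply: nearW => j; exact: competitor_ineq_div.
Qed.

End competitor.

(** The Euler-Lagrange relation says that [w] equals a constant on {f > 0} and is at least that
    constant elsewhere; the constant is the multiplier. *)
Let w z := E z / Q' (f z).
Let mw : measurable_fun setT w.
Proof.
by apply: measurable_funM => //; exact: measurable_inv_pos.
Qed.

Let Iw n (A : set (X * X)) : measurable A -> A `<=` box n -> integ M2 (fun z => w z * \1_A z).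
Proof.
move=> mA An; apply: (integ_le _ _ (integZ C^-1 (IEbox n))).
  have m1 : measurable_fun setT (\1_A : X * X -> R) by exact: measurable_indic.
  exact: measurable_funM.
move=> z; rewrite normrM (ger0_norm (_ : 0 <= \1_A z))// mulrA.
have wC : `|w z| <= C^-1 * `|E z|.
  rewrite /w normrM mulrC; apply: ler_wpM2r => //.
  by rewrite normfV (gtr0_norm (Q'_gt0 z)) lef_pV2 ?posrE.
by apply: ler_pM => //; exact: le_indic.
Qed.

Let Ione n (A : set (X * X)) : measurable A -> A `<=` box n ->
  integ M2 (\1_A) /\ (\int[M2]_z \1_A z)%R = fine (M2 A).
Proof.
move=> mA An; split; last by rewrite /Rintegral integral_indic// setIT.
apply: (integ_bounded (mbox n) (box_lty n) (B := 1)) => // z; rewrite mul1r ger0_norm//.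
exact: le_indic.
Qed.

Hypothesis f_neq0 : ~ {ae M2, forall z, f z = 0}.

(** The perturbation |B| 1_A - |A| 1_B moves Casimir mass from [B] to [A]: it has integral 0 and is
    negative only on [B], where Q(f) >= C / (n + 1) leaves room. For sets of positive measure the
    conclusion says that the mean of [w] over [B] is at most its mean over [A]. *)
Lemma two_sets n (A B : set (X * X)) : measurable A -> A `<=` box n ->
  measurable B -> B `<=` box n -> (forall z, B z -> n.+1%:R^-1 <= f z) ->
  (\int[M2]_z (w z * \1_B z))%R * fine (M2 A) <= (\int[M2]_z (w z * \1_A z))%R * fine (M2 B).
Proof.
move=> mA An mB Bn Bf.
have [IA EA] := Ione mA An; have [IB EB] := Ione mB Bn.
set a := fine (M2 A); set b := fine (M2 B).
have a0 : 0 <= a by exact: fine_ge0. have b0 : 0 <= b by exact: fine_ge0.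
have I1 (S : set (X * X)) z : 0 <= \1_S z :> R by [].
have Ab z (S : set (X * X)) : S `<=` box n -> \1_S z <= \1_(box n) z :> R.
  exact: le_indic.
pose h z : R := b * \1_A z - a * \1_B z.
have mh : measurable_fun setT h.
  by apply: measurable_funB; exact: measurable_funM.
have hB z : `|h z| <= (b + a) * \1_(box n) z.
  apply: le_trans (ler_normB _ _) _; rewrite mulrDl.
  by rewrite !ger0_norm ?mulr_ge0// lerD// ler_wpM2l// Ab.
have h0 : (\int[M2]_z h z = 0)%R.
  by rewrite (RintB (integZ b IA) (integZ a IB)) (RintZ _ IA) (RintZ _ IB) EA EB mulrC subrr.
(* Then t0 a <= C / (n + 1) <= Q(f) on [B]; adding 1 to [a] avoids a division by 0 when [A] is
   null. *)
pose t0 := C / n.+1%:R / (a + 1).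
have t00 : 0 < t0 by rewrite !divr_gt0// ltr_wpDl.
have ht0 z : 0 <= Q (f z) + t0 * h z.
  have [zB|zB] := pselect (B z); last first.
    rewrite /h (_ : \1_B z = 0); last by rewrite indicE memNset.
    rewrite mulr0 subr0 addr_ge0 ?Q_ge0// mulr_ge0//.
      exact: ltW.
    by rewrite mulr_ge0.
  have Qf : C * f z <= Q (f z).
    by apply: le_trans (Q1 (f_ge0 z)); rewrite ler_pM2l// lerDl powR_ge0.
  have : t0 * a <= C * f z.
    apply: (@le_trans _ _ (C / n.+1%:R)); last by rewrite ler_pM2l//; exact: Bf.
    rewrite /t0 -mulrA -[leRHS]mulr1 ler_wpM2l ?divr_ge0 ?(ltW C_gt0)//.
    by rewrite mulrC ler_pdivrMr ?ltr_wpDl// mul1r lerDl.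
  have : 0 <= t0 * (b * \1_A z) by apply: mulr_ge0; [exact: ltW|exact: mulr_ge0].
  rewrite /h (_ : \1_B z = 1); last by rewrite indicE mem_set.
rewrite mulr1 mulrBr; lra.
have ab0 : 0 <= b + a by rewrite addr_ge0.
have := first_variation mh ab0 hB h0 t00 ht0.
have -> : (\int[M2]_z (E z * (h z / Q' (f z))) = \int[M2]_z (b * (w z * \1_A z) - a * (w z * \1_B z)))%R.
  by congr fine; apply: eq_integral => z _; congr EFin; rewrite /w /h; ring.
rewrite (RintB (integZ b (Iw mA An)) (integZ a (Iw mB Bn))).
rewrite (RintZ _ (Iw mA An)) (RintZ _ (Iw mB Bn)) subr_ge0.
by rewrite mulrC [leRHS]mulrC.
Qed.

Let box_nd n p : (n <= p)%N -> box n `<=` box p.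
Proof. by move=> np z [? ?]; split; apply: (Dnd np). Qed.

Let box_cover z : exists n, box n z.
Proof.
have H x : exists n, D n x.
  by have : [set: X] x by []; rewrite -DT => -[n _ Dx]; exists n.
have [n1 h1] := H z.1; have [n2 h2] := H z.2.
exists (maxn n1 n2); split; [apply: Dnd h1; exact: leq_maxl|apply: Dnd h2; exact: leq_maxr].
Qed.

Let pos_set n : set (X * X) := box n `&` [set z | n.+1%:R^-1 <= f z].
Let mpos n : measurable (pos_set n).
Proof.
apply: measurableI => //; rewrite -[X in measurable X]setTI.
rewrite (_ : [set z | _] = f @^-1` `[n.+1%:R^-1, +oo[%classic); first exact: mf.
by apply/seteqP; split => z /=; rewrite in_itv/= andbT.
Qed.

Let pos_cover z : 0 < f z -> exists n, pos_set n z.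
Proof.
move=> fz; have [n bn] := box_cover z.
pose p := Num.truncn (f z)^-1.
exists (maxn n p); split; first by apply: box_nd bn; exact: leq_maxl.
rewrite /= -[leRHS]invrK lef_pV2 ?posrE ?invr_gt0//.
apply: le_trans (ltW (truncnS_gt _)) _.
by rewrite ler_nat ltnS leq_maxr.
Qed.

Let exists_pos : exists n, (0 < M2 (pos_set n))%E.
Proof.
apply: contrapT => H; apply: f_neq0.
have H' n : M2 (pos_set n) = 0%E.
  by apply/eqP; rewrite -measure_le0 leNgt; apply/negP => Hn; apply: H; exists n.
have : {ae M2, forall z, forall n, ~ pos_set n z}.
  apply/ae_foralln => n; exists (pos_set n); split; [exact: mpos|exact: H'|by move=> z /= /contrapT].
apply: filterS => z Hz; apply/eqP; rewrite eq_le f_ge0 andbT leNgt; apply/negP.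
by move=> /pos_cover[n]; exact: Hz.
Qed.

(** The multiplier is the mean of [w] over a fixed set [B0] of positive measure on which f is
    bounded below. Any piece of {w < lam} may receive mass from [B0], and any piece of {w > lam}
    with f bounded below may give mass to [B0]; the comparison of means forces both to be null. *)
Lemma euler_lagrange : exists lam : R,
  {ae M2, forall z, lam * Q' (f z) <= E z /\ (0 < f z -> E z = lam * Q' (f z))}.
Proof.
have [n0 pn0] := exists_pos.
pose B0 := pos_set n0; pose b0 := fine (M2 B0).
have B0n : B0 `<=` box n0 by move=> z [].
have b0_gt0 : 0 < b0.
  rewrite fine_gt0// pn0/=; apply: le_lt_trans (box_lty n0).
  by apply: le_measure; rewrite ?inE//; exact: mpos.
pose lam := (\int[M2]_z (w z * \1_B0 z))%R / b0.
exists lam.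
have lamb : (\int[M2]_z (w z * \1_B0 z))%R = lam * b0 by rewrite /lam divfK// gt_eqF.
(* A set is null if [w] lies strictly on one side of [lam] on it while its integral places it weakly
   on the other; [s] is 1 or -1 according to the side. *)
have null n (A : set (X * X)) (s : R) : measurable A -> A `<=` box n ->
    (forall z, A z -> 0 < s * (w z - lam)) ->
    s * ((\int[M2]_z (w z * \1_A z))%R - lam * fine (M2 A)) <= 0 ->
    {ae M2, forall z, ~ A z}.
  move=> mA An As As0.
  have [I1 E1] := Ione mA An.
  have Is : integ M2 (fun z => s * (w z * \1_A z - lam * \1_A z)).
    by apply/integZ/integB; [exact: Iw mA An|exact: integZ].
  have s0 z : 0 <= s * (w z * \1_A z - lam * \1_A z).
    rewrite indicE; have [zA|zA] := pselect (A z).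
      by rewrite mem_set// !mulr1 ltW// As.
    by rewrite memNset// !mulr0 subrr mulr0.
  have Is0 : (\int[M2]_z (s * (w z * \1_A z - lam * \1_A z)) = 0)%R.
    apply/eqP; rewrite eq_le Rintegral_ge0 ?andbT//.
    rewrite (RintZ _ (integB (Iw mA An) (integZ lam I1))).
    by rewrite (RintB (Iw mA An) (integZ lam I1)) (RintZ _ I1) E1.
  apply: filterS (Rint_ge0_eq0 Is s0 Is0) => z + zA.
  by rewrite indicE mem_set// !mulr1 => h; have := As z zA; rewrite h ltxx.
have mle : measurable [set z | w z < lam].
  rewrite -[X in measurable X]setTI (_ : [set z | _] = w @^-1` `]-oo, lam[%classic); first exact: mw.
  by apply/seteqP; split => z /=; rewrite in_itv.
have mge : measurable [set z | lam < w z].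
  rewrite -[X in measurable X]setTI (_ : [set z | _] = w @^-1` `]lam, +oo[%classic); first exact: mw.
  by apply/seteqP; split => z /=; rewrite in_itv/= andbT.
have ae1 : {ae M2, forall z, forall n, ~ (box n `&` [set z | w z < lam]) z}.
  (* The larger box contains both sets, and the lower bound 1 / (n0 + 1) on [B0] implies 1 / (N +
     1). *)
  apply/ae_foralln => n; pose N := maxn n n0.
  have bN : box n0 `<=` box N by apply: box_nd; exact: leq_maxr.
  apply: (null N _ (-1)); first exact: measurableI.
  - by move=> z [bz _]; apply: box_nd bz; exact: leq_maxl.
  - by move=> z [_ /= wz]; rewrite mulN1r oppr_gt0 subr_lt0.
  rewrite mulN1r oppr_le0 subr_ge0.
  have An : box n `&` [set z | w z < lam] `<=` box N.
    by move=> z [bz _]; apply: box_nd bz; exact: leq_maxl.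
  have := @two_sets N _ B0 (measurableI _ _ (mbox n) mle) An (mpos n0) (subset_trans B0n bN).
  have H z : B0 z -> N.+1%:R^-1 <= f z.
    move=> [_ /=]; apply: le_trans; rewrite lef_pV2 ?posrE// ler_nat ltnS.
    exact: leq_maxr.
  by move=> /(_ H); rewrite lamb mulrAC ler_pM2r.
have ae2 : {ae M2, forall z, forall n, ~ (pos_set n `&` [set z | lam < w z]) z}.
  apply/ae_foralln => n; pose N := maxn n n0.
  have bN : box n0 `<=` box N by apply: box_nd; exact: leq_maxr.
  have An : pos_set n `&` [set z | lam < w z] `<=` box N.
    by move=> z [[bz _] _]; apply: box_nd bz; exact: leq_maxl.
  have mA : measurable (pos_set n `&` [set z | lam < w z]) by apply: measurableI.
  apply: (null N _ 1) => //.
    by move=> z [_ /= wz]; rewrite mul1r subr_gt0.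
  rewrite mul1r subr_le0.
  have := @two_sets N B0 _ (mpos n0) (subset_trans B0n bN) mA An.
  have H z : (pos_set n `&` [set z | lam < w z]) z -> N.+1%:R^-1 <= f z.
    move=> [[_ /= +] _]; apply: le_trans; rewrite lef_pV2 ?posrE// ler_nat ltnS.
    exact: leq_maxl.
  by move=> /(_ H); rewrite lamb mulrAC ler_pM2r.
apply: filterS2 ae1 ae2 => z h1 h2.
have [n bz] := box_cover z.
have lw : lam <= w z by rewrite leNgt; apply/negP => wz; exact: (h1 n).
split; first by rewrite -ler_pdivlMr.
move=> fz; have [p pz] := pos_cover fz.
have : w z <= lam by rewrite leNgt; apply/negP => wz; exact: (h2 p).
move=> wl; have /eqP <- : w z == lam by rewrite eq_le wl lw.
by rewrite /w divfK// gt_eqF.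
Qed.

End euler_lagrange.

(** * Young's inequality and the bootstrap *)

Section elementary_inequalities.
Context {R : realType}.
Implicit Types a b c e l r x y z p q s t k al be ga rho G H : R.

Lemma powRD_gt0 x a b : 0 < x -> x `^ a * x `^ b = x `^ (a + b).
Proof. by move=> x0; rewrite powRD// (gt_eqF x0) implybT. Qed.

Lemma powR_le2 a x y : 0 <= a -> 0 <= x -> x <= y -> x `^ a <= y `^ a.
Proof. by move=> a0 x0 xy; apply: ge0_ler_powR; rewrite ?nnegrE// (le_trans x0 xy). Qed.

(** Each factor is at most the same power of the sum, and the exponents add up to 1. The positivity
    of [al] settles the case where all three vanish, since the zeroth power of 0 is 1. *)
Lemma geometric_mean_le x y z al be ga : 0 <= x -> 0 <= y -> 0 <= z ->
  0 < al -> 0 <= be -> 0 <= ga -> al + be + ga = 1 ->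
  x `^ al * y `^ be * z `^ ga <= x + y + z.
Proof.
move=> x0 y0 z0 al0 be0 ga0 s1.
pose w := x + y + z.
have w0 : 0 <= w by rewrite !addr_ge0.
have [w00|wn] := eqVneq w 0.
  have -> : x = 0 by rewrite /w in w00; lra.
  by rewrite powR0 ?gt_eqF// !mul0r -/w !addr_ge0.
have wp : 0 < w by rewrite lt0r wn.
rewrite -/w -[leRHS](powRr1 w0) -s1 -!powRD_gt0//.
apply: ler_pM; rewrite ?mulr_ge0 ?powR_ge0//.
  by apply: ler_pM; rewrite ?powR_ge0//; apply: powR_le2 => //; rewrite /w; lra.
by apply: powR_le2 => //; rewrite /w; lra.
Qed.

(** With be = 1 / (2 q) and al = 1 - 2 be, the product a b c is the geometric mean of a^p b^p, a^p
    c^q and b^p c^q with weights al, be, be. When c is a kernel whose q-th power has uniformly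
    bounded integrals, all three terms have finite double integrals. *)
Lemma young_trilinear a b c p q : 0 <= a -> 0 <= b -> 0 <= c -> 1 < q ->
  p * (1 - (2 * q)^-1) = 1 ->
  a * b * c <= a `^ p * b `^ p + a `^ p * c `^ q + b `^ p * c `^ q.
Proof.
move=> a0 b0 c0 q1 pq.
have q0 : 0 < q by rewrite (lt_trans _ q1).
pose be := (2 * q)^-1; pose al := 1 - 2 * be.
have bq : be * q = 2^-1 by rewrite /be invfM -mulrA mulVf ?mulr1// gt_eqF.
have be0 : 0 < be by rewrite invr_gt0 mulr_gt0.
have al0 : 0 < al.
  have : be < 2^-1 by rewrite -(ltr_pM2r q0) bq; lra.
  by rewrite /al; lra.
have [->|an] := eqVneq a 0.
  by rewrite !mul0r !addr_ge0// mulr_ge0 ?powR_ge0.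
have [->|bn] := eqVneq b 0.
  by rewrite mulr0 mul0r !addr_ge0// mulr_ge0 ?powR_ge0.
have [->|cn] := eqVneq c 0.
  by rewrite mulr0 !addr_ge0// mulr_ge0 ?powR_ge0.
have ap : 0 < a by rewrite lt0r an.
have bp : 0 < b by rewrite lt0r bn.
have cp : 0 < c by rewrite lt0r cn.
have sum1 : al + be + be = 1 by rewrite /al; ring.
have := @geometric_mean_le (a `^ p * b `^ p) (a `^ p * c `^ q) (b `^ p * c `^ q) al be be.
rewrite !mulr_ge0 ?powR_ge0// => /(_ isT isT isT al0 (ltW be0) (ltW be0) sum1).
apply: le_trans; rewrite !powRM ?powR_ge0// -!powRrM.
have -> : a * b * c = a `^ (p * al + p * be) * b `^ (p * al + p * be) * c `^ (q * be + q * be).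
  have -> : p * al + p * be = 1 by rewrite -pq /al /be; ring.
  have -> : q * be + q * be = 1 by rewrite mulrC bq; lra.
  by rewrite !powRr1.
rewrite -!powRD_gt0//.
by rewrite le_eqVlt; apply/orP; left; apply/eqP; ring.
Qed.

(* Integrated in one variable and optimized over [t], this is Young's
   convolution inequality at one point. *)
Lemma young_weighted a c p q s t : 0 <= a -> 0 <= c -> 0 < t -> 0 < p -> 0 < q ->
  1 <= s -> p <= s -> q <= s -> p^-1 + q^-1 - s^-1 = 1 ->
  a * c <= t `^ (1 - s) * (a `^ p * c `^ q) + t * (a `^ p + c `^ q).
Proof.
move=> a0 c0 t0 p0 q0 s1 ps qs E.
have s0 : 0 < s by rewrite (lt_le_trans _ s1).
(* With these weights the powers of [t] cancel, and [a] and [c] come out with exponent 1. *)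
pose al := s^-1; pose be := p^-1 - s^-1; pose ga := q^-1 - s^-1.
have al0 : 0 < al by rewrite invr_gt0.
have be0 : 0 <= be by rewrite subr_ge0 lef_pV2.
have ga0 : 0 <= ga by rewrite subr_ge0 lef_pV2.
have sum1 : al + be + ga = 1 by rewrite -E /al /be /ga; ring.
have [->|an] := eqVneq a 0.
  by rewrite mul0r addr_ge0// mulr_ge0 ?mulr_ge0 ?addr_ge0 ?powR_ge0// ltW.
have [->|cn] := eqVneq c 0.
  by rewrite mulr0 addr_ge0// mulr_ge0 ?mulr_ge0 ?addr_ge0 ?powR_ge0// ltW.
have ap : 0 < a by rewrite lt0r an.
have cp : 0 < c by rewrite lt0r cn.
have t0' := ltW t0.
have := @geometric_mean_le (t `^ (1 - s) * (a `^ p * c `^ q)) (t * a `^ p) (t * c `^ q) al be ga.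
rewrite !mulr_ge0 ?powR_ge0// => /(_ isT isT isT al0 be0 ga0 sum1).
move=> h; rewrite mulrDr addrA; apply: le_trans h.
rewrite !powRM ?mulr_ge0 ?powR_ge0// -!powRrM.
have -> : a * c = t `^ ((1 - s) * al + be + ga) * a `^ (p * al + p * be) * c `^ (q * al + q * ga).
  have -> : (1 - s) * al + be + ga = 0.
    have -> : (1 - s) * al = al - 1 by rewrite mulrBl mul1r /al divff// gt_eqF.
    lra.
  have -> : p * al + p * be = 1 by rewrite /al /be -mulrDr addrC subrK divff// gt_eqF.
  have -> : q * al + q * ga = 1 by rewrite /al /ga -mulrDr addrC subrK divff// gt_eqF.
  by rewrite powRr0 !powRr1// mul1r.
rewrite -!powRD_gt0//.
by rewrite le_eqVlt; apply/orP; left; apply/eqP; ring.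
Qed.

(** A density is estimated in three regimes: values up to [l] at small velocities, values above [l],
    paid for by the higher power, and values at large velocities, paid for by the kinetic weight
    [e]. The boolean says whether the velocity is small. *)
Lemma level_split s al l r e (b : bool) : 0 <= s -> 0 < l -> 0 < r -> 0 <= e ->
  0 < al -> (~~ b -> r ^+ 2 <= e) ->
  s <= (if b then l else 0) + s `^ (1 + al) / l `^ al + e * s / r ^+ 2.
Proof.
move=> s0 l0 r0 e0 al0 be.
have T1 : 0 <= s `^ (1 + al) / l `^ al by rewrite divr_ge0 ?powR_ge0.
have T2 : 0 <= e * s / r ^+ 2 by rewrite divr_ge0 ?mulr_ge0 ?exprn_ge0 ?(ltW r0).
have [sl|ls] := leP s l.
  case: b be => be.
    by apply: le_trans sl _; rewrite -addrA lerDl addr_ge0.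
  apply: (@le_trans _ _ (e * s / r ^+ 2)); last by rewrite add0r lerDr.
  rewrite ler_pdivlMr ?exprn_gt0// mulrC ler_wpM2r//; exact: be.
apply: (@le_trans _ _ (s `^ (1 + al) / l `^ al)).
  have sp : 0 < s by rewrite (lt_trans l0).
  rewrite ler_pdivlMr ?powR_gt0// -powRD_gt0// powRr1// ler_pM2l//.
  by apply: powR_le2; rewrite ?ltW.
by rewrite -addrA addrCA lerDl addr_ge0//; case: ifP => // _; exact: ltW.
Qed.

(* The levels [l] and [r] are tied to powers of [rho] so that the first term of
   the bound is at most [rho / 2]. *)
Lemma level_optimize rho G H k : 0 < rho -> 0 < k -> 0 <= G -> 0 <= H ->
  (forall l r, 0 < l -> 0 < r -> rho <= 8 * r ^+ 3 * l + G / l `^ (1 / k) + H / r ^+ 2) ->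
  rho `^ (1 + 1 / (k + 3 / 2)) <= 32 * (G + H).
Proof.
move=> rho0 k0 G0 H0 hyp.
pose y := 1 / (3 + 2 * k).
have k3 : 3 + 2 * k != 0 by rewrite gt_eqF//; lra.
have k32 : k + 3 / 2 != 0 by rewrite gt_eqF//; lra.
have E2y : 1 / (k + 3 / 2) = 2 * y by rewrite /y; field; rewrite k3 /=; lra.
(* With y = 1 / (3 + 2 k) the exponents in r^3 l add up to 1, while l^(1/k) and r^2 both scale as
   rho^(2 y); the divisor 4 makes 8 r^3 l equal to rho / 8. *)
pose r := rho `^ y / 4; pose l := rho `^ (2 * k * y).
have r0 : 0 < r by rewrite divr_gt0// powR_gt0.
have l0 : 0 < l by rewrite powR_gt0.
have := hyp l r l0 r0.
have -> : 8 * r ^+ 3 * l = rho / 8.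
  rewrite /r exprMn -powR_mulrn ?powR_ge0// -powRrM.
  have -> : 8 * (rho `^ (y * 3%:R) * 4^-1 ^+ 3) * l = (rho `^ (y * 3%:R) * l) / 8 by field.
  rewrite powRD_gt0// (_ : y * 3%:R + 2 * k * y = 1) ?powRr1 ?(ltW rho0)//.
  by rewrite /y; field; rewrite k3.
have -> : l `^ (1 / k) = rho `^ (2 * y).
  by rewrite /l -powRrM; congr (_ `^ _); field; rewrite gt_eqF.
have -> : r ^+ 2 = rho `^ (2 * y) / 16.
  rewrite /r exprMn -powR_mulrn ?powR_ge0// -powRrM mulrC [y * _]mulrC.
  by rewrite mulrC; congr (_ * _); field.
set P := rho `^ (2 * y); have P0 : 0 < P by rewrite powR_gt0.
rewrite E2y -powRD_gt0// powRr1 ?(ltW rho0)// -/P => h.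
have {}h : rho * P <= rho * P / 8 + G + H * 16.
  have := ler_wpM2r (ltW P0) h.
  have -> : (rho / 8 + G / P + H / (P / 16)) * P = rho * P / 8 + G + H * 16.
    by field; rewrite gt_eqF.
  by [].
have rP : 0 <= rho * P by rewrite mulr_ge0// ltW.
lra.
Qed.

End elementary_inequalities.

Section convolution.
Context {R : realType} d (X : measurableType d).
Variable m : {sigma_finite_measure set X -> \bar R}.
Local Notation M2 := (m \x m)%E.

Section one_kernel.
Variable kap : X -> X -> R.
Hypothesis kap_ge0 : forall x y, 0 <= kap x y.
Hypothesis mkap : measurable_fun setT (fun z : X * X => kap z.1 z.2).
Hypothesis kapC : forall x y, kap x y = kap y x.
Variables (q c : R).
Hypothesis c0 : 0 <= c.
Hypothesis kap_q : forall x, (\int[m]_y (kap x y `^ q)%:E <= c%:E)%E.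

Let mkq : measurable_fun setT (fun z : X * X => kap z.1 z.2 `^ q).
Proof. exact: (measurableT_comp (measurable_powR q) mkap). Qed.

Let mkq1 x : measurable_fun setT (fun y => kap x y `^ q).
Proof. by apply: (measurableT_comp mkq (g := fun y => (x, y))); exact: measurable_fun_pair. Qed.

Lemma integ_kap_q x : integ m (fun y => kap x y `^ q).
Proof.
apply: integ_ge0P => // [y|]; first exact: powR_ge0.
by apply: le_lt_trans (kap_q x) _; rewrite ltry.
Qed.

Lemma integ_conv (a : X -> R) : integ m a -> (forall x, 0 <= a x) ->
  integ M2 (fun z => a z.1 * kap z.1 z.2 `^ q).
Proof.
move=> Ia a0; have ma := integ_measurable Ia.
apply: (integ_prod (h := fun x => c * a x)); last exact: integZ.
  by apply: measurable_funM => //; exact: (measurableT_comp ma measurable_fst).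
move=> x; under eq_integral => y _.
  rewrite /= ger0_norm ?mulr_ge0 ?powR_ge0// EFinM.
  over.
rewrite ge0_integralZl//=.
- by rewrite mulrC EFinM lee_wpmul2l// lee_fin.
- exact/measurable_EFinP.
- by move=> y _; rewrite lee_fin powR_ge0.
- by rewrite lee_fin.
Qed.

(** The trilinear bound is integrated term by term; a kernel with integrable q-th power stands in
    for the weak-type kernel of the Hardy-Littlewood-Sobolev inequality. *)
Lemma young_finite (a : X -> R) (p : R) : (forall x, 0 <= a x) ->
  measurable_fun setT a -> integ m (fun x => a x `^ p) -> 1 < q ->
  p * (1 - (2 * q)^-1) = 1 ->
  integ M2 (fun z => a z.1 * a z.2 * kap z.1 z.2).
Proof.
move=> a0 ma Iap q1 pq.
have ap0 x : 0 <= a x `^ p by exact: powR_ge0.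
have ma1 : measurable_fun setT (fun z : X * X => a z.1) by exact: (measurableT_comp ma measurable_fst).
have ma2 : measurable_fun setT (fun z : X * X => a z.2) by exact: (measurableT_comp ma measurable_snd).
have I1 : integ M2 (fun z => a z.1 `^ p * a z.2 `^ p).
  apply: (integ_prod (h := fun x => (\int[m]_y (a y `^ p))%R * a x `^ p)); last exact: integZ.
    by apply: measurable_funM; exact: (measurableT_comp (measurable_powR p)).
  move=> x; rewrite mulrC -(RintZ _ Iap) (EFin_Rint (integZ _ Iap)).
  rewrite le_eqVlt; apply/orP; left; apply/eqP; apply: eq_integral => y _.
  by rewrite /= ger0_norm// mulr_ge0.
have I2 := integ_conv Iap ap0.
have I3 : integ M2 (fun z => a z.2 `^ p * kap z.1 z.2 `^ q).
  have := integ_swap I2; congr (is_true (integ _ _)).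
  by apply/funext => z /=; rewrite kapC.
apply: (integ_le _ _ (integD (integD I1 I2) I3)).
  by apply: measurable_funM => //; exact: measurable_funM.
move=> z; rewrite ger0_norm ?mulr_ge0//; exact: young_trilinear.
Qed.

(** Integrating the weighted inequality bounds the convolution V by t^(1 - s) J + t A; the choice t
    = V / (2 A) absorbs the last term into the left-hand side and leaves V^s <= c' J. *)
Lemma young_pointwise (a : X -> R) (p s : R) : (forall x, 0 <= a x) ->
  measurable_fun setT a -> integ m (fun x => a x `^ p) -> 0 < p -> 0 < q ->
  1 <= s -> p <= s -> q <= s -> p^-1 + q^-1 - s^-1 = 1 ->
  exists2 c', 0 <= c' & forall x, integ m (fun y => a y `^ p * kap x y `^ q) ->
    (\int[m]_y (a y * kap x y))%R `^ s <=
    c' * (\int[m]_y (a y `^ p * kap x y `^ q))%R.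
Proof.
move=> a0 ma Iap p0 q0 s1 ps qs E.
have s0 : 0 < s by rewrite (lt_le_trans _ s1).
pose A := (\int[m]_x (a x `^ p))%R + c + 1.
have A1 : 0 <= (\int[m]_x (a x `^ p))%R by apply: Rintegral_ge0 => x _; exact: powR_ge0.
have A0 : 0 < A by rewrite /A ltr_wpDl// addr_ge0.
exists (2 * (2 * A) `^ (s - 1)); first by rewrite mulr_ge0 ?powR_ge0.
move=> x Ix; set J := (\int[m]_y (a y `^ p * kap x y `^ q))%R.
have J0 : 0 <= J by apply: Rintegral_ge0 => y _; rewrite mulr_ge0 ?powR_ge0.
set V := (\int[m]_y (a y * kap x y))%R.
have V0 : 0 <= V by apply: Rintegral_ge0 => y _; rewrite mulr_ge0.
have [->|Vn] := eqVneq V 0.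
  by rewrite powR0 ?gt_eqF// mulr_ge0// mulr_ge0 ?powR_ge0.
have Vp : 0 < V by rewrite lt0r Vn.
pose t := V / (2 * A); have t0 : 0 < t by rewrite divr_gt0// mulr_gt0.
have mk1 : measurable_fun setT (kap x).
  by apply: (measurableT_comp mkap (g := fun y => (x, y))); exact: measurable_fun_pair.
have Isum : integ m (fun y => t `^ (1 - s) * (a y `^ p * kap x y `^ q) +
    t * (a y `^ p + kap x y `^ q)).
  by apply/integD; apply: integZ => //; apply: integD => //; exact: integ_kap_q.
have pw y : a y * kap x y <= t `^ (1 - s) * (a y `^ p * kap x y `^ q) +
    t * (a y `^ p + kap x y `^ q) by exact: young_weighted.
have Iak : integ m (fun y => a y * kap x y).
  apply: (integ_le _ _ Isum); first exact: measurable_funM.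
  by move=> y; rewrite ger0_norm ?mulr_ge0.
have : V <= t `^ (1 - s) * J + t * A.
  apply: le_trans (Rint_le Iak Isum pw) _.
  rewrite (RintD (integZ _ Ix) (integZ _ (integD Iap (integ_kap_q x)))).
  rewrite (RintZ _ Ix) (RintZ _ (integD Iap (integ_kap_q x))).
  rewrite (RintD Iap (integ_kap_q x)) lerD2l ler_pM2l// /A -addrA lerD2l.
  rewrite -[leLHS]addr0 lerD// -lee_fin (EFin_Rint (integ_kap_q x)); exact: kap_q.
have -> : t * A = V / 2 by rewrite /t; field; rewrite gt_eqF.
move=> h; have {}h : V <= 2 * (t `^ (1 - s) * J) by lra.
have tE : t `^ (1 - s) = (2 * A) `^ (s - 1) / V `^ (s - 1).
  have AA : 0 <= (2 * A)^-1 by rewrite invr_ge0 mulr_ge0// ltW.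
  rewrite /t powRM// [in LHS]mulrC; congr (_ * _).
    rewrite -(powR_inv1 (_ : 0 <= 2 * A)); last by rewrite mulr_ge0// ltW.
    by rewrite -powRrM; congr (_ `^ _); ring.
  by rewrite -powRN; congr (_ `^ _); ring.
have Vs : V `^ s = V * V `^ (s - 1).
  rewrite -{2}(powRr1 V0) powRD_gt0//; congr (_ `^ _); ring.
rewrite Vs -ler_pdivlMr ?powR_gt0//; apply: le_trans h _.
by rewrite tE le_eqVlt; apply/orP; left; apply/eqP; ring.
Qed.

(** The relation a <= b V^n, raised to the power s / n, turns the L^s bound on the convolution V
    into an L^(s/n) bound on a. *)
Lemma young_step (a : X -> R) (p s n b : R) : (forall x, 0 <= a x) ->
  measurable_fun setT a -> integ m (fun x => a x `^ p) -> 0 < p -> 0 < q ->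
  1 <= s -> p <= s -> q <= s -> p^-1 + q^-1 - s^-1 = 1 -> 0 < n -> 0 <= b ->
  {ae m, forall x, a x <= b * (\int[m]_y (a y * kap x y))%R `^ n} ->
  integ m (fun x => a x `^ (s / n)).
Proof.
move=> a0 ma Iap p0 q0 s1 ps qs E n0 b0 ab.
have ap0 x : 0 <= a x `^ p by exact: powR_ge0.
have s0 : 0 < s by rewrite (lt_le_trans _ s1).
have [c' c'0 pw] := young_pointwise a0 ma Iap p0 q0 s1 ps qs E.
have [IJ _] := Rint_fubini2 (integ_conv Iap ap0).
have Iae := integ_prod_ae2 (integ_conv Iap ap0).
apply: (integ_ae_le _ _ (integZ (b `^ (s / n) * c') IJ)).
  exact: (measurableT_comp (measurable_powR _) ma).
apply: filterS2 ab Iae => x ax Ix.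
have kE : (fun y => a y `^ p * kap y x `^ q) = (fun y => a y `^ p * kap x y `^ q).
  by apply/funext => y; rewrite kapC.
rewrite /= kE in Ix *.
rewrite ger0_norm ?powR_ge0//.
have sn0 : 0 <= s / n by rewrite divr_ge0// ltW.
have V0 : 0 <= (\int[m]_y (a y * kap x y))%R by apply: Rintegral_ge0 => y _; rewrite mulr_ge0.
apply: le_trans (powR_le2 sn0 (a0 x) ax) _.
rewrite powRM ?powR_ge0// -powRrM (_ : n * (s / n) = s); last by field; rewrite gt_eqF.
by rewrite -mulrA ler_wpM2l ?powR_ge0//; exact: pw.
Qed.

End one_kernel.

(* Subcritical bootstrap: with u = 1/p, one application of Young's inequality
   improves u to n (u - sigma), where sigma = 1 - 1/q; the fixed point
   n sigma / (n - 1) of this map lies above the initial value n / (n + 1)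
   precisely because n < 5 leaves room for sigma < 2/3. *)
Lemma bootstrap (a : X -> R) (n b : R) (kap : X -> X -> R) :
  (forall x y, 0 <= kap x y) ->
  measurable_fun setT (fun z : X * X => kap z.1 z.2) ->
  (forall x y, kap x y = kap y x) ->
  (forall q, 0 < q -> q < 3 ->
    exists2 c, 0 <= c & forall x, (\int[m]_y (kap x y `^ q)%:E <= c%:E)%E) ->
  (forall x, 0 <= a x) -> measurable_fun setT a ->
  1 < n -> n < 5 -> 0 <= b ->
  integ m (fun x => a x `^ (1 + 1 / n)) ->
  {ae m, forall x, a x <= b * (\int[m]_y (a y * kap x y))%R `^ n} ->
  exists2 r, 3 / 2 < r & integ m (fun x => a x `^ r).
Proof.
move=> kap0 mkap kapC kapq a0 ma n1 n5 b0 Ia ab.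
have n0 : 0 < n by rewrite (lt_trans _ n1).
have np1 : 0 < n + 1 by lra.
have nn1 : n + 1 != 0 by rewrite gt_eqF.
(* The midpoint between (n - 1) / (n + 1), for which the initial value [u0] would be the fixed
   point, and 2 / 3, for which q would be 3. *)
pose sg := ((n - 1) / (n + 1) + 2 / 3) / 2.
have sg1 : (n - 1) / (n + 1) < sg /\ sg < 2 / 3.
  have : (n - 1) / (n + 1) < 2 / 3 by rewrite ltr_pdivrMr//; lra.
  by rewrite /sg; lra.
have [sgl sgu] := sg1.
have sg0 : 0 < sg by apply: lt_trans sgl; rewrite divr_gt0//; lra.
pose q := (1 - sg)^-1.
have sg' : 0 < 1 - sg by lra.
have q0 : 0 < q by rewrite invr_gt0.
have q3 : q < 3 by rewrite /q -[3]invrK ltf_pV2 ?posrE//; lra.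
have [c c0 kq] := kapq q q0 q3.
pose u0 := n / (n + 1).
have u01 : u0 < 1 by rewrite /u0 ltr_pdivrMr//; lra.
have u00 : 0 < u0 by rewrite divr_gt0.
pose P u := is_true (integ m (fun x => a x `^ u^-1)).
have P0 : P u0.
  rewrite /P (_ : u0^-1 = 1 + 1 / n)// /u0; field; rewrite nn1 gt_eqF//.
(* The gain at [u0]; since n > 1, every step from a smaller exponent gains at least as much. *)
pose dl := u0 - n * (u0 - sg).
have dl0 : 0 < dl.
  have -> : dl = n * (sg - (n - 1) / (n + 1)) by rewrite /dl /u0; field.
  by rewrite mulr_gt0// subr_gt0.
have step u : P u -> 2 / 3 <= u -> u <= u0 ->
    exists2 u', 0 < u' /\ u' <= u - dl & P u'.
  move=> Pu u23 uu0.
  have u_sg : 0 < u - sg by lra.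
  have u_gt0 : 0 < u by lra.
  pose s := (u - sg)^-1.
  have s_ge1 : 1 <= s by rewrite -[1]invr1 lef_pV2 ?posrE//; lra.
  exists (n * (u - sg)).
    split; first exact: mulr_gt0.
    rewrite /dl; have : (n - 1) * u <= (n - 1) * u0 by rewrite ler_pM2l//; lra.
    lra.
  rewrite /P (_ : (n * (u - sg))^-1 = s / n); last by rewrite invfM mulrC.
  apply: (young_step (q := q) (c := c) (p := u^-1) (b := b) kap0 mkap kapC c0 kq) => //.
  - by rewrite invr_gt0.
  - by rewrite lef_pV2 ?posrE//; lra.
  - by rewrite lef_pV2 ?posrE//; lra.
  - by rewrite !invrK; lra.
(* Each step lowers u by at least [dl], so u cannot stay above 2 / 3 for more than u0 / dl steps; u
   < 2 / 3 is the desired exponent above 3 / 2. *)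
have iter j : (exists2 u, 0 < u < 2 / 3 & P u) \/
    (exists2 u, [/\ 2 / 3 <= u, u <= u0 & u <= u0 - j%:R * dl] & P u).
  elim: j => [|j [IH|[u [u23 uu0 uj] Pu]]]; last first.
  - have [u' [u'0 u'd] Pu'] := step u Pu u23 uu0.
    have [h|h] := leP (2 / 3) u'; last by left; exists u' => //; rewrite u'0.
    by right; exists u' => //; split => //; [lra|rewrite -natr1; lra].
  - by left.
  - have [h|h] := leP (2 / 3) u0; last by left; exists u0 => //; rewrite u00.
    by right; exists u0 => //; split => //; rewrite mul0r subr0.
have [u /andP[u_gt0 u23] Pu] : exists2 u, 0 < u < 2 / 3 & P u.
  have [//|[u [u23 _ uj] _]] := iter (Num.truncn (u0 / dl)).+1.
  exfalso; have := truncnS_gt (u0 / dl); rewrite ltr_pdivrMr// => h; lra.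
exists u^-1 => //.
by rewrite -[ltLHS]invrK ltf_pV2 ?posrE ?invr_gt0//; lra.
Qed.

End convolution.

(** * The Newton potential *)

Section line_integrals.
Context {R : realType}.
Local Notation mu := (@lebesgue_measure R).
Implicit Types b t : R.

Lemma even_integral (f F : R -> R) (l : R) : (forall x, 0 <= f x) -> continuous f ->
  (forall x, f (- x) = f x) -> (forall x : R, is_derive x 1 F (f x)) -> F 0 = 0 ->
  F x @[x --> +oo] --> l -> (\int[mu]_t (f t)%:E = (2 * l)%:E)%E.
Proof.
move=> f0 cf ef dF F0 Fl.
rewrite ge0_symfun_integralT//; last by move=> x /=; rewrite ef.
rewrite -set_itvcy (ge0_continuous_FTC2y (F := F) (l := l)).
- by rewrite F0 -EFinB subr0 -EFinM.
- by move=> x _.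
- exact: continuous_subspaceT.
- exact: Fl.
- by move=> x _; exact: ex_derive.
- apply: cvg_at_right_filter.
  by apply: differentiable_continuous; apply/derivable1_diffP; exact: ex_derive.
- by move=> x _; rewrite derive1E; exact: derive_val.
Qed.

Lemma der_eq (f : R -> R) (t a b : R) : is_derive t 1 f a -> a = b -> is_derive t 1 f b.
Proof. by move=> ? <-. Qed.

Lemma derM (f g : R -> R) (t a b : R) : is_derive t 1 f a -> is_derive t 1 g b ->
  is_derive t 1 (fun t => f t * g t) (a * g t + f t * b).
Proof.
move=> df dg; apply: (der_eq (is_deriveM df dg)).
by rewrite /GRing.scale/= addrC mulrC.
Qed.

Lemma derD (f g : R -> R) (t a b : R) : is_derive t 1 f a -> is_derive t 1 g b ->
  is_derive t 1 (fun t => f t + g t) (a + b).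
Proof. by move=> df dg; exact: is_deriveD. Qed.

Lemma derB (f g : R -> R) (t a b : R) : is_derive t 1 f a -> is_derive t 1 g b ->
  is_derive t 1 (fun t => f t - g t) (a - b).
Proof. by move=> df dg; exact: is_deriveB. Qed.

Lemma derN (f : R -> R) (t a : R) : is_derive t 1 f a ->
  is_derive t 1 (fun t => - f t) (- a).
Proof. by move=> df; exact: is_deriveN. Qed.

Lemma derV (f : R -> R) (t a : R) : f t != 0 -> is_derive t 1 f a ->
  is_derive t 1 (fun t => (f t)^-1) (- a / f t ^+ 2).
Proof.
move=> f0 df; apply: (der_eq (is_deriveV f0 df)).
by rewrite /GRing.scale/= -exprVn mulNr mulNr mulrC.
Qed.

Lemma derZ (f : R -> R) (t a c : R) : is_derive t 1 f a ->
  is_derive t 1 (fun t => c * f t) (c * a).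
Proof. by move=> df; exact: is_deriveZ. Qed.

Lemma derX (f : R -> R) (t a : R) n : is_derive t 1 f a ->
  is_derive t 1 (fun t => f t ^+ n.+1) (n.+1%:R * f t ^+ n * a).
Proof.
move=> df; elim: n => [|n IH]; first by apply: (der_eq df); rewrite expr0 !mul1r.
apply: (der_eq (derM df IH)).
by rewrite -[in RHS]natr1 !exprS; ring.
Qed.

Lemma der_id (t : R) : is_derive t 1 (fun t : R => t) 1.
Proof. exact: is_derive_id. Qed.

Lemma der_cst (c t : R) : is_derive t 1 (fun t : R => c) 0.
Proof. exact: is_derive_cst. Qed.

Lemma der_continuous (f df : R -> R) : (forall t : R, is_derive t 1 f (df t)) -> continuous f.
Proof.
move=> d t; apply: differentiable_continuous; apply/derivable1_diffP.
exact: (@ex_derive _ _ _ _ _ _ _ (d t)).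
Qed.

(** Nested in its first argument, it builds the regularized norm on R^3 one coordinate at a time, so
    that triple integrals become iterated one-variable integrals. *)
Definition hyp b t : R := Num.sqrt (b ^+ 2 + t ^+ 2).

Lemma hyp_gt0 b t : 0 < b -> 0 < hyp b t.
Proof. by move=> b0; rewrite sqrtr_gt0 ltr_wpDr ?sqr_ge0// exprn_gt0. Qed.

Lemma hyp_neq0 b t : 0 < b -> hyp b t != 0.
Proof. by move=> b0; rewrite gt_eqF// hyp_gt0. Qed.

Lemma hyp_sqr b t : hyp b t ^+ 2 = b ^+ 2 + t ^+ 2.
Proof. by rewrite sqr_sqrtr// addr_ge0 ?sqr_ge0. Qed.

Lemma le_hyp b t : 0 <= t -> t <= hyp b t.
Proof.
move=> t0; rewrite /hyp -[leLHS]ger0_norm// -sqrtr_sqr.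
by apply: ler_wsqrtr; rewrite lerDr sqr_ge0.
Qed.

Lemma hypN b t : hyp b (- t) = hyp b t.
Proof. by rewrite /hyp sqrrN. Qed.

Lemma der_hyp b t : 0 < b -> is_derive t 1 (hyp b) (t / hyp b t).
Proof.
move=> b0.
have h0 : 0 < b ^+ 2 + t ^+ 2 by rewrite ltr_wpDr ?sqr_ge0// exprn_gt0.
have d1 := derD (der_cst (b ^+ 2) t) (derX 1 (der_id t)).
apply: (der_eq (@is_derive1_comp _ Num.sqrt (fun t : R => b ^+ 2 + t ^+ 2) t _ _ (is_derive1_sqrt h0) d1)).
rewrite -/(hyp b t) add0r expr1 mulr1; field.
exact: hyp_neq0.
Qed.

Lemma continuous_hypVX b n : 0 < b -> continuous (fun t => (hyp b t ^+ n.+1)^-1).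
Proof.
move=> b0; apply: der_continuous => t.
by apply: derV; [rewrite expf_neq0// hyp_neq0|exact/derX/der_hyp].
Qed.

Lemma der_ratio b t : 0 < b ->
  is_derive t 1 (fun t => t / hyp b t) (b ^+ 2 / hyp b t ^+ 3).
Proof.
move=> b0; have hn := hyp_neq0 t b0.
apply: (der_eq (derM (der_id t) (derV hn (der_hyp t b0)))).
have -> : b ^+ 2 = hyp b t ^+ 2 - t ^+ 2 by rewrite hyp_sqr addrK.
by field.
Qed.

Lemma cvg_ratio b : 0 < b -> t / hyp b t @[t --> +oo] --> (1 : R).
Proof.
move=> b0; apply/cvgrPdist_le => e e0; near=> t.
have t0 : 0 < t by near: t; exact: nbhs_pinfty_gt.
have h0 := hyp_gt0 t b0.
have tb : b / e <= t by near: t; apply: nbhs_pinfty_ge; exact: num_real.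
have th : t <= hyp b t.
  exact/le_hyp/ltW.
have hb : hyp b t <= b + t.
  have bt0 : 0 <= b + t by rewrite addr_ge0 ?ltW.
  rewrite /hyp -[leRHS]ger0_norm// -sqrtr_sqr; apply: ler_wsqrtr.
  by rewrite sqrrD lerD2r lerDl mulrn_wge0// mulr_ge0 ?ltW.
rewrite ger0_norm; last by rewrite subr_ge0 ler_pdivrMr// mul1r.
have -> : 1 - t / hyp b t = (hyp b t - t) / hyp b t by field; rewrite gt_eqF.
rewrite ler_pdivrMr//.
have : b <= e * t by rewrite mulrC -ler_pdivrMr.
have : e * t <= e * hyp b t by rewrite ler_pM2l.
lra.
Unshelve. all: by end_near. Qed.

(** Integrating out a coordinate of a power of [reg] lowers the exponent by one: the fifth power
    uses the exponents 5, 4, 3 in turn, the fourth power 4, 3, 2. *)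
Lemma integral_hyp3 b : 0 < b ->
  (\int[mu]_t ((hyp b t ^+ 3)^-1)%:E = (2 / b ^+ 2)%:E)%E.
Proof.
move=> b0; have bn : b != 0 by rewrite gt_eqF.
rewrite -[2 / b ^+ 2]/(2 * (b ^+ 2)^-1).
apply: (even_integral (F := fun t => (b ^+ 2)^-1 * (t / hyp b t))).
- by move=> x; rewrite invr_ge0 exprn_ge0// ltW// hyp_gt0.
- exact: continuous_hypVX.
- by move=> x; rewrite hypN.
- move=> x; apply: (der_eq (derZ _ (der_ratio x b0))); have := hyp_neq0 x b0.
  by move=> hn; field; rewrite hn.
- by rewrite mul0r mulr0.
- rewrite -[X in _ --> X]mulr1; exact: (cvgMl_tmp (a := (b ^+ 2)^-1) (cvg_ratio b0)).
Qed.

Lemma integral_hyp5 b : 0 < b ->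
  (\int[mu]_t ((hyp b t ^+ 5)^-1)%:E = (4 / 3 / b ^+ 4)%:E)%E.
Proof.
move=> b0; have bn : b != 0 by rewrite gt_eqF.
have -> : 4 / 3 / b ^+ 4 = 2 * ((b ^+ 4)^-1 * (1 - 1 ^+ 3 / 3)) by field.
apply: (even_integral (F := fun t => (b ^+ 4)^-1 * (t / hyp b t - (t / hyp b t) ^+ 3 / 3))).
- by move=> x; rewrite invr_ge0 exprn_ge0// ltW// hyp_gt0.
- exact: continuous_hypVX.
- by move=> x; rewrite hypN.
- move=> x; have hn := hyp_neq0 x b0; have d := der_ratio x b0.
  have d3 := derM (derX 2 d) (der_cst 3^-1 x).
  apply: (der_eq (derZ _ (derB d d3))).
  have b2 : b ^+ 2 = hyp b x ^+ 2 - x ^+ 2 by rewrite hyp_sqr addrK.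
  have b4 : b ^+ 4 = (hyp b x ^+ 2 - x ^+ 2) ^+ 2 by rewrite -b2 -exprM.
  have bn2 : hyp b x ^+ 2 - x ^+ 2 != 0 by rewrite -b2 expf_neq0.
  rewrite mulr0 addr0 b4 b2; field.
  by rewrite hn -?expr2 bn2.
- by rewrite mul0r expr0n mul0r subrr mulr0.
- apply: cvgMl_tmp; apply: cvgB; first exact: cvg_ratio.
  apply: cvgMr_tmp; have h := cvg_ratio b0; exact: (cvgM h (cvgM h h)).
Qed.

Lemma der_atan_div b t : 0 < b ->
  is_derive t 1 (fun t => atan (t / b)) (b / hyp b t ^+ 2).
Proof.
move=> b0; have bn : b != 0 by rewrite gt_eqF.
have hn := hyp_neq0 t b0.
have d1 := derM (der_id t) (der_cst b^-1 t).
apply: (der_eq (@is_derive1_comp _ (@atan R) (fun t : R => t / b) t _ _ (is_derive1_atan (t / b)) d1)).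
rewrite mulr0 addr0 mul1r.
have -> : 1 + (t / b) ^+ 2 = hyp b t ^+ 2 / b ^+ 2 by rewrite hyp_sqr; field.
by field; rewrite bn hn.
Qed.

Lemma cvg_atan_div b : 0 < b -> atan (t / b) @[t --> +oo] --> (pi / 2 : R).
Proof.
move=> b0; apply: (@cvg_comp _ _ _ (fun t => t / b) (@atan R) _ +oo%R _ _ (@cvgy_atan R)).
apply/cvgryPge => A; near=> t.
by rewrite ler_pdivlMr//; near: t; apply: nbhs_pinfty_ge; exact: num_real.
Unshelve. all: by end_near. Qed.

Lemma integral_hyp2 b : 0 < b ->
  (\int[mu]_t ((hyp b t ^+ 2)^-1)%:E = (pi / b)%:E)%E.
Proof.
move=> b0; have bn : b != 0 by rewrite gt_eqF.
have -> : pi / b = 2 * (b^-1 * (pi / 2)) :> R by field.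
apply: (even_integral (F := fun t => b^-1 * atan (t / b))).
- by move=> x; rewrite invr_ge0 exprn_ge0// ltW// hyp_gt0.
- exact: continuous_hypVX.
- by move=> x; rewrite hypN.
- move=> x; have hn := hyp_neq0 x b0.
  by apply: (der_eq (derZ _ (der_atan_div x b0))); field; rewrite hn.
- by rewrite mul0r atan0 mulr0.
- apply: cvgMl_tmp; exact: cvg_atan_div.
Qed.

Lemma integral_hyp4 b : 0 < b ->
  (\int[mu]_t ((hyp b t ^+ 4)^-1)%:E = (pi / 2 / b ^+ 3)%:E)%E.
Proof.
move=> b0; have bn : b != 0 by rewrite gt_eqF.
have -> : pi / 2 / b ^+ 3 = 2 * ((2 * b ^+ 2)^-1 * (1 * 0) + (2 * b ^+ 3)^-1 * (pi / 2)) :> R by field.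
apply: (even_integral (F := fun t => (2 * b ^+ 2)^-1 * ((t / hyp b t) * (hyp b t)^-1) +
   (2 * b ^+ 3)^-1 * atan (t / b))).
- by move=> x; rewrite invr_ge0 exprn_ge0// ltW// hyp_gt0.
- exact: continuous_hypVX.
- by move=> x; rewrite hypN.
- move=> x; have hn := hyp_neq0 x b0.
  have d1 := derM (der_ratio x b0) (derV hn (der_hyp x b0)).
  apply: (der_eq (derD (derZ _ d1) (derZ _ (der_atan_div x b0)))).
  have x2 : x ^+ 2 = hyp b x ^+ 2 - b ^+ 2 by rewrite hyp_sqr addrC addKr.
  have -> : x / hyp b x * (- (x / hyp b x) / hyp b x ^+ 2) = - (x ^+ 2) / hyp b x ^+ 4 by field.
  rewrite x2; field.
  by rewrite hn bn.
- by rewrite !mul0r atan0 !mulr0 addr0.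
- apply: cvgD; last by apply: cvgMl_tmp; exact: cvg_atan_div.
  apply: cvgMl_tmp; apply: cvgM; first exact: cvg_ratio.
  apply/cvgrPdist_le => e e0; near=> t.
  have t0 : 0 < t by near: t; exact: nbhs_pinfty_gt.
  have th : t <= hyp b t.
    exact/le_hyp/ltW.
  rewrite sub0r normrN gtr0_norm ?invr_gt0 ?hyp_gt0//.
  rewrite -[leRHS]invrK lef_pV2 ?posrE ?invr_gt0 ?hyp_gt0//.
  by apply: le_trans th; near: t; apply: nbhs_pinfty_ge; exact: num_real.
Unshelve. all: by end_near. Qed.

(** The integrand is the derivative of the Wronskian g p' - g' p, which vanishes at both ends of
    [-a, a] with a beyond the support. *)
Lemma line_green (g g1 g2 p p1 p2 : R -> R) (r : R) : 0 < r ->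
  (forall t : R, is_derive t 1 g (g1 t)) -> (forall t : R, is_derive t 1 g1 (g2 t)) ->
  (forall t : R, is_derive t 1 p (p1 t)) -> (forall t : R, is_derive t 1 p1 (p2 t)) ->
  continuous g2 -> continuous p2 ->
  (forall t, r < `|t| -> [/\ p t = 0, p1 t = 0 & p2 t = 0]) ->
  (\int[mu]_t (g t * p2 t - g2 t * p t) = 0)%R.
Proof.
move=> r0 dg dg1 dp dp1 cg2 cp2 supp.
pose a := r + 1.
have ra : r < a by rewrite ltrDl.
have aa : - a < a by rewrite /a; lra.
pose W t := g t * p1 t - g1 t * p t.
have dW t : is_derive t 1 W (g t * p2 t - g2 t * p t).
  by apply: (der_eq (derB (derM (dg t) (dp1 t)) (derM (dg1 t) (dp t)))); ring.
have cW := der_continuous dW.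
have cf : continuous (fun t => g t * p2 t - g2 t * p t).
  move=> t; apply: cvgB; apply: cvgM.
  - exact: (der_continuous dg).
  - exact: cp2.
  - exact: cg2.
  - exact: (der_continuous dp).
have W0 t : r < `|t| -> W t = 0.
  by move=> /supp[p0 p10 _]; rewrite /W p0 p10 !mulr0 subrr.
have Wa : W a = 0 by apply: W0; rewrite ger0_norm// ltW// (lt_trans r0).
have WNa : W (- a) = 0 by apply: W0; rewrite normrN ger0_norm// ltW// (lt_trans r0).
have dWab : derivable_oo_LRcontinuous W (- a) a.
  split.
  - by move=> t _; exact: (@ex_derive _ _ _ _ _ _ _ (dW t)).
  - by apply: cvg_at_right_filter; exact: cW.
  - by apply: cvg_at_left_filter; exact: cW.
have dWE : {in `](- a), a[, derive1 W =1 (fun t => g t * p2 t - g2 t * p t)}.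
  by move=> t _; rewrite derive1E; exact: (@derive_val _ _ _ _ _ _ _ (dW t)).
have FTC := @continuous_FTC2 _ (fun t => g t * p2 t - g2 t * p t) W (- a) a aa
  (continuous_subspaceT cf) dWab dWE.
rewrite Wa WNa subee// in FTC.
rewrite /Rintegral -[RHS]/(fine 0%E) -FTC.
congr fine; rewrite [RHS]integral_mkcond; apply: eq_integral => t _.
rewrite patchE; case: ifPn => // ta.
have [->  _ ->] : [/\ p t = 0, p1 t = 0 & p2 t = 0].
  apply: supp; apply: (lt_le_trans ra); rewrite leNgt; apply/negP => h.
  apply: (negP ta); apply: mem_set; rewrite /= in_itv/=.
  by move: h; rewrite ltr_norml => /andP[/ltW -> /ltW ->].
by rewrite !mulr0 subrr.
Qed.

End line_integrals.

Lemma mulr_indic_le {R : realType} (U : Type) (A : set U) (B : R) (x : U) :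
  0 <= B -> B * \1_A x <= B.
Proof. by move=> B0; rewrite indicE; case: (x \in A); rewrite ?mulr1// mulr0. Qed.

(** * Calculus and measure on R^3 *)

Section vec3_calculus.
Context {R : realType}.
Local Notation mu := (@lebesgue_measure R).
Local Notation lb3 := (@leb3 R).
Implicit Types (psi : vec3 R -> R) (x y z : vec3 R).

(** This links the product topology to the product sigma-algebra: the cubes with rational centres
    and half-sides 1 / (n + 1) are measurable, countably many, and form a base. *)
Lemma open_vec3_measurable (U : set (vec3 R)) : open U -> measurable U.
Proof.
move=> oU.
pose b (p : rat * rat * rat * nat) (z : vec3 R) : bool :=
  [&& `|z.1.1 - ratr p.1.1.1| < p.2.+1%:R^-1, `|z.1.2 - ratr p.1.1.2| < p.2.+1%:R^-1
    & `|z.2 - ratr p.1.2| < p.2.+1%:R^-1].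
pose B p : set (vec3 R) := [set z | b p z].
pose F p := if `[< B p `<=` U >] then B p else set0.
have mB p : measurable (B p).
  have mb (u : vec3 R -> R) (c e : R) : measurable_fun setT u ->
      measurable_fun setT (fun z => `|u z - c| < e).
    move=> mu_; apply: measurable_fun_ltr => //; apply: measurableT_comp => //.
    exact: measurable_funB.
  have : measurable_fun setT (b p).
    apply: measurable_and; first exact: (mb (fun z => z.1.1) _ _ measurable_c1).
    by apply: measurable_and; [exact: (mb (fun z => z.1.2) _ _ measurable_c2)
                              |exact: (mb (fun z => z.2) _ _ measurable_c3)].
  by move=> /(_ measurableT [set true] I); rewrite setTI.
have mF p : measurable (F p) by rewrite /F; case: ifP.
rewrite (_ : U = \bigcup_p F p); first exact: countable_bigcupT_measurable.
apply/seteqP; split => [z Uz|z [p _]]; last first.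
  by rewrite /F; case: ifPn => [/asboolP|//] + Bz; apply.
have /nbhs_ballP[e /= e0 He] : nbhs z U by apply: open_nbhs_nbhs.
(* If the centre is within 1 / (n + 1) of [z], all points of the cube of that half-side are within 2
   / (n + 1) < e of [z]. *)
pose n := Num.truncn (2 / e).
have n0 : 0 < n.+1%:R^-1 :> R by rewrite invr_gt0.
have ne : n.+1%:R^-1 + n.+1%:R^-1 < e :> R.
  have : 2 / e < n.+1%:R by exact: truncnS_gt.
  rewrite ltr_pdivrMr// => h.
  have -> : n.+1%:R^-1 + n.+1%:R^-1 = 2 / n.+1%:R :> R by ring.
  by rewrite ltr_pdivrMr// mulrC.
have rt (t : R) : exists q : rat, `|t - ratr q| < n.+1%:R^-1.
  have [|q] := @rat_in_itvoo R (t - n.+1%:R^-1) (t + n.+1%:R^-1).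
    by rewrite ltrBlDr -addrA ltrDl addr_gt0.
  by rewrite in_itv/= => /andP[h1 h2]; exists q; rewrite distrC ltr_distl h1 h2.
have [q1 h1] := rt z.1.1; have [q2 h2] := rt z.1.2; have [q3 h3] := rt z.2.
exists (q1, q2, q3, n) => //; rewrite /F; case: ifPn => [_|/asboolPn[]].
  by rewrite /B/= /b/= h1 h2.
move=> w; rewrite /B/= /b/= => /and3P[w1 w2 w3]; apply: He.
have tri (s t c : R) : `|s - c| < n.+1%:R^-1 -> `|t - c| < n.+1%:R^-1 -> `|s - t| < e.
  move=> h h'; apply: le_lt_trans (ler_distD c s t) _; apply: lt_trans ne.
  by rewrite (distrC c); exact: ltrD.
by split; [split; [exact: tri h1 w1|exact: tri h2 w2]|exact: tri h3 w3].
Qed.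

Lemma continuous_vec3_measurable psi : continuous psi -> measurable_fun setT psi.
Proof.
move=> cp; apply: (measurability _ (RGenOInfty.measurableE R)).
move=> /= _ [_ [a ->]] <-; rewrite setTI; apply: open_vec3_measurable.
apply: open_comp; last exact: interval_open.
by move=> x _; exact: cp.
Qed.

Definition boxset (r : R) : set (vec3 R) :=
  (`[- r, r] `*` `[- r, r]) `*` `[- r, r].

Lemma boxsetP (r : R) x : boxset r x <-> inbox r x.
Proof.
rewrite /inbox /boxset/= !in_itv/= !ler_norml; split.
  by move=> [[-> ->] ->].
by move=> /and3P[-> -> ->].
Qed.

Lemma measurable_boxset r : measurable (boxset r).
Proof. by do 2 apply: measurableX => //; exact: measurable_itv. Qed.

Lemma boxset_lty r : (lb3 (boxset r) < +oo)%E.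
Proof.
pose s : set (measurableTypeR R) := `[- r, r]%classic.
have ms : measurable s by exact: measurable_itv.
have soo : (mu s < +oo)%E.
  by rewrite lebesgue_measure_itv; case: ifP => // _; rewrite -EFinB ltry.
have E2 : (leb2 (s `*` s) = mu s * mu s)%E by exact: product_measure1E.
have -> : (lb3 (boxset r) = leb2 (s `*` s) * mu s)%E.
  by apply: product_measure1E => //; exact: measurableX.
have s2 : (leb2 (s `*` s) < +oo)%E by rewrite E2; apply: lte_mul_pinfty => //; rewrite ge0_fin_numE.
by apply: lte_mul_pinfty => //; rewrite ge0_fin_numE.
Qed.

Lemma integ_indic_boxset r : integ lb3 (\1_(boxset r) : vec3 R -> R).
Proof.
have mb : measurable_fun setT (\1_(boxset r) : vec3 R -> R).
  by apply: measurable_indic; exact: measurable_boxset.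
apply: (integ_bounded (measurable_boxset r) (boxset_lty r) (B := 1)) => // x.
by rewrite mul1r ger0_norm.
Qed.

Lemma compact_boxset r : compact (boxset r).
Proof.
have c : compact (`[- r, r]%classic : set R) by exact: segment_compact.
exact: (compact_setX (compact_setX c c) c).
Qed.

Lemma bounded_support psi r : continuous psi -> (forall x, ~~ inbox r x -> psi x = 0) ->
  exists2 B, 0 <= B & forall x, `|psi x| <= B * \1_(boxset r) x.
Proof.
move=> cp supp.
have out x : ~~ inbox r x -> forall B : R, `|psi x| <= B * \1_(boxset r) x.
  move=> xr B; rewrite supp// normr0 indicE memNset ?mulr0//.
  by move=> /boxsetP; rewrite (negbTE xr).
have [[x0 bx0]|ne] := pselect (boxset r !=set0); last first.
  exists 0 => // x; have [xr|xr] := boolP (inbox r x); last exact: (out x xr 0).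
  by exfalso; apply: ne; exists x; exact/boxsetP.
have cn : {within boxset r, continuous (fun x => `|psi x|)}.
  by apply: continuous_subspaceT => x; apply: cvg_norm; exact: cp.
have [c _ cmax] := compact_EVT_max (ex_intro _ x0 bx0) (@compact_boxset r) cn.
exists `|psi c| => // x; have [xr|xr] := boolP (inbox r x); last exact: (out x xr).
have bx : boxset r x by exact/boxsetP.
by rewrite indicE mem_set// mulr1; apply: cmax; rewrite inE.
Qed.

Lemma open_out r : open [set x : vec3 R | ~~ inbox r x].
Proof.
have c1 : continuous (fun x : vec3 R => x.1.1 : R).
  by move=> x; apply: (@cvg_comp _ _ _ fst fst _ (nbhs x.1)); exact: cvg_fst.
have c2 : continuous (fun x : vec3 R => x.1.2 : R).
  by move=> x; apply: (@cvg_comp _ _ _ fst snd _ (nbhs x.1)); [exact: cvg_fst|exact: cvg_snd].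
have c3 : continuous (fun x : vec3 R => x.2 : R) by move=> x; exact: cvg_snd.
have o (u : vec3 R -> R) : continuous u -> open [set x | r < `|u x|].
  move=> cu; rewrite (_ : [set x | _] = (fun x => `|u x|) @^-1` `]r, +oo[%classic); last first.
    by apply/seteqP; split => x /=; rewrite in_itv/= andbT.
  apply: open_comp; last exact: interval_open.
  by move=> x _; apply: cvg_norm; exact: cu.
rewrite (_ : [set x | _] = [set x | r < `|x.1.1|] `|` [set x | r < `|x.1.2|] `|` [set x | r < `|x.2|]).
  by apply: openU; [apply: openU|]; exact: o.
apply/seteqP; split => x /=; rewrite /inbox !negb_and -!ltNge.
  by move=> /or3P[]; [left; left|left; right|right].
by move=> [[->|->]|->]; rewrite ?orbT.
Qed.

Lemma derive_support psi r (e : vec3 R) : (forall x, ~~ inbox r x -> psi x = 0) ->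
  forall x, ~~ inbox r x -> 'D_e psi x = 0.
Proof.
move=> supp x xr; rewrite (near_eq_derive (g := cst 0)); first exact: derive_cst.
have : nbhs x [set x : vec3 R | ~~ inbox r x] by apply: open_nbhs_nbhs; split => //; exact: open_out.
by apply: filterS => y /= yr; rewrite supp.
Qed.

Lemma line_derive psi (x e : vec3 R) (t : R) : derivable psi (t *: e + x) e ->
  is_derive t (1 : R) (fun s : R => psi (s *: e + x)) ('D_e psi (t *: e + x)).
Proof.
move=> /derivableP [d1 d2].
have E' (h : R) : (h *: (1 : R) + t) *: e + x = h *: e + (t *: e + x).
  by rewrite scalerDl -addrA /GRing.scale/= mulr1.
have EE : (fun h : R => h^-1 *: (((fun s : R => psi (s *: e + x)) \o shift t) (h *: (1 : R)) -
      psi (t *: e + x))) =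
    (fun h : R => h^-1 *: ((psi \o shift (t *: e + x)) (h *: e) - psi (t *: e + x))).
  by apply/funext => h /=; rewrite E'.
by split; rewrite ?/derivable ?/derive EE.
Qed.

Lemma derive1_coord psi : (forall e x, derivable psi x e) ->
  [/\ forall a b c : R, is_derive a (1 : R) (fun s : R => psi (s, b, c)) ('D_(1, 0, 0) psi (a, b, c)),
      forall a b c : R, is_derive b (1 : R) (fun s : R => psi (a, s, c)) ('D_(0, 1, 0) psi (a, b, c)) &
      forall a b c : R, is_derive c (1 : R) (fun s : R => psi (a, b, s)) ('D_(0, 0, 1) psi (a, b, c))].
Proof.
move=> d; split => a b c.
- have E s : s *: ((1, 0, 0) : vec3 R) + (0, b, c) = (s, b, c) :> vec3 R.
    by congr (_, _, _); rewrite /= /GRing.scale/= ?mulr1 ?mulr0 ?addr0 ?add0r.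
  have := line_derive (d (1, 0, 0) (a *: ((1, 0, 0) : vec3 R) + (0, b, c))).
  by rewrite E; congr (is_derive _ _ _ _); apply/funext => s; rewrite E.
- have E s : s *: ((0, 1, 0) : vec3 R) + (a, 0, c) = (a, s, c) :> vec3 R.
    by congr (_, _, _); rewrite /= /GRing.scale/= ?mulr1 ?mulr0 ?addr0 ?add0r.
  have := line_derive (d (0, 1, 0) (b *: ((0, 1, 0) : vec3 R) + (a, 0, c))).
  by rewrite E; congr (is_derive _ _ _ _); apply/funext => s; rewrite E.
- have E s : s *: ((0, 0, 1) : vec3 R) + (a, b, 0) = (a, b, s) :> vec3 R.
    by congr (_, _, _); rewrite /= /GRing.scale/= ?mulr1 ?mulr0 ?addr0 ?add0r.
  have := line_derive (d (0, 0, 1) (c *: ((0, 0, 1) : vec3 R) + (a, b, 0))).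
  by rewrite E; congr (is_derive _ _ _ _); apply/funext => s; rewrite E.
Qed.

Lemma line_lipschitz (p dp : R -> R) (L : R) : (forall t, is_derive t (1 : R) p (dp t)) ->
  (forall t, `|dp t| <= L) -> forall s t, `|p s - p t| <= L * `|s - t|.
Proof.
move=> d dL s t; wlog st : s t / t <= s.
  move=> H; have [|/ltW] := leP t s; first exact: H.
  by move=> st; rewrite distrC (distrC s); exact: H.
have cp : {within `[t, s], continuous p} by apply/continuous_subspaceT/(der_continuous d).
have [c _ ->] := MVT_segment st (fun (u : R) _ => d u) cp.
by rewrite normrM ler_wpM2r.
Qed.

(** Three moves along coordinate lines, each controlled by a partial derivative that is bounded
    because it is continuous with compact support. *)
Lemma vec3_lipschitz psi r : continuous psi -> (forall e x, derivable psi x e) ->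
  (forall e, continuous ('D_e psi)) -> (forall x, ~~ inbox r x -> psi x = 0) ->
  exists2 L, 0 <= L & forall x y, `|psi x - psi y| <= L * enorm (x - y).
Proof.
move=> cp d cd supp.
have bd e : exists2 B, 0 <= B & forall x, `|'D_e psi x| <= B.
  have [B B0 HB] := bounded_support (cd e) (derive_support e supp).
  exists B => // x; apply: le_trans (HB x) _; exact: mulr_indic_le.
have [B1 B10 H1] := bd (1, 0, 0); have [B2 B20 H2] := bd (0, 1, 0).
have [B3 B30 H3] := bd (0, 0, 1).
have [d1 d2 d3] := derive1_coord d.
exists (B1 + B2 + B3); first by rewrite !addr_ge0.
move=> [[x1 x2] x3] [[y1 y2] y3].
have [n1 n2 n3] := enorm_ge ((x1, x2, x3) - (y1, y2, y3)).
set N := enorm _ in n1 n2 n3 *.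
have l1 := line_lipschitz (fun t => d1 t x2 x3) (fun t => H1 (t, x2, x3)) x1 y1.
have l2 := line_lipschitz (fun t => d2 y1 t x3) (fun t => H2 (y1, t, x3)) x2 y2.
have l3 := line_lipschitz (fun t => d3 y1 y2 t) (fun t => H3 (y1, y2, t)) x3 y3.
have {}l1 : `|psi (x1, x2, x3) - psi (y1, x2, x3)| <= B1 * N.
  by apply: le_trans l1 _; rewrite ler_wpM2l.
have {}l2 : `|psi (y1, x2, x3) - psi (y1, y2, x3)| <= B2 * N.
  by apply: le_trans l2 _; rewrite ler_wpM2l.
have {}l3 : `|psi (y1, y2, x3) - psi (y1, y2, y3)| <= B3 * N.
  by apply: le_trans l3 _; rewrite ler_wpM2l.
rewrite !mulrDl; apply: le_trans (lerD (lerD l1 l2) l3).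
apply: le_trans (lerD (ler_normD _ _) (lexx _)); apply: le_trans (ler_normD _ _).
by rewrite le_eqVlt; apply/orP; left; apply/eqP; congr `|_|; ring.
Qed.

Lemma Rint3_c (F : vec3 R -> R) : integ lb3 F ->
  (forall a b, (\int[mu]_c F (a, b, c) = 0)%R) -> (\int[lb3]_z F z = 0)%R.
Proof.
move=> IF F0; have If : integ (leb2 \x mu)%E F by exact: IF.
transitivity (\int[(leb2 \x mu)%E]_z F z)%R; first by [].
rewrite -(Rint_fubini1 If) /Rintegral integral0_eq// => -[a b] _.
by congr EFin; exact: F0.
Qed.

Let Rint2 (G : measurableTypeR R * measurableTypeR R -> R) : integ leb2 G ->
  ((forall b, (\int[mu]_a G (a, b) = 0)%R) \/ (forall a, (\int[mu]_b G (a, b) = 0)%R)) ->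
  (\int[leb2]_z G z = 0)%R.
Proof.
move=> IG G0; have Ig : integ (mu \x mu)%E G by exact: IG.
transitivity (\int[(mu \x mu)%E]_z G z)%R; first by [].
case: G0 => G0.
  have [_ <-] := Rint_fubini2 Ig.
  by rewrite /Rintegral integral0_eq// => b _; congr EFin; exact: G0.
rewrite -(Rint_fubini1 Ig).
by rewrite /Rintegral integral0_eq// => b _; congr EFin; exact: G0.
Qed.

(** The first two coordinates are nested inside the first factor of [vec3], so Fubini is used twice;
    the third coordinate needs it once. *)
Lemma Rint3_ab (F : vec3 R -> R) : integ lb3 F ->
  ((forall b c, (\int[mu]_a F (a, b, c) = 0)%R) \/
   (forall a c, (\int[mu]_b F (a, b, c) = 0)%R)) -> (\int[lb3]_z F z = 0)%R.
Proof.
move=> IF F0; have If : integ (leb2 \x mu)%E F by exact: IF.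
transitivity (\int[(leb2 \x mu)%E]_z F z)%R; first by [].
have [Ic <-] := Rint_fubini2 If.
transitivity (\int[mu]_c (0 : R))%R.
  apply: Rint_ae_eq; [exact: integ_measurable Ic|exact: measurable_cst|].
  apply: filterS (integ_prod_ae2 If) => c Iab; apply: (Rint2 Iab).
  by case: F0 => F0; [left|right] => a; exact: F0.
by rewrite /Rintegral integral0.
Qed.

Lemma leb3_set1 y : lb3 [set y] = 0%E.
Proof.
have -> : [set y] = ([set y.1.1] `*` [set y.1.2]) `*` [set y.2].
  apply/seteqP; split => [x ->//|[[a b] c] /= [[-> ->] ->]].
  by case: y => [[]].
have m1 (t : R) : measurable ([set t] : set (measurableTypeR R)) by exact: measurable_set1.
transitivity (leb2 ([set y.1.1] `*` [set y.1.2] : set (measurableTypeR R * measurableTypeR R)) * mu [set y.2])%E.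
  by apply: product_measure1E => //; exact: measurableX.
by rewrite (_ : mu [set y.2] = 0%E) ?mule0//; exact: lebesgue_measure_set1.
Qed.

Lemma enorm_eq0 z : enorm z = 0 -> z = 0.
Proof.
move=> z0; have [] := enorm_ge z; rewrite z0 !normr_le0 => /eqP h1 /eqP h2 /eqP h3.
by case: z h1 h2 h3 {z0} => [[a b] c] /= -> -> ->.
Qed.

Lemma measurable_vec3_set1 y : measurable [set y].
Proof.
rewrite (_ : [set y] = ([set y.1.1] `*` [set y.1.2]) `*` [set y.2]).
  by do 2 apply: measurableX => //; exact: measurable_set1.
apply/seteqP; split => [x ->//|[[a b] c] /= [[-> ->] ->]].
by case: (y) => [[]].
Qed.

End vec3_calculus.

(** * The Newtonian kernel as a fundamental solution of the Laplacian *)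

Section newton_potential.
Context {R : realType}.
Local Notation mu := (@lebesgue_measure R).
Local Notation lb3 := (@leb3 R).
Implicit Types (psi : vec3 R -> R) (x y z : vec3 R) (e : R).

(* Plummer regularization of the Euclidean norm. *)
Definition reg e z : R := hyp (hyp (hyp e z.1.1) z.1.2) z.2.

Lemma regE e (a b c : R) : reg e (a, b, c) = hyp (hyp (hyp e a) b) c. Proof. by []. Qed.

Lemma reg_sqr e z : reg e z ^+ 2 = e ^+ 2 + enorm z ^+ 2.
Proof.
rewrite /reg !hyp_sqr /enorm sqr_sqrtr; first ring.
by rewrite !addr_ge0 ?sqr_ge0.
Qed.

Lemma reg_gt0 e z : 0 < e -> 0 < reg e z.
Proof. by move=> e0; do 3 apply: hyp_gt0. Qed.

Lemma reg_neq0 e z : 0 < e -> reg e z != 0.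
Proof. by move=> e0; rewrite gt_eqF// reg_gt0. Qed.

Lemma le_of_sqr (a b : R) : 0 <= a -> 0 <= b -> a ^+ 2 <= b ^+ 2 -> a <= b.
Proof. by move=> a0 b0; rewrite ler_sqr. Qed.

Lemma reg_ge e z : 0 < e -> e <= reg e z /\ enorm z <= reg e z.
Proof.
move=> e0; have r0 := ltW (reg_gt0 z e0).
by split; apply: le_of_sqr; rewrite ?enorm_ge0 ?(ltW e0)// reg_sqr ?lerDl ?lerDr sqr_ge0.
Qed.

Lemma reg_le e z : 0 < e -> reg e z <= e + enorm z.
Proof.
move=> e0; apply: le_of_sqr; rewrite ?addr_ge0 ?enorm_ge0 ?(ltW (reg_gt0 z e0)) ?(ltW e0)//.
by rewrite reg_sqr sqrrD lerD2r lerDl mulrn_wge0// mulr_ge0 ?enorm_ge0 ?ltW.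
Qed.

(** The one-dimensional Green identity requires the varying coordinate to sit in the outermost
    [hyp]. *)
Lemma reg_perm e z : 0 < e ->
  reg e z = hyp (hyp (hyp e z.1.2) z.2) z.1.1 /\ reg e z = hyp (hyp (hyp e z.1.1) z.2) z.1.2.
Proof.
have E (u w : R) : 0 <= u -> 0 <= w -> u ^+ 2 = w ^+ 2 -> u = w.
  by move=> u0 w0 uw; apply/le_anti/andP; split; apply: le_of_sqr => //; rewrite uw lexx.
have h0 (u w : R) : 0 <= hyp u w by exact: sqrtr_ge0.
by move=> e0; split; apply: E; rewrite /reg ?h0// !hyp_sqr; ring.
Qed.

Lemma measurable_reg e : measurable_fun setT (reg e).
Proof.
have mh d (T : measurableType d) (a b : T -> R) : measurable_fun setT a ->
    measurable_fun setT b -> measurable_fun setT (fun t => hyp (a t) (b t)).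
  move=> ma mb; have m1 : measurable_fun setT (fun t => a t ^+ 2 + b t ^+ 2).
    by apply: measurable_funD; exact: measurable_funX.
  apply: (measurableT_comp _ m1).
  exact: (continuous_measurable_fun (@sqrt_continuous R)).
apply: (mh); last exact: measurable_c3.
apply: (mh); last exact: measurable_c2.
by apply: (mh) => //; exact: measurable_c1.
Qed.

Lemma measurable_shift3 (d : measure_display) (T : measurableType d) (u : vec3 R -> T) y :
  measurable_fun setT u -> measurable_fun setT (fun x => u (x - y)).
Proof. by move=> mu_; apply: (measurableT_comp mu_); exact: measurable_sub3. Qed.

Lemma der_shift (f : R -> R) (t y a : R) : is_derive (t - y) (1 : R) f a ->
  is_derive t (1 : R) (fun t => f (t - y)) a.
Proof.
move=> df; have d1 := derB (der_id t) (der_cst y t).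
apply: (der_eq (@is_derive1_comp _ f (fun t : R => t - y) t _ _ df d1)).
by rewrite subr0 mulr1.
Qed.

(** Second derivative of 1 / hyp b t with respect to t. *)
Definition g2 (b t : R) : R := 3 * t ^+ 2 / hyp b t ^+ 5 - (hyp b t ^+ 3)^-1.

Lemma line_green_hyp (b y r : R) (p p1 p2 : R -> R) : 0 < b -> 0 < r ->
  (forall t : R, is_derive t (1 : R) p (p1 t)) -> (forall t : R, is_derive t (1 : R) p1 (p2 t)) ->
  continuous p2 ->
  (forall t, r < `|t| -> [/\ p t = 0, p1 t = 0 & p2 t = 0]) ->
  (\int[mu]_t ((hyp b (t - y))^-1 * p2 t - g2 b (t - y) * p t) = 0)%R.
Proof.
move=> b0 r0 dp dp1 cp2 supp.
have d0 (t : R) : is_derive t (1 : R) (fun t => (hyp b t)^-1) (- t / hyp b t ^+ 3).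
  have hn := hyp_neq0 t b0; apply: (der_eq (derV hn (der_hyp t b0))); by field.
have d1 (t : R) : is_derive t (1 : R) (fun t => - t / hyp b t ^+ 3) (g2 b t).
  have hn := hyp_neq0 t b0.
  have h3 : hyp b t ^+ 3 != 0 by rewrite expf_neq0.
  have D1 := @derV R (fun t => hyp b t ^+ 3) _ _ h3 (derX 2 (der_hyp t b0)).
  have D := derM (derN (der_id t)) D1.
  apply: (der_eq D).
  by rewrite /g2; field.
have d2 (t : R) : is_derive t (1 : R) (g2 b) (3 * (2 * t ^+ 1 * 1 / hyp b t ^+ 5 +
    t ^+ 2 * (- (5%:R * hyp b t ^+ 4 * (t / hyp b t)) / (hyp b t ^+ 5) ^+ 2))
    - (- (3%:R * hyp b t ^+ 2 * (t / hyp b t)) / (hyp b t ^+ 3) ^+ 2)).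
  have hn := hyp_neq0 t b0.
  have h3 : hyp b t ^+ 3 != 0 by rewrite expf_neq0.
  have h5 : hyp b t ^+ 5 != 0 by rewrite expf_neq0.
  have D1 := derZ 3 (derM (derX 1 (der_id t)) (@derV R (fun t => hyp b t ^+ 5) _ _ h5 (derX 4 (der_hyp t b0)))).
  have D := derB D1 (@derV R (fun t => hyp b t ^+ 3) _ _ h3 (derX 2 (der_hyp t b0))).
  rewrite (_ : g2 b = (fun t => 3 * (t ^+ 2 * (hyp b t ^+ 5)^-1) - (hyp b t ^+ 3)^-1)); last first.
    by apply/funext => s; rewrite /g2 mulrA.
  exact: D.
apply: (line_green (g := fun t => (hyp b (t - y))^-1)
  (g1 := fun t => - (t - y) / hyp b (t - y) ^+ 3) (p1 := p1) r0 _ _ dp dp1 _ cp2 supp).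
- by move=> t; exact: (der_shift (d0 (t - y))).
- by move=> t; exact: (der_shift (d1 (t - y))).
- by apply: der_continuous => t; exact: (der_shift (d2 (t - y))).
Qed.

(** The smoothness that Green's identity uses, with support in a cube rather than a ball to suit
    iterated integrals. *)
Definition C2c psi (r : R) : Prop := [/\ continuous psi,
  (forall e x : vec3 R, derivable psi x e), (forall e : vec3 R, continuous ('D_e psi)),
  (forall e x : vec3 R, derivable ('D_e psi) x e) &
  (forall e : vec3 R, continuous ('D_e ('D_e psi))) /\ forall x, ~~ inbox r x -> psi x = 0].

Lemma measurable_regVX n e : 0 < e -> measurable_fun setT (fun z => (reg e z ^+ n)^-1).
Proof.
move=> e0; apply: measurable_inv_pos; first by apply: measurable_funX; exact: measurable_reg.
by move=> z; rewrite exprn_gt0// reg_gt0.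
Qed.

Lemma integralZ_hypVX n (b c : R) : 0 < b -> 0 <= c ->
  (\int[mu]_t (c * (hyp b t ^+ n.+1)^-1)%:E = c%:E * \int[mu]_t ((hyp b t ^+ n.+1)^-1)%:E)%E.
Proof.
move=> b0 c0; under eq_integral do rewrite EFinM.
have mh : measurable_fun setT (fun t : R => ((hyp b t ^+ n.+1)^-1)%:E).
  by apply/measurable_EFinP; apply: continuous_measurable_fun; exact: continuous_hypVX.
have h0 (t : R) : (0 <= ((hyp b t ^+ n.+1)^-1)%:E)%E.
  by rewrite lee_fin invr_ge0 exprn_ge0// ltW// hyp_gt0.
exact: (ge0_integralZl mu measurableT mh (fun t _ => h0 t)).
Qed.

Lemma integral_regVX n e y (c : R) : 0 < e -> 0 <= c ->
  (\int[lb3]_x (c * (reg e (x - y) ^+ n)^-1)%:E =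
   \int[mu]_a \int[mu]_b \int[mu]_d (c * (reg e (a, b, d) ^+ n)^-1)%:E)%E.
Proof.
move=> e0 c0.
have mr : measurable_fun setT (fun x => (c * (reg e x ^+ n)^-1)%:E).
  by apply/measurable_EFinP; apply: measurable_funM => //; exact: measurable_regVX.
have r0 x : (0 <= (c * (reg e x ^+ n)^-1)%:E)%E.
  by rewrite lee_fin mulr_ge0// invr_ge0 exprn_ge0// ltW// reg_gt0.
exact: (etrans (ge0_integral_shift3 y mr r0) (integral_leb3 mr r0)).
Qed.

(** The normalization does not depend on [e], which lets the Plummer density act as an approximate
    identity of mass 4 pi. *)
Lemma integral_reg5 e y : 0 < e ->
  (\int[lb3]_x (3 * e ^+ 2 * (reg e (x - y) ^+ 5)^-1)%:E = (4 * pi)%:E)%E.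
Proof.
move=> e0; have e2 : 0 <= 3 * e ^+ 2 by rewrite mulr_ge0// sqr_ge0.
have en : e != 0 by rewrite gt_eqF.
apply: (etrans (integral_regVX _ y e0 e2)).
have E1 (a b : R) : (\int[mu]_c (3 * e ^+ 2 * (reg e (a, b, c) ^+ 5)^-1)%:E =
    (4 * e ^+ 2 * (hyp (hyp e a) b ^+ 4)^-1)%:E)%E.
  have B0 : 0 < hyp (hyp e a) b by do 2 apply: hyp_gt0.
  under eq_integral do rewrite regE.
  rewrite (integralZ_hypVX 4 B0 e2) integral_hyp5// -EFinM; congr EFin.
  by field; rewrite gt_eqF.
have E2 (a : R) : (\int[mu]_b \int[mu]_c (3 * e ^+ 2 * (reg e (a, b, c) ^+ 5)^-1)%:E =
    (2 * pi * e ^+ 2 * (hyp e a ^+ 3)^-1)%:E)%E.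
  have B0 : 0 < hyp e a by apply: hyp_gt0.
  under eq_integral do rewrite E1.
  have e4 : 0 <= 4 * e ^+ 2 by rewrite mulr_ge0// sqr_ge0.
  rewrite (integralZ_hypVX 3 B0 e4) integral_hyp4// -EFinM; congr EFin.
  by field; rewrite gt_eqF.
under eq_integral do rewrite E2.
have ep : 0 <= 2 * pi * e ^+ 2 by apply: mulr_ge0; [rewrite mulr_ge0 ?pi_ge0|exact: sqr_ge0].
rewrite (integralZ_hypVX 2 e0 ep) integral_hyp3// -EFinM; congr EFin.
by field.
Qed.

(** Up to the factor 3 this integrand is the Plummer density times [reg], hence bounds its first
    moment; being of order [e], it shows that the mass concentrates at [y]. *)
Lemma integral_reg4 e y : 0 < e ->
  (\int[lb3]_x (e ^+ 2 * (reg e (x - y) ^+ 4)^-1)%:E = (pi ^+ 2 * e)%:E)%E.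
Proof.
move=> e0; have e2 : 0 <= e ^+ 2 by rewrite sqr_ge0.
have en : e != 0 by rewrite gt_eqF.
apply: (etrans (integral_regVX _ y e0 e2)).
have E1 (a b : R) : (\int[mu]_c (e ^+ 2 * (reg e (a, b, c) ^+ 4)^-1)%:E =
    (pi / 2 * e ^+ 2 * (hyp (hyp e a) b ^+ 3)^-1)%:E)%E.
  have B0 : 0 < hyp (hyp e a) b by do 2 apply: hyp_gt0.
  under eq_integral do rewrite regE.
  rewrite (integralZ_hypVX 3 B0 e2) integral_hyp4// -EFinM; congr EFin.
  by field; rewrite gt_eqF.
have E2 (a : R) : (\int[mu]_b \int[mu]_c (e ^+ 2 * (reg e (a, b, c) ^+ 4)^-1)%:E =
    (pi * e ^+ 2 * (hyp e a ^+ 2)^-1)%:E)%E.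
  have B0 : 0 < hyp e a by apply: hyp_gt0.
  under eq_integral do rewrite E1.
  have e4 : 0 <= pi / 2 * e ^+ 2 by apply: mulr_ge0; [rewrite divr_ge0 ?pi_ge0|exact: sqr_ge0].
  rewrite (integralZ_hypVX 2 B0 e4) integral_hyp3// -EFinM; congr EFin.
  by field; rewrite gt_eqF.
under eq_integral do rewrite E2.
have ep : 0 <= pi * e ^+ 2 by apply: mulr_ge0; [exact: pi_ge0|exact: sqr_ge0].
rewrite (integralZ_hypVX 1 e0 ep) integral_hyp2// -EFinM; congr EFin.
by field.
Qed.

Lemma plummer_ge0 e z : 0 < e -> 0 <= 3 * e ^+ 2 * (reg e z ^+ 5)^-1.
Proof.
move=> e0; apply: mulr_ge0; first by rewrite mulr_ge0// sqr_ge0.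
by rewrite invr_ge0 exprn_ge0// ltW// reg_gt0.
Qed.

Lemma continuous_triple (f g h : R -> R) : continuous f -> continuous g -> continuous h ->
  continuous (fun t => (f t, g t, h t) : vec3 R).
Proof.
move=> cf cg ch t.
have fg : (fun t => (f t, g t)) @ nbhs t --> ((f t, g t) : R * R).
  exact: (@cvg_pair _ _ _ (nbhs t) (nbhs (f t)) (nbhs (g t)) _ _ _ _ _ (cf t) (cg t)).
exact: (@cvg_pair _ _ _ (nbhs t) (nbhs ((f t, g t) : R * R)) (nbhs (h t)) _ _ _ _ _ fg (ch t)).
Qed.

(** Summing 3 i^2 / s^5 - 1 / s^3 over the coordinates i gives 3 (s^2 - e^2) / s^5 - 3 / s^3 = - 3
    e^2 / s^5, the Laplacian of 1 / s. *)
Lemma plummer_identity (e s a b c A B D p : R) : s != 0 ->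
  c ^+ 2 = s ^+ 2 - e ^+ 2 - a ^+ 2 - b ^+ 2 ->
  s^-1 * A - (3 * a ^+ 2 / s ^+ 5 - (s ^+ 3)^-1) * p +
  (s^-1 * B - (3 * b ^+ 2 / s ^+ 5 - (s ^+ 3)^-1) * p) +
  (s^-1 * D - (3 * c ^+ 2 / s ^+ 5 - (s ^+ 3)^-1) * p) -
  3 * e ^+ 2 * (s ^+ 5)^-1 * p = s^-1 * (A + B + D).
Proof. by move=> s0 ->; field. Qed.

Section one_test_function.
Variables (psi : vec3 R -> R) (r : R).
Hypothesis r0 : 0 < r.
Hypothesis psi_C2 : C2c psi r.

Let cpsi : continuous psi. Proof. by case: psi_C2. Qed.
Let dpsi (e x : vec3 R) : derivable psi x e. Proof. by case: psi_C2. Qed.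
Let cdpsi (e : vec3 R) : continuous ('D_e psi). Proof. by case: psi_C2. Qed.
Let ddpsi (e x : vec3 R) : derivable ('D_e psi) x e. Proof. by case: psi_C2. Qed.
Let cddpsi (e : vec3 R) : continuous ('D_e ('D_e psi)). Proof. by case: psi_C2 => _ _ _ _ []. Qed.
Let supp x : ~~ inbox r x -> psi x = 0. Proof. by case: psi_C2 => _ _ _ _ [_]; apply. Qed.
Let suppd (e x : vec3 R) : ~~ inbox r x -> 'D_e psi x = 0. Proof. exact: derive_support. Qed.
Let suppdd (e x : vec3 R) : ~~ inbox r x -> 'D_e ('D_e psi) x = 0.
Proof. by apply: derive_support => {}x; exact: suppd. Qed.
Let mpsi := continuous_vec3_measurable cpsi.

Let mrinv n e y : 0 < e -> measurable_fun setT (fun x => (reg e (x - y) ^+ n)^-1).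
Proof.
by move=> e0; apply: (@measurable_shift3 _ _ (fun z => (reg e z ^+ n)^-1)); exact: measurable_regVX.
Qed.

(* One coordinate direction of Green's identity against 1 / reg. *)
Let term e y (i : vec3 R -> R) (v : vec3 R) (x : vec3 R) : R :=
  (reg e (x - y))^-1 * 'D_v ('D_v psi) x -
  (3 * i (x - y) ^+ 2 / reg e (x - y) ^+ 5 - (reg e (x - y) ^+ 3)^-1) * psi x.

Let integ_term e y (i : vec3 R -> R) (v : vec3 R) : 0 < e -> measurable_fun setT i ->
  (forall z, `|i z| <= enorm z) -> integ lb3 (term e y i v).
Proof.
move=> e0 mi ii.
have [B1 B10 H1] := bounded_support (@cddpsi v) (@suppdd v).
have [B2 B20 H2] := bounded_support cpsi supp.
have mD := continuous_vec3_measurable (@cddpsi v).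
have m1 : measurable_fun setT (fun x => (reg e (x - y))^-1) by exact: (@mrinv 1%N).
have mi' : measurable_fun setT (fun x => i (x - y)) by exact: measurable_shift3.
(* The 4 is 3 + 1, from the two parts of the second derivative, as |i z| is at most [reg e z]. *)
apply: (integ_bounded (@measurable_boxset R r) (boxset_lty r)
  (B := e^-1 * B1 + (4 / e ^+ 3) * B2)).
  apply: measurable_funB; first exact: measurable_funM.
  apply: measurable_funM => //; apply: measurable_funB; last exact: mrinv.
  apply: measurable_funM; last exact: mrinv.
  by apply: measurable_funM => //; exact: measurable_funX.
move=> x; rewrite /term; set z := x - y; apply: le_trans (ler_normB _ _) _.
have [ge1 ge2] := reg_ge z e0; have rp := reg_gt0 z e0.
have rn : reg e z != 0 by rewrite gt_eqF.
rewrite [leRHS]mulrDl; apply: lerD; rewrite -[leRHS]mulrA normrM.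
  apply: ler_pM; [by []|by []| |exact: H1].
  by rewrite normfV gtr0_norm// lef_pV2 ?posrE.
apply: ler_pM; [by []|by []| |exact: H2].
have r3 : (reg e z ^+ 3)^-1 <= (e ^+ 3)^-1.
  by rewrite lef_pV2 ?posrE ?exprn_gt0//; apply: lerXn2r => //; rewrite nnegrE ltW.
have b1 : 0 <= 3 * i z ^+ 2 / reg e z ^+ 5 <= 3 * (reg e z ^+ 3)^-1.
  apply/andP; split.
    by apply: divr_ge0; [rewrite mulr_ge0// sqr_ge0|rewrite exprn_ge0// ltW].
  have i2 : i z ^+ 2 <= reg e z ^+ 2.
    rewrite -real_normK ?num_real//; apply: lerXn2r; rewrite ?nnegrE ?(ltW rp)//.
    exact: le_trans (ii z) ge2.
  have -> : 3 * (reg e z ^+ 3)^-1 = 3 * reg e z ^+ 2 / reg e z ^+ 5 by field.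
  by rewrite ler_wpM2r ?invr_ge0 ?exprn_ge0 ?(ltW rp)// ler_pM2l.
have b2 : 0 <= (reg e z ^+ 3)^-1 by rewrite invr_ge0 exprn_ge0// ltW.
case/andP: b1 => b10 b11.
by rewrite ler_norml; apply/andP; split; lra.
Qed.

Let out1 (a b c : R) : r < `|a| -> ~~ inbox r (a, b, c).
Proof. by rewrite /inbox/= !negb_and -!ltNge => ->. Qed.
Let out2 (a b c : R) : r < `|b| -> ~~ inbox r (a, b, c).
Proof. by rewrite /inbox/= !negb_and -!ltNge => ->; rewrite orbT. Qed.
Let out3 (a b c : R) : r < `|c| -> ~~ inbox r (a, b, c).
Proof. by rewrite /inbox/= !negb_and -!ltNge => ->; rewrite !orbT. Qed.

Let cline1 (u : vec3 R -> R) (b c : R) : continuous u -> continuous (fun t : R => u (t, b, c)).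
Proof.
move=> cu t; apply: (@continuous_comp _ _ _ (fun t : R => (t, b, c) : vec3 R) u); last exact: cu.
by apply: continuous_triple => s; [exact: cvg_id|exact: cvg_cst|exact: cvg_cst].
Qed.
Let cline2 (u : vec3 R -> R) (a c : R) : continuous u -> continuous (fun t : R => u (a, t, c)).
Proof.
move=> cu t; apply: (@continuous_comp _ _ _ (fun t : R => (a, t, c) : vec3 R) u); last exact: cu.
by apply: continuous_triple => s; [exact: cvg_cst|exact: cvg_id|exact: cvg_cst].
Qed.
Let cline3 (u : vec3 R -> R) (a b : R) : continuous u -> continuous (fun t : R => u (a, b, t)).
Proof.
move=> cu t; apply: (@continuous_comp _ _ _ (fun t : R => (a, b, t) : vec3 R) u); last exact: cu.
by apply: continuous_triple => s; [exact: cvg_cst|exact: cvg_cst|exact: cvg_id].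
Qed.

Let e1 : vec3 R := (1, 0, 0).
Let e2 : vec3 R := (0, 1, 0).
Let e3 : vec3 R := (0, 0, 1).

Let term1_0 e y : 0 < e -> (\int[lb3]_x term e y (fun z => z.1.1) e1 x = 0)%R.
Proof.
move=> e0; apply: Rint3_ab.
  apply: integ_term => //; first exact: measurable_c1.
  by move=> z; have [] := enorm_ge z.
left => b c.
have [d1 _ _] := derive1_coord dpsi.
have B0 : 0 < hyp (hyp e (b - y.1.2)) (c - y.2) by do 2 apply: hyp_gt0.
have dd (t : R) : is_derive t (1 : R) (fun s => 'D_e1 psi (s, b, c)) ('D_e1 ('D_e1 psi) (t, b, c)).
  have E s : s *: e1 + (0, b, c) = (s, b, c) :> vec3 R.
    by congr (_, _, _); rewrite /= /GRing.scale/= ?mulr1 ?mulr0 ?addr0 ?add0r.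
  have := line_derive (@ddpsi e1 (t *: e1 + (0, b, c))).
  by rewrite E; congr (is_derive _ _ _ _); apply/funext => s; rewrite E.
rewrite -[RHS](line_green_hyp y.1.1 B0 r0 (fun t => d1 t b c) dd
  (@cline1 _ b c (@cddpsi e1)) (fun t h => And3 (supp (out1 b c h)) (suppd e1 (out1 b c h))
  (suppdd e1 (out1 b c h)))).
apply: eq_Rintegral => t _; rewrite /term.
by have [-> _] := reg_perm ((t, b, c) - y) e0.
Qed.

Let term2_0 e y : 0 < e -> (\int[lb3]_x term e y (fun z => z.1.2) e2 x = 0)%R.
Proof.
move=> e0; apply: Rint3_ab.
  apply: integ_term => //; first exact: measurable_c2.
  by move=> z; have [] := enorm_ge z.
right => a c.
have [_ d2 _] := derive1_coord dpsi.
have B0 : 0 < hyp (hyp e (a - y.1.1)) (c - y.2) by do 2 apply: hyp_gt0.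
have dd (t : R) : is_derive t (1 : R) (fun s => 'D_e2 psi (a, s, c)) ('D_e2 ('D_e2 psi) (a, t, c)).
  have E s : s *: e2 + (a, 0, c) = (a, s, c) :> vec3 R.
    by congr (_, _, _); rewrite /= /GRing.scale/= ?mulr1 ?mulr0 ?addr0 ?add0r.
  have := line_derive (@ddpsi e2 (t *: e2 + (a, 0, c))).
  by rewrite E; congr (is_derive _ _ _ _); apply/funext => s; rewrite E.
rewrite -[RHS](line_green_hyp y.1.2 B0 r0 (fun t => d2 a t c) dd
  (@cline2 _ a c (@cddpsi e2)) (fun t h => And3 (supp (out2 a c h)) (suppd e2 (out2 a c h))
  (suppdd e2 (out2 a c h)))).
apply: eq_Rintegral => t _; rewrite /term.
by have [_ ->] := reg_perm ((a, t, c) - y) e0.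
Qed.

Let term3_0 e y : 0 < e -> (\int[lb3]_x term e y (fun z => z.2) e3 x = 0)%R.
Proof.
move=> e0; apply: Rint3_c.
  apply: integ_term => //; first exact: measurable_c3.
  by move=> z; have [] := enorm_ge z.
move=> a b.
have [_ _ d3] := derive1_coord dpsi.
have B0 : 0 < hyp (hyp e (a - y.1.1)) (b - y.1.2) by do 2 apply: hyp_gt0.
have dd (t : R) : is_derive t (1 : R) (fun s => 'D_e3 psi (a, b, s)) ('D_e3 ('D_e3 psi) (a, b, t)).
  have E s : s *: e3 + (a, b, 0) = (a, b, s) :> vec3 R.
    by congr (_, _, _); rewrite /= /GRing.scale/= ?mulr1 ?mulr0 ?addr0 ?add0r.
  have := line_derive (@ddpsi e3 (t *: e3 + (a, b, 0))).
  by rewrite E; congr (is_derive _ _ _ _); apply/funext => s; rewrite E.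
rewrite -[RHS](line_green_hyp y.2 B0 r0 (fun t => d3 a b t) dd
  (@cline3 _ a b (@cddpsi e3)) (fun t h => And3 (supp (out3 a b h)) (suppd e3 (out3 a b h))
  (suppdd e3 (out3 a b h)))).
by apply: eq_Rintegral => t _.
Qed.

Lemma continuous_laplacian : continuous (laplacian psi).
Proof. by move=> x; apply: cvgD; [apply: cvgD|]; exact: cddpsi. Qed.

Lemma laplacian_support x : ~~ inbox r x -> laplacian psi x = 0.
Proof.
move=> xr; rewrite -[RHS](addr0 0) -[X in _ = X + _](addr0 0).
by apply: (congr2 +%R (congr2 +%R _ _) _); exact: suppdd.
Qed.

Lemma integ_regpsi e y : 0 < e -> integ lb3 (fun x => 3 * e ^+ 2 * (reg e (x - y) ^+ 5)^-1).
Proof.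
move=> e0; apply: integ_ge0P.
- by apply: measurable_funM => //; exact: mrinv.
- by move=> x; exact: plummer_ge0.
- by rewrite integral_reg5// ltry.
Qed.

Lemma green_reg e y : 0 < e ->
  (\int[lb3]_x ((reg e (x - y))^-1 * laplacian psi x) =
   - \int[lb3]_x (3 * e ^+ 2 * (reg e (x - y) ^+ 5)^-1 * psi x))%R.
Proof.
move=> e0.
have I1 : integ lb3 (term e y (fun z => z.1.1) e1).
  by apply: integ_term => //; [exact: measurable_c1|move=> z; have [] := enorm_ge z].
have I2 : integ lb3 (term e y (fun z => z.1.2) e2).
  by apply: integ_term => //; [exact: measurable_c2|move=> z; have [] := enorm_ge z].
have I3 : integ lb3 (term e y (fun z => z.2) e3).
  by apply: integ_term => //; [exact: measurable_c3|move=> z; have [] := enorm_ge z].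
have [B B0 HB] := bounded_support cpsi supp.
have HB' x : `|psi x| <= B.
  apply: le_trans (HB x) _; exact: mulr_indic_le.
have IP : integ lb3 (fun x => 3 * e ^+ 2 * (reg e (x - y) ^+ 5)^-1 * psi x).
  apply: (integ_le _ _ (integZ B (integ_regpsi y e0))).
    by apply: measurable_funM => //; apply: measurable_funM => //; exact: mrinv.
  move=> x; rewrite normrM (ger0_norm (plummer_ge0 (x - y) e0)) mulrC.
  by apply: ler_wpM2r => //; exact: plummer_ge0.
have I12 := integD (integD I1 I2) I3.
have S0 : (\int[lb3]_x (term e y (fun z => z.1.1) e1 x + term e y (fun z => z.1.2) e2 x +
    term e y (fun z => z.2) e3 x) = 0)%R.
  by rewrite (RintD (integD I1 I2) I3) (RintD I1 I2) term1_0// term2_0// term3_0// !addr0.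
rewrite -[RHS]add0r -S0 -(RintB I12 IP); congr fine; apply: eq_integral => x _.
congr EFin; rewrite /term /laplacian -/e1 -/e2 -/e3; set z := x - y.
have rn := reg_neq0 z e0.
have z2 : z.2 ^+ 2 = reg e z ^+ 2 - e ^+ 2 - z.1.1 ^+ 2 - z.1.2 ^+ 2.
  rewrite reg_sqr /enorm sqr_sqrtr; first ring.
  by rewrite !addr_ge0 ?sqr_ge0.
exact: (esym (plummer_identity _ _ _ _ rn z2)).
Qed.

Lemma near_pow2 z : enorm z != 0 -> (enorm z ^+ 2)^-1 <= near_pow 2 1 z + 1.
Proof.
move=> z0; have zp : 0 < enorm z by rewrite lt0r z0 enorm_ge0.
rewrite /near_pow; case: ifPn => [_|].
  by rewrite powR_invn ?enorm_ge0// lerDl.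
move=> zb; rewrite add0r invf_le1 ?exprn_gt0// expr_ge1 ?enorm_ge0//.
have [n1 n2 n3] := enorm_ge z.
by move: zb; rewrite /inbox !negb_and -!ltNge => /or3P[] h; rewrite ltW// (lt_le_trans h).
Qed.

(** Two errors of order [e] are connected by Green's identity: replacing the kernel by 1 / reg costs
    at most e / |z|^2, locally integrable in dimension three, and testing the Plummer density
    against psi - psi y costs the Lipschitz constant times the first moment. *)
Lemma newton_potential y : integ lb3 (fun x => (enorm (x - y))^-1 * laplacian psi x) /\
  (\int[lb3]_x ((enorm (x - y))^-1 * laplacian psi x) = - (4 * pi * psi y))%R.
Proof.
have [L L0 lip] := vec3_lipschitz cpsi dpsi cdpsi supp.
have [B B0 HB] := bounded_support continuous_laplacian laplacian_support.
have mL := continuous_vec3_measurable continuous_laplacian.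
have [c c0 Hc] := @near_pow_integral R 2 1 ltac:(by []) ltac:(by rewrite ltr_nat) ltac:(by []).
have mnp : measurable_fun setT (fun x => near_pow 2 1 (x - y)).
  by apply: measurable_shift3; exact: measurable_near_pow.
have Inp : integ lb3 (fun x => near_pow 2 1 (x - y)).
  by apply: integ_ge0P => // [x|]; [exact: near_pow_ge0|rewrite Hc ltry].
have Id := integD Inp (integ_indic_boxset r).
pose k := (\int[lb3]_x (near_pow 2 1 (x - y) + \1_(boxset r) x))%R.
have ae_ne : {ae lb3, forall x, enorm (x - y) != 0}.
  exists [set y]; split; [exact: measurable_vec3_set1|exact: leb3_set1|].
  move=> x /= /negP; rewrite negbK => /eqP/enorm_eq0 /eqP.
  by rewrite subr_eq0 => /eqP.
have pw e x : 0 < e -> enorm (x - y) != 0 ->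
    `|(enorm (x - y))^-1 * laplacian psi x - (reg e (x - y))^-1 * laplacian psi x| <=
    e * B * (near_pow 2 1 (x - y) + \1_(boxset r) x).
  move=> e0 n0; rewrite -mulrBl normrM.
  have [xb|xb] := boolP (inbox r x); last first.
    rewrite laplacian_support// normr0 mulr0 mulr_ge0 ?mulr_ge0 ?addr_ge0 ?near_pow_ge0//.
    exact: ltW.
  have zp : 0 < enorm (x - y) by rewrite lt0r n0 enorm_ge0.
  have rp := reg_gt0 (x - y) e0.
  have [g1 g2'] := reg_ge (x - y) e0; have gl := reg_le (x - y) e0.
  rewrite -mulrA mulrCA mulrC; apply: ler_pM => //.
    apply: le_trans (HB x) _; exact: mulr_indic_le.
  rewrite ger0_norm ?subr_ge0 ?lef_pV2 ?posrE//.
  have -> : (enorm (x - y))^-1 - (reg e (x - y))^-1 =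
      (reg e (x - y) - enorm (x - y)) / (enorm (x - y) * reg e (x - y)).
    by field; rewrite n0 gt_eqF.
  apply: (@le_trans _ _ (e / enorm (x - y) ^+ 2)).
    apply: ler_pM; rewrite ?subr_ge0 ?invr_ge0 ?mulr_ge0 ?enorm_ge0 ?(ltW rp)//.
      by rewrite lerBlDr.
    by rewrite lef_pV2 ?posrE ?exprn_gt0 ?mulr_gt0// expr2 ler_pM2l.
  rewrite ler_pM2l// indicE mem_set; last exact/boxsetP.
  exact: near_pow2.
have mN : measurable_fun setT (fun x => (enorm (x - y))^-1 * laplacian psi x).
  by apply: measurable_funM => //; exact: (@measurable_shift3 _ _ (fun z => (enorm z)^-1) y measurable_enorm_inv).
have Ir e : 0 < e -> integ lb3 (fun x => (reg e (x - y))^-1 * laplacian psi x).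
  move=> e0; apply: (integ_bounded (@measurable_boxset R r) (boxset_lty r) (B := e^-1 * B)).
    by apply: measurable_funM => //; exact: (@mrinv 1%N).
  move=> x; rewrite normrM -mulrA; apply: ler_pM => //.
  have [g1 _] := reg_ge (x - y) e0.
  by rewrite normfV gtr0_norm ?reg_gt0// lef_pV2 ?posrE ?reg_gt0.
have IN : integ lb3 (fun x => (enorm (x - y))^-1 * laplacian psi x).
  apply: (integ_ae_le mN _ (integD (integ_norm (Ir 1 ltr01)) (integZ (1 * B) Id))).
  apply: filterS ae_ne => x n0 /=; have := pw 1 x ltr01 n0 => h.
  rewrite -lerBlDl; apply: le_trans h.
  exact: lerB_dist.
split=> //.
have est e : 0 < e -> `|(\int[lb3]_x ((enorm (x - y))^-1 * laplacian psi x))%R + 4 * pi * psi y| <=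
    e * (B * k + 3 * L * pi ^+ 2).
  move=> e0; have Ie := Ir e e0.
  have est1 : `|(\int[lb3]_x ((enorm (x - y))^-1 * laplacian psi x))%R -
      (\int[lb3]_x ((reg e (x - y))^-1 * laplacian psi x))%R| <= e * B * k.
    rewrite -(RintB IN Ie); apply: le_trans (le_normr_Rintegral _ (integB IN Ie)) _ => //.
    rewrite /k -(RintZ _ Id) -lee_fin (EFin_Rint (integ_norm (integB IN Ie))).
    rewrite (EFin_Rint (integZ _ Id)); apply: ae_ge0_le_integral => //.
    - by apply: (measurable_int lb3); exact: (integ_norm (integB IN Ie)).
    - move=> x _; rewrite lee_fin !mulr_ge0 ?addr_ge0 ?near_pow_ge0//; exact: ltW.
    - by apply: (measurable_int lb3); exact: (integZ _ Id).
    - by apply: filterS ae_ne => x n0 _; rewrite lee_fin; exact: pw.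
  have Ip := integ_regpsi y e0.
  pose P x := 3 * e ^+ 2 * (reg e (x - y) ^+ 5)^-1.
  have P0 x : 0 <= P x by exact: plummer_ge0.
  have I4 : integ lb3 (fun x => e ^+ 2 * (reg e (x - y) ^+ 4)^-1).
    apply: integ_ge0P; first by apply: measurable_funM => //; exact: mrinv.
    - by move=> x; apply: mulr_ge0; [exact: sqr_ge0|rewrite invr_ge0 exprn_ge0// ltW// reg_gt0].
    - by rewrite integral_reg4// ltry.
  have R4 : (\int[lb3]_x (e ^+ 2 * (reg e (x - y) ^+ 4)^-1))%R = pi ^+ 2 * e.
    by rewrite /Rintegral integral_reg4.
  have R5 : (\int[lb3]_x P x)%R = 4 * pi by rewrite /Rintegral integral_reg5.
  have pw2 x : `|P x * (psi x - psi y)| <= 3 * L * (e ^+ 2 * (reg e (x - y) ^+ 4)^-1).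
    rewrite normrM (ger0_norm (P0 x)).
    apply: (@le_trans _ _ (P x * (L * reg e (x - y)))).
      rewrite ler_wpM2l//; apply: le_trans (lip x y) _; rewrite ler_wpM2l//.
      by have [] := reg_ge (x - y) e0.
    rewrite le_eqVlt; apply/orP; left; apply/eqP; rewrite /P; field.
    exact: reg_neq0.
  have mP : measurable_fun setT (fun x => P x * (psi x - psi y)).
    apply: measurable_funM; last exact: measurable_funB.
    exact: integ_measurable Ip.
  have IPd : integ lb3 (fun x => P x * (psi x - psi y)).
    exact: (integ_le mP pw2 (integZ _ I4)).
  have est2 : `|(\int[lb3]_x (P x * psi x))%R - 4 * pi * psi y| <= 3 * L * (pi ^+ 2 * e).
    have -> : (\int[lb3]_x (P x * psi x))%R = (\int[lb3]_x (P x * (psi x - psi y)))%R + 4 * pi * psi y.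
      rewrite -R5 mulrC -(RintZ _ Ip) -(RintD IPd (integZ _ Ip)).
      by congr fine; apply: eq_integral => x _; congr EFin; rewrite -/(P x); ring.
    rewrite addrK; apply: le_trans (le_normr_Rintegral _ IPd) _ => //.
    rewrite -R4 -(RintZ _ I4).
    exact: (Rint_le (integ_norm IPd) (integZ _ I4) pw2).
  have G := green_reg y e0.
  have -> : (\int[lb3]_x ((enorm (x - y))^-1 * laplacian psi x))%R + 4 * pi * psi y =
    ((\int[lb3]_x ((enorm (x - y))^-1 * laplacian psi x))%R -
     (\int[lb3]_x ((reg e (x - y))^-1 * laplacian psi x))%R) -
    ((\int[lb3]_x (P x * psi x))%R - 4 * pi * psi y).
    by rewrite G -/(P _); ring.
  apply: le_trans (ler_normB _ _) _; apply: le_trans (lerD est1 est2) _.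
  by rewrite le_eqVlt; apply/orP; left; apply/eqP; ring.
have k0 : 0 <= k.
  by apply: Rintegral_ge0 => x _; rewrite addr_ge0// near_pow_ge0.
(* [q] may vanish, hence the division by q + 1 below. *)
pose q := B * k + 3 * L * pi ^+ 2.
have q0 : 0 <= q by rewrite addr_ge0 ?mulr_ge0 ?pi_ge0.
apply/eqP; rewrite -subr_eq0 opprK -normr_le0; apply/ler_addgt0Pr => e e0.
rewrite add0r; apply: le_trans (est (e / (q + 1)) _) _.
  by rewrite divr_gt0// ltr_wpDl.
rewrite -/q -mulrA -[leRHS]mulr1 ler_pM2l// ler_pdivrMl ?ltr_wpDl// mulr1.
by rewrite lerDl.
Qed.

End one_test_function.
End newton_potential.

(** * The Coulomb kernel and the minimizer *)

Section coulomb_kernel.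
Context {R : realType}.
Local Notation lb3 := (@leb3 R).
Local Notation M2 := (lb3 \x lb3)%E.
Implicit Types (x y z : vec3 R).

Definition coulK x y : R := (enorm (x - y))^-1.

Lemma coulK_ge0 x y : 0 <= coulK x y.
Proof. by rewrite invr_ge0 enorm_ge0. Qed.

Lemma enormN z : enorm (- z) = enorm z.
Proof. by rewrite /enorm /= !sqrrN. Qed.

Lemma coulKC x y : coulK x y = coulK y x.
Proof. by rewrite /coulK -enormN opprB. Qed.

Lemma measurable_coulK : measurable_fun setT (fun z : vec3 R * vec3 R => coulK z.1 z.2).
Proof. by apply: (measurableT_comp measurable_enorm_inv); exact: measurable_sub3. Qed.

(** The Coulomb kernel cut off at range [r]: its powers q < 3 have uniformly bounded integrals, and
    what is cut off is at most 1 / r. *)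
Definition near_ker (r : R) x y : R := near_pow 1 r (x - y).

Lemma near_pow_powR (q r : R) z : 0 < q -> near_pow 1 r z `^ q = near_pow q r z.
Proof.
move=> q0; rewrite /near_pow; case: ifP => _; last by rewrite powR0 ?gt_eqF.
by rewrite -powRrM mulN1r.
Qed.

Lemma near_powN (q r : R) z : near_pow q r (- z) = near_pow q r z.
Proof. by rewrite /near_pow enormN /inbox /= !normrN. Qed.

Lemma near_kerC r x y : near_ker r x y = near_ker r y x.
Proof. by rewrite /near_ker -near_powN opprB. Qed.

Lemma near_ker_ge0 r x y : 0 <= near_ker r x y.
Proof. exact: near_pow_ge0. Qed.

Lemma measurable_near_ker r :
  measurable_fun setT (fun z : vec3 R * vec3 R => near_ker r z.1 z.2).
Proof. by apply: (measurableT_comp (measurable_near_pow 1 r)); exact: measurable_sub3. Qed.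

Lemma near_ker_powR_bound (q r : R) : 0 < q -> q < 3 -> 0 < r ->
  exists2 c, 0 <= c & forall x, (\int[lb3]_y (near_ker r x y `^ q)%:E <= c%:E)%E.
Proof.
move=> q0 q3 r0; have [c c0 Hc] := near_pow_integral q0 q3 r0.
exists c => // x; rewrite -(Hc x) le_eqVlt; apply/orP; left; apply/eqP.
by apply: eq_integral => y _; rewrite near_kerC /near_ker near_pow_powR.
Qed.

Lemma inbox_out (r : R) z : ~~ inbox r z -> r < enorm z.
Proof.
have [n1 n2 n3] := enorm_ge z.
by rewrite /inbox !negb_and -!ltNge => /or3P[] h; rewrite (lt_le_trans h).
Qed.

Lemma coulK_le (r : R) x y : 0 < r -> coulK x y <= near_ker r x y + r^-1.
Proof.
move=> r0; rewrite /coulK /near_ker /near_pow; case: ifPn => [_|/inbox_out h].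
  by rewrite powR_inv1 ?enorm_ge0// lerDl invr_ge0 ltW.
by rewrite add0r lef_pV2 ?posrE ?ltW// (lt_trans r0).
Qed.

Lemma near_ker_le (r : R) x y : near_ker r x y <= coulK x y.
Proof.
rewrite /coulK /near_ker /near_pow; case: ifPn => [_|_].
  by rewrite powR_inv1 ?enorm_ge0.
by rewrite invr_ge0 enorm_ge0.
Qed.

Lemma leb3_boxset (r : R) : 0 < r -> lb3 (boxset r) = (8 * r ^+ 3)%:E.
Proof.
move=> r0.
pose s : set (measurableTypeR R) := `[- r, r]%classic.
have ms : measurable s by exact: measurable_itv.
have sE : (@lebesgue_measure R s = (2 * r)%:E)%E.
  rewrite lebesgue_measure_itv /= lte_fin ifT; last by lra.
  by rewrite -EFinB; congr EFin; ring.
have E2 : (leb2 (s `*` s) = (@lebesgue_measure R) s * (@lebesgue_measure R) s)%E.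
  exact: product_measure1E.
transitivity (leb2 (s `*` s) * (@lebesgue_measure R) s)%E.
  by apply: product_measure1E => //; exact: measurableX.
rewrite E2; transitivity ((2 * r)%:E * (2 * r)%:E * (2 * r)%:E)%E; first by rewrite -sE.
by rewrite -!EFinM; congr EFin; ring.
Qed.

Lemma leb3_nonnull (P : vec3 R -> Prop) : {ae lb3, forall x, P x} -> exists x, P x.
Proof.
move=> [N [mN N0 PN]]; apply: contrapT => H.
have : (lb3 (boxset 1) <= lb3 N)%E.
  apply: le_measure; rewrite ?inE//; first exact: measurable_boxset.
  by move=> x _; apply: PN => Px; apply: H; exists x.
rewrite N0 leb3_boxset ?ltr01// lee_fin.
by rewrite expr1n mulr1 leNgt ltr0n.
Qed.

Definition boxn (n : nat) : set (vec3 R) := boxset n%:R.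

Lemma boxn_cover : \bigcup_n boxn n = setT.
Proof.
apply/seteqP; split => // x _; exists (Num.truncn (enorm x)).+1 => //.
have h := ltW (truncnS_gt (enorm x)); have [n1 n2 n3] := enorm_ge x.
by apply/boxsetP; rewrite /inbox !(le_trans _ h).
Qed.

Lemma boxset_mono (r s : R) : r <= s -> boxset r `<=` boxset s.
Proof.
move=> rs x /boxsetP /and3P[h1 h2 h3]; apply/boxsetP.
by rewrite /inbox !(le_trans _ rs).
Qed.

Lemma boxn_nd n p : (n <= p)%N -> boxn n `<=` boxn p.
Proof. by move=> np; apply: boxset_mono; rewrite ler_nat. Qed.

Lemma integral_boxset_coulK : exists c : nat -> R, (forall n, 0 <= c n) /\
  forall n x, (\int[lb3]_y (\1_(boxn n) y * coulK x y)%:E <= (c n)%:E)%E.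
Proof.
have [c c0 Hc] := near_ker_powR_bound (ltr01 : 0 < 1 :> R) (ltac:(by rewrite ltr1n)) (ltr01 : 0 < 1 :> R).
(* The near part contributes [c], and the rest of the kernel is at most 1 on the box. *)
exists (fun n => c + fine (lb3 (boxn n))); split => [n|n x].
  by rewrite addr_ge0// fine_ge0.
have mb : measurable_fun setT (\1_(boxn n) : vec3 R -> R).
  by apply: measurable_indic; exact: measurable_boxset.
have mk1 : measurable_fun setT (fun y => near_ker 1 x y `^ 1).
  apply: (measurableT_comp (measurable_powR _)).
  by apply: (measurableT_comp (measurable_near_ker 1) (g := fun y => (x, y))); exact: measurable_fun_pair.
have mK1 : measurable_fun setT (coulK x).
  by apply: (measurableT_comp measurable_coulK (g := fun y => (x, y))); exact: measurable_fun_pair.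
apply: (@le_trans _ _ (\int[lb3]_y ((near_ker 1 x y `^ 1)%:E + (\1_(boxn n) y)%:E))%E).
  apply: ge0_le_integral => //.
  - by move=> y _; rewrite lee_fin mulr_ge0// coulK_ge0.
  - by apply/measurable_EFinP; exact: measurable_funM.
  - by apply/measurable_EFinP; exact: measurable_funD.
  - move=> y _; rewrite -EFinD lee_fin powRr1 ?near_ker_ge0//.
    have h := coulK_le x y (ltr01 : 0 < 1 :> R); rewrite invr1 in h.
    rewrite indicE; case: (_ \in _); first by rewrite mul1r.
    by rewrite mul0r addr0 near_ker_ge0.
rewrite ge0_integralD//; last 3 first.
- by move=> y _; rewrite lee_fin powR_ge0.
- exact/measurable_EFinP.
- exact/measurable_EFinP.
rewrite EFinD; apply: leeD; first exact: Hc.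
rewrite integral_indic//; last exact: measurable_boxset.
by rewrite setIT fineK// ge0_fin_numE// boxset_lty.
Qed.

Definition kin (z : phase R) : R := 1 / 2 * enorm z.2 ^+ 2.

Lemma kin_ge0 (z : phase R) : 0 <= kin z.
Proof. by rewrite mulr_ge0// sqr_ge0. Qed.

Lemma measurable_kin : measurable_fun setT kin.
Proof.
apply: measurable_funM => //; apply: measurable_funX.
exact: (measurableT_comp measurable_enorm measurable_snd).
Qed.

Lemma enorm_box (r : R) z : boxset r z -> enorm z ^+ 2 <= 3 * r ^+ 2.
Proof.
move=> /boxsetP /and3P[h1 h2 h3].
have r0 : 0 <= r by exact: le_trans h1.
have sq (t : R) : `|t| <= r -> t ^+ 2 <= r ^+ 2.
  by move=> h; rewrite -real_normK ?num_real// lerXn2r ?nnegrE.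
rewrite /enorm sqr_sqrtr ?addr_ge0 ?sqr_ge0//.
have := sq _ h1; have := sq _ h2; have := sq _ h3; lra.
Qed.

Lemma kin_boxn n (z : phase R) : boxn n z.1 -> boxn n z.2 -> kin z <= 1 / 2 * (3 * n%:R ^+ 2).
Proof. by move=> _ h; rewrite /kin ler_pM2l//; exact: enorm_box. Qed.

End coulomb_kernel.

(** * Finiteness of the Coulomb energy *)

Section finite_energy.
Context {R : realType}.
Local Notation lb3 := (@leb3 R).
Local Notation M2 := (lb3 \x lb3)%E.
Variables (f : phase R -> R) (k : R).
Hypothesis k0 : 0 < k.
Hypothesis k72 : k < 7 / 2.
Hypothesis f0 : forall z, 0 <= f z.
Hypothesis If : integ M2 f.
Hypothesis IT : integ M2 (fun z => kin z * f z).
Hypothesis Ik : integ M2 (fun z => f z `^ (1 + 1 / k)).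

(** Interpolation at a fixed position: splitting the velocity integral by levels and optimizing
    bounds this power of the density by the slices of the kinetic energy and of the integral of f^(1
    + 1/k), both integrable in x. *)
Lemma density_integ_pow : integ lb3 (fun x => dens lb3 f x `^ (1 + 1 / (k + 3 / 2))).
Proof.
have Ie : integ M2 (fun z => enorm z.2 ^+ 2 * f z).
  have := integZ 2 IT; congr (is_true (integ _ _)).
  by apply/funext => z; rewrite /kin; field.
have md : measurable_fun setT (dens lb3 f) by apply: measurable_dens; exact: integ_measurable If.
pose G x := (\int[lb3]_v (f (x, v) `^ (1 + 1 / k)))%R.
pose H x := (\int[lb3]_v (enorm v ^+ 2 * f (x, v)))%R.
have IG : integ lb3 G by exact: (integ_Rint1 Ik).
have IH : integ lb3 H by exact: (integ_Rint1 Ie).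
apply: (integ_ae_le _ _ (integZ 32 (integD IG IH))).
  exact: (measurableT_comp (measurable_powR _) md).
apply: filterS3 (integ_prod_ae1 If) (integ_prod_ae1 Ik) (integ_prod_ae1 Ie) => x h1 h2 h3.
have d0 : 0 <= dens lb3 f x by exact: dens_ge0.
have G0 : 0 <= G x by apply: Rintegral_ge0 => v _; exact: powR_ge0.
have H0 : 0 <= H x by apply: Rintegral_ge0 => v _; rewrite mulr_ge0// sqr_ge0.
have p0 : 0 < 1 / (k + 3 / 2) by rewrite divr_gt0 ?addr_gt0 ?divr_gt0.
rewrite ger0_norm ?powR_ge0//.
have [->|dn] := eqVneq (dens lb3 f x) 0.
  by rewrite powR0 ?mulr_ge0 ?addr_ge0// gt_eqF//; lra.
have dp : 0 < dens lb3 f x by rewrite lt0r dn.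
apply: level_optimize => // l r l0 r0.
have Ib := @integ_indic_boxset R r.
have I1 := integZ l Ib.
have I2 := integZ (l `^ (1 / k))^-1 h2.
have I3 := integZ (r ^+ 2)^-1 h3.
have pw v : f (x, v) <= l * \1_(boxset r) v + (l `^ (1 / k))^-1 * f (x, v) `^ (1 + 1 / k) +
    (r ^+ 2)^-1 * (enorm v ^+ 2 * f (x, v)).
  have k1 : 0 < 1 / k by rewrite divr_gt0.
  have out : ~~ inbox r v -> r ^+ 2 <= enorm v ^+ 2.
    by move=> /inbox_out/ltW h; rewrite lerXn2r ?nnegrE ?enorm_ge0// ltW.
  have e0 : 0 <= enorm v ^+ 2 by exact: sqr_ge0.
  apply: le_trans (level_split (f0 (x, v)) l0 r0 e0 k1 out) _.
  rewrite [_ / l `^ _]mulrC [_ / r ^+ 2]mulrC !lerD2r.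
  have [vb|vb] := boolP (inbox r v); last by rewrite mulr_ge0// ltW.
  by rewrite indicE mem_set ?mulr1//; exact/boxsetP.
apply: le_trans (Rint_le h1 (integD (integD I1 I2) I3) pw) _.
rewrite (RintD (integD I1 I2) I3) (RintD I1 I2) (RintZ _ Ib) (RintZ _ h2) (RintZ _ h3).
have -> : (\int[lb3]_v \1_(boxset r) v)%R = 8 * r ^+ 3.
  rewrite /Rintegral integral_indic//; last exact: measurable_boxset.
  by rewrite setIT; exact: (congr1 fine (leb3_boxset r0)).
by rewrite -/(G x) -/(H x) le_eqVlt; apply/orP; left; apply/eqP; ring.
Qed.

Lemma integ_coulomb : integ M2 (coul lb3 coulK f).
Proof.
have mf := integ_measurable If.
have d0 x : 0 <= dens lb3 f x by exact: dens_ge0.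
have Id : integ lb3 (dens lb3 f) by exact: integ_Rint1.
have md := integ_measurable Id.
(* The relation p (1 - 1 / (2 q)) = 1 with p = 1 + 1 / n fixes q = (n + 1) / 2, and q < 3 means
   exactly k < 7 / 2. *)
pose n := k + 3 / 2; pose q := (n + 1) / 2.
have n0 : 0 < n by rewrite /n addr_gt0// divr_gt0.
have n5 : n < 5 by have K := k72; rewrite /n; lra.
have n32 : 3 / 2 < n by rewrite /n ltrDr.
have q1 : 1 < q by rewrite /q; lra.
have q3 : q < 3 by rewrite /q; lra.
have q0 : 0 < q by lra.
have [c c0 Hc] := near_ker_powR_bound q0 q3 (ltr01 : 0 < 1 :> R).
have pq : (1 + 1 / n) * (1 - (2 * q)^-1) = 1.
  rewrite /q; field; rewrite (gt_eqF n0) /= gt_eqF//; lra.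
have I1 := young_finite (@near_ker_ge0 R 1) (measurable_near_ker 1) (near_kerC 1) Hc d0 md
  density_integ_pow q1 pq.
(* The far part of the kernel is at most 1 and contributes at most the square of the mass. *)
have I2 : integ M2 (fun z => dens lb3 f z.1 * dens lb3 f z.2).
  have m1 : measurable_fun setT (fun z : vec3 R * vec3 R => dens lb3 f z.1 * dens lb3 f z.2).
    by apply: measurable_funM; [exact: (measurableT_comp md measurable_fst)|
                                exact: (measurableT_comp md measurable_snd)].
  apply: (integ_prod (h := fun x => (\int[lb3]_y dens lb3 f y)%R * dens lb3 f x) m1); last exact: integZ.
  move=> x; rewrite mulrC -(RintZ _ Id) (EFin_Rint (integZ _ Id)).
  rewrite le_eqVlt; apply/orP; left; apply/eqP; apply: eq_integral => y _.
  by rewrite /= ger0_norm// mulr_ge0.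
apply: (integ_le _ _ (integD I1 I2)).
  by apply: measurable_coul => //; exact: measurable_coulK.
move=> z; rewrite /coul ger0_norm ?mulr_ge0 ?coulK_ge0//.
have := coulK_le z.1 z.2 (ltr01 : 0 < 1 :> R); rewrite invr1 => h.
rewrite -[X in _ <= _ + X]mulr1 -mulrDr ler_wpM2l//.
by rewrite mulr_ge0.
Qed.

End finite_energy.

(** * The multiplier of the minimizer and its sign *)

Section minimizer.
Context {R : realType}.
Variables (Q : R -> R) (C k M : R) (f : phase R -> R).
Hypothesis Q_C1 : hC1 Q.
Hypothesis Q_ge0 : forall s : R, 0 <= s -> 0 <= Q s.
Hypothesis Q_0 : Q 0 = 0.
Hypothesis C_gt0 : 0 < C.
Hypothesis k_gt0 : 0 < k.
Hypothesis k_lt : k < 7 / 2.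
Hypothesis Q1 : forall s : R, 0 <= s -> C * (s + s `^ (1 + 1 / k)) <= Q s.
Hypothesis Q2 : convex_function (`[0, +oo[%classic : set R^o) (Q : R^o -> R^o).
Hypothesis M_gt0 : 0 < M.
Hypothesis f_min : minimizer Q M f.
Local Notation lb3 := (@leb3 R).
Local Notation M2 := (lb3 \x lb3)%E.
Local Notation Q' := (hderive Q).
Local Notation V := (pot lb3 coulK f).

Lemma integ_kin (g : phase R -> R) : measurable_fun setT g -> (forall z, 0 <= g z) ->
  (Ekin g < +oo)%E -> integ M2 (fun z => kin z * g z).
Proof.
move=> mg g0 Eg.
have me : measurable_fun setT (fun z : phase R => enorm z.2 ^+ 2 * g z).
  apply: measurable_funM => //; apply: measurable_funX.
  exact: (measurableT_comp measurable_enorm measurable_snd).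
have eg0 (z : phase R) : 0 <= enorm z.2 ^+ 2 * g z by rewrite mulr_ge0// sqr_ge0.
suff I1 : integ M2 (fun z : phase R => enorm z.2 ^+ 2 * g z).
  have := integZ (1 / 2) I1; congr (is_true (integ _ _)).
  by apply/funext => z; rewrite /kin mulrA.
apply: integ_ge0P => //.
rewrite ltNge leye_eq; apply/negP => /eqP h.
move: Eg; rewrite /Ekin.
have -> : (\int[leb6]_z (enorm z.2 ^+ 2 * g z)%:E = +oo)%E by exact: h.
by rewrite gt0_muley// lte_fin divr_gt0.
Qed.

(** Once both integrals converge, no infinities meet in the extended-real sum, and the energy takes
    the real form of the variational argument. *)
Lemma Hamiltonian_fin (g : phase R -> R) : integ M2 (fun z => kin z * g z) ->
  integ M2 (coul lb3 coulK g) ->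
  Hamiltonian g = (\int[M2]_z (kin z * g z) - 2^-1 * \int[M2]_z coul lb3 coulK g z)%R%:E.
Proof.
move=> minimizer_integ_kin Ic.
have Ie : integ M2 (fun z => enorm z.2 ^+ 2 * g z).
  have := integZ 2 minimizer_integ_kin; congr (is_true (integ _ _)).
  by apply/funext => z; rewrite /kin; field.
rewrite /Hamiltonian EFinB; congr (_ - _)%E.
  transitivity ((1 / 2)%:E * \int[M2]_z (enorm z.2 ^+ 2 * g z)%:E)%E; first by [].
  rewrite -(EFin_Rint Ie) -EFinM -(RintZ _ Ie); congr EFin.
  by congr fine; apply: eq_integral => z _; rewrite /kin mulrA.
transitivity ((1 / 2)%:E * \int[M2]_z (coul lb3 coulK g z)%:E)%E; first by [].
by rewrite -(EFin_Rint Ic) -EFinM; congr EFin; rewrite div1r.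
Qed.

Lemma minimizer_ge0 z : 0 <= f z. Proof. by case: f_min => -[_ + _ _] _; apply. Qed.
Lemma minimizer_integ : integ M2 f. Proof. by case: f_min => -[+ _ _ _] _; apply. Qed.
Let mf := integ_measurable minimizer_integ.
Lemma minimizer_integ_kin : integ M2 (fun z => kin z * f z).
Proof. by apply: integ_kin => //; [exact: minimizer_ge0|case: f_min => -[]]. Qed.
Lemma minimizer_Casimir : (\int[M2]_z (Q (f z))%:E = M%:E)%E.
Proof. by case: f_min => -[_ _ + _] _; apply. Qed.

Let mQ : measurable_fun setT (fun z => Q (f z)).
Proof. by have [] := measurable_Qc Q_C1 Q_0 C_gt0 Q1 Q2 mf minimizer_ge0. Qed.

Lemma integ_f_pow : integ M2 (fun z => f z `^ (1 + 1 / k)).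
Proof.
have IQ : integ M2 (fun z => Q (f z)).
  by apply: integ_ge0P => // [z|]; [exact/Q_ge0/minimizer_ge0|rewrite minimizer_Casimir ltry].
apply: (integ_le _ _ (integZ C^-1 IQ)).
  exact: (measurableT_comp (measurable_powR _) mf).
move=> z; rewrite ger0_norm ?powR_ge0// ler_pdivlMl//.
apply: le_trans (Q1 (minimizer_ge0 z)); rewrite ler_pM2l// lerDr; exact: minimizer_ge0.
Qed.

Lemma minimizer_integ_coul : integ M2 (coul lb3 coulK f).
Proof. exact: (integ_coulomb k_gt0 k_lt minimizer_ge0 minimizer_integ minimizer_integ_kin integ_f_pow). Qed.

Lemma minimizer_neq0 : ~ {ae M2, forall z, f z = 0}.
Proof.
move=> H; have : (\int[M2]_z (Q (f z))%:E = 0)%E.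
  rewrite -[RHS](integral0 M2 setT); apply: ae_eq_integral => //.
  - exact/measurable_EFinP.
  - by apply: filterS H => z /= -> _; rewrite Q_0.
by rewrite minimizer_Casimir => -[M0]; move: M_gt0; rewrite M0 ltxx.
Qed.

Lemma minimizer_EL : exists lam : R, {ae M2, forall z,
  lam * Q' (f z) <= kin z - V z.1 /\ (0 < f z -> kin z - V z.1 = lam * Q' (f z))}.
Proof.
have [c [c0 Kc]] := @integral_boxset_coulK R.
apply: (euler_lagrange coulK_ge0 measurable_coulK coulKC Q_C1 Q_ge0 Q_0 C_gt0 Q1 Q2
  (D := boxn) _ _ boxn_cover boxn_nd c0 Kc measurable_kin kin_ge0 kin_boxn minimizer_ge0 minimizer_integ minimizer_integ_coul minimizer_integ_kin minimizer_Casimir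
  _ minimizer_neq0).
- by move=> n; exact: measurable_boxset.
- by move=> n; exact: boxset_lty.
move=> g Ig g0 QgM ITg Icg; rewrite -lee_fin.
rewrite -(Hamiltonian_fin minimizer_integ_kin minimizer_integ_coul) -(Hamiltonian_fin ITg Icg).
case: f_min => _ ->; apply: ereal_inf_lbound; exists g => //; split => //.
have Ie : integ M2 (fun z => enorm z.2 ^+ 2 * g z).
  have := integZ 2 ITg; congr (is_true (integ _ _)).
  by apply/funext => z; rewrite /kin; field.
rewrite /Ekin; have -> : (\int[leb6]_z (enorm z.2 ^+ 2 * g z)%:E =
  \int[M2]_z (enorm z.2 ^+ 2 * g z)%:E)%E by [].
by rewrite -(EFin_Rint Ie) -EFinM ltry.
Qed.

Lemma minimizer_integ_dens : integ lb3 (dens lb3 f).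
Proof. exact: (integ_Rint1 minimizer_integ). Qed.

Lemma minimizer_pot_ae : {ae lb3, forall x, integ lb3 (fun y => dens lb3 f y * coulK x y)}.
Proof.
have [c [c0 Kc]] := @integral_boxset_coulK R.
have H n : {ae lb3, forall x, boxn n x -> integ lb3 (fun y => dens lb3 f y * coulK x y)}.
  by apply: (pot_ae coulK_ge0 measurable_coulK coulKC (measurable_boxset _) (Kc n)); exact: minimizer_integ_dens.
apply: filterS (ae_foralln H) => x Hx.
have : [set: vec3 R] x by [].
by rewrite -boxn_cover => -[n _]; exact: Hx.
Qed.

Lemma minimizer_dens_neq0 : ~ {ae lb3, forall x, dens lb3 f x = 0}.
Proof.
move=> H; apply: minimizer_neq0; apply: (Rint_ge0_eq0 minimizer_integ minimizer_ge0).
rewrite -(Rint_fubini1 minimizer_integ); transitivity (\int[lb3]_x (0 : R))%R.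
  apply: Rint_ae_eq => //; exact: (integ_measurable minimizer_integ_dens).
by rewrite /Rintegral integral0.
Qed.

(** If the integral vanished, so would its nonnegative integrand, and the density would be zero
    almost everywhere. *)
Lemma minimizer_pot_gt0 x : integ lb3 (fun y => dens lb3 f y * coulK x y) -> 0 < V x.
Proof.
move=> Ix; rewrite lt0r pot_ge0 ?andbT; [|exact: coulK_ge0|exact: minimizer_ge0].
apply/eqP => V0; apply: minimizer_dens_neq0.
have k0 y : 0 <= dens lb3 f y * coulK x y.
  by rewrite mulr_ge0 ?coulK_ge0// dens_ge0//; exact: minimizer_ge0.
(* The inverse of 0 is 0, so the kernel vanishes on the diagonal and the point [x] has to be
   discarded. *)
have ne : {ae lb3, forall y, y != x}.
  exists [set x]; split; [exact: measurable_vec3_set1|exact: leb3_set1|].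
  by move=> y /= /negP; rewrite negbK => /eqP.
apply: filterS2 ne (Rint_ge0_eq0 Ix k0 V0) => y yx /eqP.
rewrite mulf_eq0 => /orP[/eqP//|]; rewrite /coulK invr_eq0 => /eqP/enorm_eq0/eqP.
by rewrite subr_eq0 eq_sym (negbTE yx).
Qed.

(** For lam >= 0 the relation would give V <= |v|^2 / 2 almost everywhere, which fails for small v
    at any position where the integral defining V converges, since V is positive there. *)
Lemma multiplier_lt0 lam : {ae M2, forall z,
    lam * Q' (f z) <= kin z - V z.1 /\ (0 < f z -> kin z - V z.1 = lam * Q' (f z))} ->
  lam < 0.
Proof.
move=> EL; rewrite ltNge; apply/negP => lam0.
have E0 : {ae M2, forall z, V z.1 <= kin z}.
  apply: filterS EL => z [h _]; rewrite -subr_ge0; apply: le_trans h.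
  by rewrite mulr_ge0// ltW// (Q'_gt0 Q_C1 Q_0 C_gt0 Q1 Q2)// minimizer_ge0.
have [x [Ix Hx]] : exists x, integ lb3 (fun y => dens lb3 f y * coulK x y) /\
    {ae lb3, forall v, V x <= kin (x, v)}.
  by apply: leb3_nonnull; apply: filterS2 minimizer_pot_ae (ae_prod E0) => x ? ?.
have Vx := minimizer_pot_gt0 Ix.
(* On the cube of half-side [dl] the kinetic energy is at most 3 dl^2 / 2 <= 3 dl / 2 <= V x / 2. *)
pose dl := Num.min 1 (V x / 3).
have dl0 : 0 < dl by rewrite lt_min ltr01 divr_gt0.
have [N [mN N0 HN]] := Hx.
have : (lb3 (boxset dl) <= lb3 N)%E.
  apply: le_measure; rewrite ?inE//; first exact: measurable_boxset.
  move=> v vb; apply: HN => /=; apply/negP; rewrite -ltNge /kin /=.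
  have := enorm_box vb.
  have d1 : dl <= 1 by rewrite ge_min lexx.
  have d2 : dl <= V x / 3 by rewrite ge_min lexx orbT.
  have d3 : dl ^+ 2 <= dl by rewrite expr2 ler_piMr// ltW.
  lra.
rewrite N0 leb3_boxset// lee_fin leNgt mulr_gt0// exprn_gt0//.
Qed.

End minimizer.

(** * Null energy levels and decay of Newtonian potentials *)

Section steady.
Context {R : realType}.
Local Notation lb3 := (@leb3 R).
Local Notation M2 := (lb3 \x lb3)%E.
Implicit Types (x y v : vec3 R).

Lemma Rint_ae_le d (T : measurableType d) (mu : {measure set T -> \bar R}) (f g : T -> R) :
  integ mu f -> integ mu g -> (forall z, 0 <= f z) -> (forall z, 0 <= g z) ->
  {ae mu, forall z, f z <= g z} -> (\int[mu]_z f z <= \int[mu]_z g z)%R.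
Proof.
move=> If Ig f0 g0 fg; rewrite -lee_fin (EFin_Rint If) (EFin_Rint Ig).
apply: ae_ge0_le_integral => //.
- by move=> z _; rewrite lee_fin.
- exact: (measurable_int mu If).
- by move=> z _; rewrite lee_fin.
- exact: (measurable_int mu Ig).
- by apply: filterS fg => z fg _; rewrite lee_fin.
Qed.

Lemma measurable_enorm_ball (r : R) : measurable [set x : vec3 R | enorm x <= r].
Proof.
rewrite -[X in measurable X]setTI.
rewrite (_ : [set x | _] = (@enorm R) @^-1` `]-oo, r]%classic); first exact: measurable_enorm.
by apply/seteqP; split => x /=; rewrite in_itv.
Qed.

(** A line parallel to the third axis meets the sphere in at most two points. *)
Lemma sphere_null (s : R) : {ae lb3, forall v, enorm v ^+ 2 <> s}.
Proof.
pose A : set (vec3 R) := [set v | enorm v ^+ 2 = s].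
have mA : measurable A.
  have m2 : measurable_fun setT (fun v : vec3 R => enorm v ^+ 2).
    by apply: measurable_funX; exact: measurable_enorm.
  by have := m2 measurableT [set s] (measurable_set1 s); rewrite setTI.
exists A; split => //; last by move=> v /= /contrapT.
transitivity (\int[leb2]_p (@lebesgue_measure R) (xsection A p))%E; first by [].
apply: integral0_eq => -[a b] _.
have neg1 (t : R) : (@lebesgue_measure R).-negligible [set t].
  by exists [set t]; split; [exact: measurable_set1|exact: lebesgue_measure_set1|].
apply: measure_negligible; first exact: measurable_xsection.
pose u := s - a ^+ 2 - b ^+ 2.
apply: (negligibleS _ (negligibleU (neg1 (Num.sqrt u)) (neg1 (- Num.sqrt u)))).
move=> t; rewrite /xsection /= inE /A /= /enorm /= sqr_sqrtr; last first.
  by rewrite !addr_ge0 ?sqr_ge0.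
move=> h; have tu : t ^+ 2 = u by rewrite /u -h; ring.
rewrite -tu sqrtr_sqr; have [t0|t0] := leP 0 t; first by left; rewrite /= ger0_norm.
by right; rewrite /= ltr0_norm// opprK.
Qed.

(** At a fixed position the level set is a sphere in velocity space, or empty. *)
Lemma energy_level_null (U : vec3 R -> R) (c : R) : measurable_fun setT U ->
  {ae M2, forall z, kin z + U z.1 <> c}.
Proof.
move=> mU; pose A : set (phase R) := [set z | kin z + U z.1 = c].
have mA : measurable A.
  have m2 : measurable_fun setT (fun z : phase R => kin z + U z.1).
    apply: measurable_funD; first exact: measurable_kin.
    exact: (measurableT_comp mU measurable_fst).
  by have := m2 measurableT [set c] (measurable_set1 c); rewrite setTI.
exists A; split => //; last by move=> v /= /contrapT.
transitivity (\int[lb3]_x lb3 (xsection A x))%E; first by [].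
apply: integral0_eq => x _.
apply: measure_negligible; first exact: measurable_xsection.
apply: (negligibleS _ (sphere_null (2 * (c - U x)))).
move=> v; rewrite /xsection /= inE /A /= /kin /= => h; apply; rewrite -h; by field.
Qed.

(** One of the two terms alone suffices, according to whether a is below th c^(1 / (r - 1)). The
    weight [th] can be taken small in front of the kernel term. *)
Lemma young_level (a c th r : R) : 0 <= a -> 0 <= c -> 0 < th -> 1 < r ->
  a * c <= th * c `^ (r / (r - 1)) + th `^ (1 - r) * a `^ r.
Proof.
move=> a0 c0 th0 r1.
have r10 : 0 < r - 1 by rewrite subr_gt0.
have T1 : 0 <= th * c `^ (r / (r - 1)) by rewrite mulr_ge0 ?powR_ge0// ltW.
have T2 : 0 <= th `^ (1 - r) * a `^ r by rewrite mulr_ge0 ?powR_ge0.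
have [->|an] := eqVneq a 0; first by rewrite mul0r addr_ge0 ?mulr_ge0 ?powR_ge0// ltW.
have [->|cn] := eqVneq c 0; first by rewrite mulr0 addr_ge0 ?mulr_ge0 ?powR_ge0// ltW.
have ap : 0 < a by rewrite lt0r an.
have cp : 0 < c by rewrite lt0r cn.
have rE : r / (r - 1) = 1 + (r - 1)^-1 by field; rewrite gt_eqF.
have [h|h] := leP a (th * c `^ ((r - 1)^-1)).
  apply: le_trans (_ : _ <= th * c `^ (r / (r - 1))) _; last by rewrite lerDl.
  by rewrite rE -powRD_gt0// powRr1// mulrCA [leLHS]mulrC ler_pM2l.
apply: le_trans (_ : _ <= th `^ (1 - r) * a `^ r) _; last by rewrite lerDr.
have cle : c <= (a / th) `^ (r - 1).
  have -> : c = (c `^ ((r - 1)^-1)) `^ (r - 1).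
    by rewrite -powRrM mulVf ?gt_eqF// powRr1.
  apply: powR_le2; rewrite ?powR_ge0 ?(ltW r10)//.
  by rewrite ler_pdivlMr// mulrC ltW.
have -> : th `^ (1 - r) * a `^ r = a * (a / th) `^ (r - 1).
  have -> : a `^ r = a * a `^ (r - 1).
    by rewrite -{2}(powRr1 a0) (powRD_gt0 1 (r - 1) ap); congr (_ `^ _); ring.
  rewrite powRM ?invr_ge0 ?(ltW th0)// -(powR_inv1 (ltW th0)) -powRrM.
  rewrite (_ : -1 * (r - 1) = 1 - r); by ring.
by rewrite ler_pM2l.
Qed.

Lemma enorm_le_box (s : R) x : 0 <= s -> inbox s x -> enorm x <= 2 * s.
Proof.
move=> s0 /boxsetP/enorm_box h.
have s2 : 0 <= 2 * s by rewrite mulr_ge0.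
apply: (le_of_sqr (enorm_ge0 x) s2); apply: le_trans h _.
have : 0 <= s ^+ 2 by exact: sqr_ge0.
rewrite exprMn; lra.
Qed.

Lemma tail_cvg0 (a : vec3 R -> R) : (forall y, 0 <= a y) -> integ lb3 a ->
  (\int[lb3]_y (a y * (1 - \1_(boxn n) y)))%R @[n --> \oo] --> (0 : R).
Proof.
move=> a0 Ia; have ma := integ_measurable Ia.
rewrite (_ : 0 = (\int[lb3]_y (0 : R))%R); last by rewrite /Rintegral integral0.
apply: (Rint_dominated (h := a)) => //.
- move=> n; apply: measurable_funM => //; apply: measurable_funB => //.
  by apply: measurable_indic; exact: measurable_boxset.
- move=> n y; rewrite normrM ger0_norm// indicE.
  by case: (_ \in _); rewrite ?subrr ?subr0 ?normr0 ?normr1 ?mulr0 ?mulr1.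
- move=> y; have : [set: vec3 R] y by [].
  rewrite -boxn_cover => -[N _ yN].
  apply: cvg_near_cst; exists N => // n /= Nn.
  by rewrite indicE mem_set ?subrr ?mulr0//; exact: boxn_nd yN.
Qed.

(** Beyond range [s] the kernel contributes at most 1 / s times the mass. Within range, Young's
    inequality pairs a^r with the q-th power of the kernel, and q = r / (r - 1) < 3 says precisely r
    > 3 / 2; for distant [x] only the small tail of a^r outside a box is within range. *)
Lemma newtonian_decay (a : vec3 R -> R) (r : R) : (forall y, 0 <= a y) -> integ lb3 a ->
  3 / 2 < r -> integ lb3 (fun y => a y `^ r) -> forall e : R, 0 < e ->
  exists r0 : R, forall x, r0 <= enorm x -> (\int[lb3]_y (a y * coulK x y))%R < e.
Proof.
move=> a0 Ia r32 Iar e e0; have ma := integ_measurable Ia.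
have r1 : 1 < r by lra.
have r10 : 0 < r - 1 by lra.
pose q := r / (r - 1).
have q0 : 0 < q by rewrite divr_gt0//; lra.
have q3 : q < 3 by rewrite /q ltr_pdivrMr//; lra.
pose N := (\int[lb3]_y a y)%R.
have N0 : 0 <= N by apply: Rintegral_ge0.
(* Each of the three terms is to be at most e / 4: [s] is the range, [th] the Young weight, and
   outside the box of index [n0] the tail of a^r is small. *)
pose s := 4 * (N + 1) / e.
have N1 : 0 < N + 1 by lra.
have s0 : 0 < s by rewrite /s !mulr_gt0// invr_gt0.
have [c c0 Hc] := near_ker_powR_bound q0 q3 s0.
pose th := e / (4 * (c + 1)).
have c1 : 0 < 4 * (c + 1) by lra.
have th0 : 0 < th by rewrite divr_gt0.
pose A n := (\int[lb3]_y (a y `^ r * (1 - \1_(boxn n) y)))%R.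
have A0 : A n @[n --> \oo] --> (0 : R) by apply: tail_cvg0 => // y; exact: powR_ge0.
have d0 : 0 < e / 4 / th `^ (1 - r) by rewrite !divr_gt0// powR_gt0.
have /cvgrPdist_lt/(_ _ d0) [n0 _ Hn0] := A0.
have An : th `^ (1 - r) * A n0 < e / 4.
  have := Hn0 n0 (leqnn _); rewrite /= sub0r normrN => /(le_lt_trans (ler_norm _)).
  by rewrite ltr_pdivlMr ?powR_gt0// mulrC.
(* The cube of half-side n0 + s lies in the ball of twice that radius, as the square root of 3 is
   below 2. *)
exists (2 * (n0%:R + s) + 1) => x xr.
have ns0 : 0 <= n0%:R + s by rewrite addr_ge0// ltW.
have far y : boxn n0 y -> near_ker s x y = 0.
  move=> /boxsetP /and3P[y1 y2 y3]; rewrite /near_ker /near_pow; case: ifPn => // /and3P[z1 z2 z3].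
  have t (u w : R) : `|w| <= n0%:R -> `|u - w| <= s -> `|u| <= n0%:R + s.
    move=> hw huw; rewrite -[u](subrK w) addrC.
    by apply: le_trans (ler_normD _ _) _; exact: lerD.
  have : inbox (n0%:R + s) x.
    by apply/and3P; split; [exact: t y1 z1|exact: t y2 z2|exact: t y3 z3].
  move=> /(enorm_le_box ns0) h; exfalso; lra.
have mb : measurable_fun setT (\1_(boxn n0) : vec3 R -> R).
  by apply: measurable_indic; exact: measurable_boxset.
have Ik : integ lb3 (fun y => near_ker s x y `^ q).
  exact: (integ_kap_q (measurable_near_ker s) Hc).
have ib01 y : 0 <= 1 - (\1_(boxn n0) y : R) <= 1.
  by rewrite indicE; case: (_ \in _); rewrite ?subrr ?subr0 ?lexx ?ler01.
have It : integ lb3 (fun y => a y `^ r * (1 - \1_(boxn n0) y)).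
  apply: (integ_le _ _ Iar).
    by apply: measurable_funM; [exact: (measurableT_comp (measurable_powR _) ma)|exact: measurable_funB].
  move=> y; have /andP[h1 h2] := ib01 y.
  by rewrite ger0_norm ?mulr_ge0 ?powR_ge0// ler_piMr// powR_ge0.
have Isum := integD (integD (integZ th Ik) (integZ (th `^ (1 - r)) It)) (integZ s^-1 Ia).
have pw y : a y * coulK x y <= th * near_ker s x y `^ q +
    th `^ (1 - r) * (a y `^ r * (1 - \1_(boxn n0) y)) + s^-1 * a y.
  apply: le_trans (_ : _ <= a y * near_ker s x y + s^-1 * a y) _.
    by rewrite mulrC [s^-1 * _]mulrC -mulrDr [leLHS]mulrC ler_wpM2l// coulK_le.
  rewrite lerD2r; have [yb|yb] := pselect (boxn n0 y).
    rewrite far// mulr0; apply: addr_ge0; apply: mulr_ge0; rewrite ?powR_ge0 ?(ltW th0)//.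
    by apply: mulr_ge0; [exact: powR_ge0|have /andP[] := ib01 y].
  rewrite indicE memNset// subr0 mulr1.
  by apply: young_level => //; exact: near_ker_ge0.
have mK1 : measurable_fun setT (coulK x).
  by apply: (measurableT_comp measurable_coulK (g := fun y => (x, y))); exact: measurable_fun_pair.
have IaK : integ lb3 (fun y => a y * coulK x y).
  apply: (integ_le _ _ Isum); first exact: measurable_funM.
  by move=> y; rewrite ger0_norm// mulr_ge0// coulK_ge0.
apply: le_lt_trans (Rint_le IaK Isum pw) _.
rewrite (RintD (integD (integZ th Ik) (integZ (th `^ (1 - r)) It)) (integZ s^-1 Ia)).
rewrite (RintD (integZ th Ik) (integZ (th `^ (1 - r)) It)).
rewrite (RintZ _ Ik) (RintZ _ It) (RintZ _ Ia) -/(A n0) -/N.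
have k1 : th * (\int[lb3]_y (near_ker s x y `^ q))%R <= e / 4.
  apply: (@le_trans _ _ (th * c)).
    by rewrite ler_pM2l// -lee_fin (EFin_Rint Ik); exact: Hc.
  rewrite /th mulrAC ler_pdivrMr// -mulrA ler_pM2l//; lra.
have k2 : s^-1 * N <= e / 4.
  rewrite ler_pdivrMl// /s; have -> : 4 * (N + 1) / e * (e / 4) = N + 1.
    by field; rewrite gt_eqF.
  lra.
lra.
Qed.

Lemma test_function_C2c (psi : vec3 R -> R) : test_function psi ->
  exists2 r : R, 0 < r & C2c psi r.
Proof.
move=> [smooth [r supp]]; exists (Num.max r 1); first by rewrite lt_max ltr01 orbT.
have [c0 h1] := smooth 2%N.
split => //.
- by move=> e x; have [h _] := h1 e; exact: h.
- by move=> e; have [_ []] := h1 e.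
- by move=> e x; have [_ [_ h2]] := h1 e; have [h _] := h2 e; exact: h.
split; first by move=> e; have [_ [_ h2]] := h1 e; have [_ []] := h2 e.
move=> x /inbox_out h; apply: supp; apply: le_lt_trans h.
by rewrite le_max lexx.
Qed.

End steady.

(** * The formula for the minimizer, and why it is a steady state *)

Section steady_minimizer.
Context {R : realType}.
Variables (Q : R -> R) (C k M : R) (f : phase R -> R).
Hypothesis Q_C1 : hC1 Q.
Hypothesis Q_ge0 : forall s : R, 0 <= s -> 0 <= Q s.
Hypothesis Q_0 : Q 0 = 0.
Hypothesis C_gt0 : 0 < C.
Hypothesis k_gt0 : 0 < k.
Hypothesis k_lt : k < 7 / 2.
Hypothesis Q1 : forall s : R, 0 <= s -> C * (s + s `^ (1 + 1 / k)) <= Q s.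
Hypothesis Q2 : convex_function (`[0, +oo[%classic : set R^o) (Q : R^o -> R^o).
Hypothesis M_gt0 : 0 < M.
Hypothesis f_min : minimizer Q M f.
Local Notation lb3 := (@leb3 R).
Local Notation M2 := (lb3 \x lb3)%E.
Local Notation Q' := (hderive Q).
Local Notation rho := (dens lb3 f).
Local Notation V := (pot lb3 coulK f).
Variable lam : R.
Hypothesis EL : {ae M2, forall z,
  lam * Q' (f z) <= kin z - V z.1 /\ (0 < f z -> kin z - V z.1 = lam * Q' (f z))}.
Hypothesis lam0 : lam < 0.

Let f_ge0 := minimizer_ge0 f_min.
Let If : integ M2 f := minimizer_integ f_min.
Let mf := integ_measurable If.
Let IT := minimizer_integ_kin f_min.
Let Icoul := minimizer_integ_coul Q_C1 Q_ge0 Q_0 C_gt0 k_gt0 k_lt Q1 Q2 f_min.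
Let Irho : integ lb3 rho := minimizer_integ_dens f_min.
Let mrho := integ_measurable Irho.
Let rho_ge0 x : 0 <= rho x. Proof. exact: dens_ge0. Qed.
Let mV : measurable_fun setT V.
Proof. by apply: measurable_pot; [exact: measurable_coulK|exact: mf]. Qed.
Let V_ge0 x : 0 <= V x. Proof. by apply: pot_ge0; [exact: coulK_ge0|exact: f_ge0]. Qed.
Let V_ae := minimizer_pot_ae f_min.
Let mQ' : measurable_fun setT (fun z => Q' (f z)).
Proof. by have [] := measurable_Qc Q_C1 Q_0 C_gt0 Q1 Q2 mf f_ge0. Qed.
Let Q'_geC z : C <= Q' (f z).
Proof. exact: (Q'_geC Q_C1 Q_0 C_gt0 Q1 Q2 (f_ge0 z)). Qed.

(** Multiplied by [f], the Euler-Lagrange relation becomes an equality almost everywhere, also where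
    [f] vanishes, and can be integrated. The denominator is at least C times the positive mass. *)
Lemma multiplier_eq :
  (\int[M2]_z ((kin z - V z.1) * f z))%R / (\int[M2]_z (Q' (f z) * f z))%R = lam.
Proof.
have [IfV _] := integ_fpot coulK_ge0 measurable_coulK f_ge0 If Icoul.
have IE : integ M2 (fun z => (kin z - V z.1) * f z).
  have := integB IT IfV; congr (is_true (integ _ _)).
  by apply/funext => z; ring.
have aeq : {ae M2, forall z, (kin z - V z.1) * f z = lam * (Q' (f z) * f z)}.
  apply: filterS EL => z [_ h]; have [->|fn] := eqVneq (f z) 0; first by rewrite !mulr0.
  by rewrite h ?mulrA// lt0r fn f_ge0.
have mQf : measurable_fun setT (fun z => Q' (f z) * f z) by exact: measurable_funM.
have IQ : integ M2 (fun z => Q' (f z) * f z).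
  apply: (integ_ae_eq mQf _ (integZ lam^-1 IE)).
  by apply: filterS aeq => z ->; rewrite mulrA mulVf ?mul1r// lt_eqF.
rewrite (Rint_ae_eq (integ_measurable IE) (integ_measurable (integZ lam IQ)) aeq).
rewrite (RintZ _ IQ) mulfK// gt_eqF//.
have If0 : 0 < (\int[M2]_z f z)%R.
  rewrite lt0r Rintegral_ge0// andbT; apply/eqP => h.
  apply: (minimizer_neq0 Q_C1 Q_0 C_gt0 Q1 Q2 M_gt0 f_min); exact: (Rint_ge0_eq0 If f_ge0 h).
apply: (@lt_le_trans _ _ (C * (\int[M2]_z f z)%R)); first exact: mulr_gt0.
rewrite -(RintZ _ If); apply: (Rint_le (integZ C If) IQ) => z.
by rewrite ler_wpM2r.
Qed.

(** The infimum is f z unless Q' is constant on an interval ending at f z. Such an interval contains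
    a rational q, so E takes the value lam Q' q, one of countably many null levels. *)
Lemma minimizer_formula : {ae M2, forall z, f z =
  if kin z - V z.1 < lam * Q' 0 then inf [set s | 0 <= s /\ Q' s = (kin z - V z.1) / lam] else 0}.
Proof.
(* [unpickle] enumerates the rationals, so that countably many null sets are removed at once. *)
have null : {ae M2, forall z, forall n : nat, forall q : rat, unpickle n = Some q ->
    kin z - V z.1 <> lam * Q' (ratr q)}.
  apply/ae_foralln => n; case: (unpickle n) => [q|]; last by apply: aeW.
  have := energy_level_null (lam * Q' (ratr q)) (measurable_funN mV).
  by apply: filterS => z h q' [<-].
apply: filterS2 EL null => z [h1 h2] h3.
have {}h3 (q : rat) : kin z - V z.1 <> lam * Q' (ratr q).
  by apply: (h3 (pickle q)); exact: pickleK.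
(* The level of the rational 0 is lam Q' 0; avoiding it makes the inequality in the formula strict
   wherever f > 0. *)
have h30 := h3 0; rewrite rmorph0 in h30.
set e := kin z - V z.1 in h1 h2 h3 h30 *.
have [f0|fn] := eqVneq (f z) 0.
  by rewrite f0; case: ifPn => // he; move: h1; rewrite f0 leNgt he.
have fp : 0 < f z by rewrite lt0r fn f_ge0.
have ee := h2 fp.
have mono s t : 0 <= s -> s <= t -> Q' s <= Q' t.
  exact: (Q'_nondecreasing Q_C1 Q2).
have elt : e < lam * Q' 0.
  rewrite lt_neqAle; apply/andP; split; first exact/eqP.
  by rewrite ee ler_nM2l// mono.
rewrite elt.
have eq : e / lam = Q' (f z) by rewrite ee mulrAC divff ?mul1r// lt_eqF.
set S := [set s | _].
have Sf : S (f z) by split.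
have lbS : lbound S (f z).
  move=> s [s0 Qs]; rewrite leNgt; apply/negP => sf.
  have [q] := rat_in_itvoo sf; rewrite in_itv/= => /andP[sq qf].
  apply: (h3 q); rewrite ee; congr (_ * _); apply/le_anti.
  rewrite -{1}eq -Qs mono ?(ltW sq)//= mono ?(ltW qf)//.
  by rewrite (le_trans s0)// ltW.
apply/le_anti; rewrite lb_le_inf ?ge_inf//; first by exists (f z).
by exists (f z).
Qed.

(** Where f > 0, the relation and Q' >= C give E <= lam C, so the potential V is at least this
    threshold. *)
Let e0 := - lam * C.
Let e0_gt0 : 0 < e0. Proof. by rewrite mulr_gt0// oppr_gt0. Qed.

(** The relation and Q' >= C (1 + f^(1/k)) give f <= (V / e0)^k, with f supported in |v| <= sqrt (2
    V); the cube of that half-side has volume 8 (2 V)^(3/2). Below the threshold f vanishes. *)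
Lemma density_le_potential : {ae lb3, forall x,
  rho x <= 8 * 2 `^ (3 / 2) * e0^-1 `^ k * V x `^ (k + 3 / 2) /\ (V x < e0 -> rho x = 0)}.
Proof.
apply: filterS2 (ae_prod EL) (integ_prod_ae1 If) => x ELx Ifx.
set P := V x; have P0 : 0 <= P by exact: V_ge0.
have e0V0 : 0 <= e0^-1 by rewrite invr_ge0 ltW.
have key v : 0 < f (x, v) -> kin (x, v) - P = lam * Q' (f (x, v)) ->
    [/\ e0 <= P, kin (x, v) <= P & f (x, v) <= (P / e0) `^ k].
  move=> fp h; have f0 := ltW fp.
  have := Q'_ge Q_C1 Q_0 C_gt0 k_gt0 Q1 Q2 f0.
  rewrite -(ler_nM2l lam0) -h => h'.
  have {}h' : e0 * (1 + f (x, v) `^ (1 / k)) <= P - kin (x, v).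
    by rewrite /e0; lra.
  have t0 := kin_ge0 (x, v).
  have fk0 : 0 <= f (x, v) `^ (1 / k) by exact: powR_ge0.
  have ef0 : 0 <= e0 * f (x, v) `^ (1 / k) by rewrite mulr_ge0// ltW.
  split; [lra|have := e0_gt0; lra|].
  have -> : f (x, v) = (f (x, v) `^ (1 / k)) `^ k.
    by rewrite -powRrM div1r mulVf ?gt_eqF// powRr1.
  apply: powR_le2; rewrite ?(ltW k_gt0)//.
  by rewrite ler_pdivlMr// mulrC; have := e0_gt0; lra.
have [Pe|Pe] := ltP P e0.
  have r0 : rho x = 0.
    transitivity (\int[lb3]_v (0 : R))%R; last by rewrite /Rintegral integral0.
    apply: Rint_ae_eq; [exact: integ_measurable Ifx|exact: measurable_cst|].
    apply: filterS ELx => v [_ h]; apply/eqP; rewrite eq_le f_ge0 andbT leNgt.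
    apply/negP => fp; have [eP _ _] := key v fp (h fp).
    by move: Pe; rewrite ltNge eP.
  split; last by rewrite r0.
  by rewrite r0 !mulr_ge0 ?powR_ge0.
split => //.
have Pp : 0 < P by rewrite (lt_le_trans e0_gt0).
pose s := Num.sqrt (2 * P).
have s0 : 0 < s by rewrite sqrtr_gt0 mulr_gt0.
have Ib := @integ_indic_boxset R s.
have Pk : 0 <= (P / e0) `^ k by exact: powR_ge0.
have : rho x <= (P / e0) `^ k * (\int[lb3]_v \1_(boxset s) v)%R.
  rewrite -(RintZ _ Ib); apply: Rint_ae_le => //.
  - exact: integZ.
  - by move=> v; rewrite mulr_ge0.
  apply: filterS ELx => v [_ h]; have [->|fn] := eqVneq (f (x, v)) 0.
    by rewrite mulr_ge0.
  have fp : 0 < f (x, v) by rewrite lt0r fn f_ge0.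
  have [_ kP fP] := key v fp (h fp).
  rewrite indicE mem_set ?mulr1//; apply/boxsetP.
  have vs : enorm v <= s.
    rewrite /s -(ger0_norm (enorm_ge0 v)) -sqrtr_sqr; apply: ler_wsqrtr.
    by move: kP; rewrite /kin /=; lra.
  have [n1 n2 n3] := enorm_ge v.
  by rewrite /inbox !(le_trans _ vs).
rewrite (_ : (\int[lb3]_v \1_(boxset s) v)%R = 8 * s ^+ 3); last first.
  rewrite /Rintegral integral_indic//; last exact: measurable_boxset.
  by rewrite setIT; exact: (congr1 fine (leb3_boxset s0)).
have -> : s ^+ 3 = 2 `^ (3 / 2) * P `^ (3 / 2).
  rewrite -powRM// /s -powR12_sqrt ?mulr_ge0// -powR_mulrn ?powR_ge0// -powRrM.
  by congr (_ `^ _); rewrite mulrC.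
move=> h; apply: le_trans h _.
rewrite powRM// -(powRD_gt0 k (3 / 2) Pp) le_eqVlt; apply/orP; left; apply/eqP; ring.
Qed.

(** The bootstrap asks for a bound by a power of the cut-off potential J. At range [s] the far part
    of V is at most e0 / 2, and the density vanishes unless V >= e0; hence V <= 2 J wherever the
    density is nonzero. *)
Lemma density_higher_integ : exists2 r, 3 / 2 < r & integ lb3 (fun x => rho x `^ r).
Proof.
pose n := k + 3 / 2.
pose N := (\int[lb3]_y rho y)%R.
have N0 : 0 <= N by apply: Rintegral_ge0.
pose s := 2 * (N + 1) / e0.
have N1 : 0 < N + 1 by lra.
have s0 : 0 < s by rewrite divr_gt0// mulr_gt0.
pose b1 := 8 * 2 `^ (3 / 2) * e0^-1 `^ k.
have b10 : 0 <= b1 by rewrite !mulr_ge0 ?powR_ge0.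
have n1 : 1 < n by have K := k_gt0; rewrite /n; lra.
have n5 : n < 5 by have K := k_lt; rewrite /n; lra.
have b0 : 0 <= b1 * 2 `^ n by rewrite mulr_ge0 ?powR_ge0.
apply: (bootstrap (@near_ker_ge0 R s) (measurable_near_ker s) (near_kerC s) _ rho_ge0 mrho n1 n5 b0).
- by move=> q q0 q3; exact: near_ker_powR_bound.
- apply: (density_integ_pow k_gt0 f_ge0 If IT).
  exact: (integ_f_pow Q_C1 Q_ge0 Q_0 C_gt0 Q1 Q2 f_min).
apply: filterS2 density_le_potential V_ae => x [h1 h2] Ix.
have mk1 : measurable_fun setT (near_ker s x).
  by apply: (measurableT_comp (measurable_near_ker s) (g := fun y => (x, y))); exact: measurable_fun_pair.
have Ink : integ lb3 (fun y => rho y * near_ker s x y).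
  apply: (integ_le _ _ Ix); first exact: measurable_funM.
  by move=> y; rewrite ger0_norm ?mulr_ge0 ?near_ker_ge0// ler_wpM2l// near_ker_le.
set J := (\int[lb3]_y (rho y * near_ker s x y))%R.
have J0 : 0 <= J by apply: Rintegral_ge0 => y _; rewrite mulr_ge0 ?near_ker_ge0.
have [Ve|Ve] := ltP (V x) e0.
  by rewrite [leLHS](h2 Ve); exact: mulr_ge0 b0 (powR_ge0 _ _).
have VJ : V x <= J + s^-1 * N.
  rewrite -(RintZ _ Irho) -(RintD Ink (integZ s^-1 Irho)).
  apply: (Rint_le Ix (integD Ink (integZ s^-1 Irho))) => y.
  by rewrite [s^-1 * _]mulrC -mulrDr ler_wpM2l// coulK_le.
have sN : s^-1 * N <= e0 / 2.
  rewrite ler_pdivrMl// /s (_ : 2 * (N + 1) / e0 * (e0 / 2) = N + 1); first lra.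
  by field; rewrite gt_eqF.
have V2J : V x <= 2 * J by lra.
apply: le_trans h1 _; rewrite -/n -/b1 -mulrA ler_wpM2l//.
rewrite -powRM//; apply: powR_le2 => //; lra.
Qed.

Lemma potential_vanishes : vanishes_at_infinity (fun x => - V x).
Proof.
have [r r32 Ir] := density_higher_integ.
move=> e e_gt0; have [r0 H] := newtonian_decay rho_ge0 Irho r32 Ir e_gt0.
by exists r0 => x /H; rewrite normrN ger0_norm.
Qed.

Let pick_n (r : R) : exists n, boxset r `<=` boxn n.
Proof.
exists (Num.truncn r).+1; apply: boxset_mono; exact: ltW (truncnS_gt _).
Qed.

Lemma locally_L1_V : locally_L1 (fun x => - V x).
Proof.
move=> r; have [n Hn] := pick_n r.
have [c [c0 Kc]] := @integral_boxset_coulK R.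
have ID := integ_potD coulK_ge0 measurable_coulK coulKC (measurable_boxset n%:R) (Kc n) Irho.
have mB := measurable_enorm_ball r.
have I2 := integrableS measurableT mB (@subsetT _ _) ID.
have I3 := integrableN I2; move: I3; apply: eq_integrable; first exact: mB.
move=> x; rewrite inE /= => xr; rewrite indicE mem_set ?mul1r//.
apply: Hn; apply/boxsetP; have [n1 n2 n3] := enorm_ge x.
by rewrite /inbox !(le_trans _ xr).
Qed.

Lemma locally_L1_rho : locally_L1 rho.
Proof.
move=> r; exact: (integrableS measurableT (measurable_enorm_ball r) (@subsetT _ _) Irho).
Qed.

(** Fubini moves the kernel onto the test function, where the fundamental solution applies at every
    point. In the other order the inner integral is V times the Laplacian at almost every point,
    namely where the integral defining V converges. *)
Lemma poisson_V : poisson (fun x => - V x) rho.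
Proof.
split; [exact: locally_L1_V|exact: locally_L1_rho|move=> psi /test_function_C2c [r r0 pC]].
have cL := continuous_laplacian pC; have mL := continuous_vec3_measurable cL.
have [B B0 HB] := bounded_support cL (laplacian_support pC).
have [n Hn] := pick_n r.
have [c [c0 Kc]] := @integral_boxset_coulK R.
have ID := integ_aDK coulK_ge0 measurable_coulK (measurable_boxset n%:R) (Kc n) (integ_norm Irho).
have IF : integ M2 (fun z => rho z.1 * (coulK z.1 z.2 * laplacian psi z.2)).
  apply: (integ_le _ _ (integZ B ID)).
    apply: measurable_funM; first exact: (measurableT_comp mrho measurable_fst).
    apply: measurable_funM; first exact: measurable_coulK.
    exact: (measurableT_comp mL measurable_snd).
  move=> z; rewrite !normrM (ger0_norm (coulK_ge0 _ _)).
  have -> : B * (`|rho z.1| * (\1_(boxset n%:R) z.2 * coulK z.1 z.2)) =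
    `|rho z.1| * (coulK z.1 z.2 * (B * \1_(boxset n%:R) z.2)) by ring.
  rewrite ler_wpM2l// ler_wpM2l ?coulK_ge0//; apply: le_trans (HB z.2) _.
  by rewrite ler_wpM2l//; exact: le_indic.
have E1 : (\int[M2]_z (rho z.1 * (coulK z.1 z.2 * laplacian psi z.2)) =
    \int[lb3]_y (rho y * (- (4 * pi * psi y))))%R.
  rewrite -(Rint_fubini1 IF); congr fine; apply: eq_integral => y _; congr EFin.
  have [IN <-] := newton_potential r0 pC y.
  rewrite -(RintZ _ IN); congr fine; apply: eq_integral => x _.
  by rewrite /= coulKC.
have [Ix E2] := Rint_fubini2 IF.
have mVL : measurable_fun setT (fun x => V x * laplacian psi x) by exact: measurable_funM.
have E3 : (\int[lb3]_x \int[lb3]_y (rho y * (coulK y x * laplacian psi x)) =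
    \int[lb3]_x (V x * laplacian psi x))%R.
  apply: Rint_ae_eq => //; first exact: (integ_measurable Ix).
  apply: filterS V_ae => x Ivx; rewrite mulrC -(RintZ _ Ivx).
  by congr fine; apply: eq_integral => y _; congr EFin; rewrite /= (coulKC y x); ring.
have IVL : integ lb3 (fun x => V x * laplacian psi x).
  apply: (integ_ae_eq mVL _ Ix).
  apply: filterS V_ae => x Ivx; rewrite mulrC -(RintZ _ Ivx).
  by congr fine; apply: eq_integral => y _; congr EFin; rewrite /= (coulKC y x); ring.
have cpsi : continuous psi by case: pC.
have spsi x : ~~ inbox r x -> psi x = 0 by case: pC => _ _ _ _ [_]; apply.
have [B2 B20 HB2] := bounded_support cpsi spsi.
have Irp : integ lb3 (fun y => rho y * psi y).
  apply: (integ_le _ _ (integZ B2 (integ_norm Irho))).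
    by apply: measurable_funM => //; exact: continuous_vec3_measurable.
  move=> y; rewrite normrM mulrC ler_wpM2r//; apply: le_trans (HB2 y) _.
  exact: mulr_indic_le.
transitivity (- \int[lb3]_x (V x * laplacian psi x))%R.
  rewrite -mulN1r -(RintZ _ IVL); congr fine; apply: eq_integral => x _.
  by congr EFin; ring.
rewrite -E3 E2 E1 -(RintZ _ Irp) -mulN1r.
have I4 := integZ (4 * pi) Irp.
have I5 : integ lb3 (fun y => rho y * (- (4 * pi * psi y))).
  have := integZ (-1) I4; congr (is_true (integ _ _)).
  by apply/funext => y; ring.
rewrite -(RintZ _ I5); congr fine; apply: eq_integral => y _.
by congr EFin; ring.
Qed.

End steady_minimizer.

Theorem theorem2 (R : realType) (Q : R -> R) (C k M : R) (f0 : phase R -> R)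
  (Q_C1 : hC1 Q)
  (Q_ge0 : forall s : R, 0 <= s -> 0 <= Q s)
  (Q_0 : Q 0 = 0)
  (C_gt0 : 0 < C) (k_gt0 : 0 < k) (k_lt : k < 7 / 2)
  (Q1 : forall s : R, 0 <= s -> C * (s + s `^ (1 + 1 / k)) <= Q s)
  (Q2 : convex_function (`[0, +oo[%classic : set R^o) (Q : R^o -> R^o))
  (M_gt0 : 0 < M)
  (f0_min : minimizer Q M f0) :
  let U0 := potential f0 in
  let E := particle_energy U0 in
  let lambda0 := (\int[leb6]_z (E z * f0 z))%R /
                 (\int[leb6]_z (hderive Q (f0 z) * f0 z))%R in
  let E0 := lambda0 * hderive Q 0 in
  let phi := fun eta : R =>
    inf [set s | 0 <= s /\ hderive Q s = eta / lambda0] in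
  [/\ lambda0 < 0,
      {ae leb6, forall z, f0 z = if E z < E0 then phi (E z) else 0} &
      steady_state f0 U0].
Proof.
move=> U0 E lambda0 E0 phi.
have [lam EL] := minimizer_EL Q_C1 Q_ge0 Q_0 C_gt0 k_gt0 k_lt Q1 Q2 M_gt0 f0_min.
have lam_lt0 := multiplier_lt0 Q_C1 Q_0 C_gt0 Q1 Q2 M_gt0 f0_min EL.
(* The abstract multiplier is the quotient of the statement, so its sign and the formula carry
   over. *)
have lamE : lambda0 = lam.
  exact: (multiplier_eq Q_C1 Q_ge0 Q_0 C_gt0 k_gt0 k_lt Q1 Q2 M_gt0 f0_min EL lam_lt0).
have formula : {ae leb6, forall z, f0 z = if E z < E0 then phi (E z) else 0}.
  (* [E z] unfolds to [kin z - pot leb3 coulK f0 z.1], so the two formulas are convertible. *)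
  rewrite /E0 /phi lamE.
  exact: (minimizer_formula Q_C1 Q2 f0_min EL lam_lt0).
split => //; first by rewrite lamE.
split.
- by exists (fun e => if e < E0 then phi e else 0).
- exact: (poisson_V f0_min).
- exact: (potential_vanishes Q_C1 Q_ge0 Q_0 C_gt0 k_gt0 k_lt Q1 Q2 f0_min EL lam_lt0).
Qed.
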